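(* Let $\Omega\subseteq\mathbb{R}^n$ be open. Given $p(\cdot)\in\mathcal{P}(\Omega)$, suppose $1\le p_-\le p_+<\infty$ and $p(\cdot)\in LH(\Omega)$. Given a $d\times d$ matrix weight $W\in\mathcal{A}_{p(\cdot)}$, $$\mathscr{W}^{1,p(\cdot)}(W,\Omega)=\mathscr{H}^{1,p(\cdot)}(W,\Omega).$$
   Context: Exponents: $\mathcal{P}(\Omega)$ is the set of Lebesgue measurable $p(\cdot):\Omega\to[1,\infty]$; $p_-=\operatorname{ess\,inf}_\Omega p$, $p_+=\operatorname{ess\,sup}_\Omega p$; $1/p(x)+1/p'(x)=1$ with $1/\infty=0$. Modular: $\rho_{p(\cdot)}(f)=\int_{\Omega\setminus\Omega_\infty}|f(x)|^{p(x)}dx+\|f\|_{L^\infty(\Omega_\infty)}$, $\Omega_\infty=\{x\in\Omega:p(x)=\infty\}$. Norm: $\|f\|_{L^{p(\cdot)}(\Omega)}=\inf\{\lambda>0:\rho_{p(\cdot)}(f/\lambda)\le1\}$. Log-Hölder continuity: $p(\cdot)\in LH(\Omega)$ if there are constants $C_0,C_\infty,p_\infty$ with $|p(x)-p(y)|\le \frac{C_0}{-\log|x-y|}$ for all $x,y\in\Omega$ with $|x-y|<1/2$, and $|p(x)-p_\infty|\le\frac{C_\infty}{\log(e+|x|)}$ for all $x\in\Omega$. Matrix weights: $\mathcal{S}_d$ is the set of self-adjoint positive semidefinite $d\times d$ matrices; $|\cdot|_{\mathrm{op}}$ is the operator norm. A matrix weight on $\Omega$ is a measurable $W:\Omega\to\mathcal{S}_d$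 with $|W|_{\mathrm{op}}\in L^1_{\mathrm{loc}}(\Omega)$. $L^{p(\cdot)}(W,\Omega)$ is the set of measurable $\mathbf{f}:\Omega\to\mathbb{R}^d$ with $\|\mathbf{f}\|_{L^{p(\cdot)}(W,\Omega)}:=\||W\mathbf{f}|\|_{L^{p(\cdot)}(\Omega)}<\infty$. Matrix $\mathcal{A}_{p(\cdot)}$: $W\in\mathcal{A}_{p(\cdot)}(\Omega)$ means $$[W]_{\mathcal{A}_{p(\cdot)}}=\sup_{Q}|Q|^{-1}\Big\|\,\big\||W(x)W^{-1}(\cdot)|_{\mathrm{op}}\chi_Q(\cdot)\big\|_{L^{p'(\cdot)}(\Omega)}\chi_Q(x)\Big\|_{L^{p(\cdot)}_x(\Omega)}<\infty,$$ the supremum over cubes $Q\subset\Omega$, where $L^{p(\cdot)}_x$ indicates the norm in the variable $x$. Standing convention on the domain: a matrix weight $W$ on a domain $\Omega$ is implicitly assumed to satisfy this condition on some larger domain $\Omega'$ (not specified further), and reference to the domain is suppressed, so that one writes $W\in\mathcal{A}_{p(\cdot)}$ instead of $W\in\mathcal{A}_{p(\cdot)}(\Omega)$. Sobolev spaces: $\mathscr{W}^{1,1}_{\mathrm{loc}}(\Omega;\mathbb{R}^d)$ is the set of $\mathbf{f}=(f_1,\dots,f_d)^T\in L^1_{\mathrm{loc}}(\Omega;\mathbb{R}^d)$ all of whose weak first derivatives $\partial_jf_i$ exist in $L^1_{\mathrm{loc}}(\Omega)$; $D\mathbf{f}=(\partial_jf_i)_{i,j}$ is the $d\times n$ Jacobian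 matrix. $\mathscr{W}^{1,p(\cdot)}(W,\Omega)$ is the set of $\mathbf{f}\in\mathscr{W}^{1,1}_{\mathrm{loc}}(\Omega;\mathbb{R}^d)$ with $$\|\mathbf{f}\|_{\mathscr{W}^{1,p(\cdot)}(W,\Omega)}=\|\mathbf{f}\|_{L^{p(\cdot)}(W,\Omega)}+\||WD\mathbf{f}|_{\mathrm{op}}\|_{L^{p(\cdot)}(\Omega)}<\infty.$$ $\mathscr{H}^{1,p(\cdot)}(W,\Omega)$ is the closure of $C^\infty(\Omega;\mathbb{R}^d)\cap\mathscr{W}^{1,p(\cdot)}(W,\Omega)$ in $\mathscr{W}^{1,p(\cdot)}(W,\Omega)$. *)

(* Defs.v *)
From HB Require Import structures.
From mathcomp Require Import all_boot all_order all_algebra.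
From mathcomp Require Import all_classical all_reals all_analysis.
From mathcomp Require Import measurable_realfun.

Set Implicit Arguments.
Unset Strict Implicit.
Unset Printing Implicit Defensive.

Import Order.TTheory GRing.Theory Num.Theory.
Import numFieldNormedType.Exports.

Local Open Scope classical_set_scope.
Local Open Scope ring_scope.

(* The space dimension is written n.+1, so that it is positive; points of the
   space are column vectors. The norm provided by the library on 'cV[R]_n is
   the maximum norm: it serves for the topology only, all the estimates use
   the Euclidean norm. *)
Definition enorm (R : realType) (m : nat) (v : 'cV[R]_m) : R :=
  Num.sqrt (\sum_i v i 0 ^+ 2).

Definition opnorm (R : realType) (m k : nat) (A : 'M[R]_(m, k)) : R :=
  sup [set enorm (A *m v) | v in [set v : 'cV[R]_k | enorm v <= 1]].

(** Lebesgue measure: Caratheodory's construction from coverings by boxes *)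

Section lebesgue_outer_measure.
Context {R : realType} {n : nat}.
Local Notation Rn := 'cV[R]_n.+1.

Definition box (ab : Rn * Rn) : set Rn :=
  [set x | forall i, ab.1 i 0 < x i 0 <= ab.2 i 0].

Definition box_volume (ab : Rn * Rn) : R :=
  \prod_i Num.max 0 (ab.2 i 0 - ab.1 i 0).

Definition leb_outer (A : set Rn) : \bar R :=
  ereal_inf [set (\sum_(k <oo) (box_volume (B k))%:E)%E |
    B in [set B : nat -> Rn * Rn | A `<=` \bigcup_k box (B k)]].

Local Open Scope ereal_scope.

Lemma box_volume_ge0 ab : 0 <= (box_volume ab)%:E.
Proof. by rewrite lee_fin; apply: prodr_ge0 => i _; rewrite le_max lexx. Qed.

Lemma leb_outer_ge0 A : 0 <= leb_outer A.
Proof.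
apply: le_ereal_inf_tmp => _ [B _ <-].
by apply: nneseries_ge0 => k _ _; exact: box_volume_ge0.
Qed.

Lemma leb_outer0 : leb_outer set0 = 0.
Proof.
apply/eqP; rewrite eq_le leb_outer_ge0 andbT.
apply: ereal_inf_lbound; exists (fun=> (0%R, 0%R)); first exact: sub0set.
rewrite eseries0// => k _ _; rewrite /box_volume (bigD1 ord0)//=.
by rewrite subrr maxxx mul0r.
Qed.

Lemma le_leb_outer : {homo leb_outer : A B / A `<=` B >-> A <= B}.
Proof.
move=> A B AB; apply: ereal_inf_le_tmp => _ [C BC <-].
by exists C => //; exact: subset_trans BC.
Qed.

Lemma leb_outer_sigma_subadditive : sigma_subadditive leb_outer.
Proof.
move=> A; have [[i ioo]|] := pselect (exists i, leb_outer (A i) = +oo).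
  rewrite (eseries_pinfty _ _ ioo) ?leey// => k _.
  by rewrite -ltNye (lt_le_trans _ (leb_outer_ge0 _)).
rewrite -forallNE => Aoo.
suff add2e (e : {posnum R}) :
    leb_outer (\bigcup_k A k) <= \sum_(i <oo) leb_outer (A i) + e%:num%:E.
  by apply/lee_addgt0Pr => _/posnumP[].
rewrite (le_trans _ (epsilon_trick _ _ _))//; last first.
  by move=> k; exact: leb_outer_ge0.
pose vol (ab : Rn * Rn) := (box_volume ab)%:E.
pose P k (B : nat -> Rn * Rn) := A k `<=` \bigcup_j box (B j) /\
  \sum_(j <oo) vol (B j) <= leb_outer (A k) + (e%:num / (2 ^ k.+1)%:R)%:E.
have [G PG] : {G : nat -> nat -> Rn * Rn & forall k, P k (G k)}.
  apply: (@choice _ _ P) => k; rewrite /P.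
  have fA : leb_outer (A k) \is a fin_num.
    by rewrite ge0_fin_numE ?leb_outer_ge0// ltey; apply/eqP/Aoo.
  have en1 : (0 < e%:num / (2 ^ k.+1)%:R)%R by [].
  have [_ [B AB <-] ltB] := lb_ereal_inf_adherent en1 fA.
  by exists B; split => //; exact: ltW.
have volG_ge0 x : 0 <= (vol \o uncurry G) x by exact: box_volume_ge0.
apply: (@le_trans _ _ (\esum_(i in setT) (vol \o uncurry G) i)).
  apply: ereal_inf_lbound => /=.
  have /card_esym/ppcard_eqP[f] := card_nat2.
  exists (uncurry G \o f).
    move=> x [k _ Akx]; have [j _ ?] := (PG k).1 x Akx; exists (f^-1%FUN (k, j)) => //=.
    by rewrite invK ?inE.
  rewrite -(esum_pred_image (vol \o uncurry G) _ xpredT) ?[fun=> _]set_true//.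
  by rewrite image_eq.
rewrite (_ : esum _ _ = \sum_(i <oo) \sum_(j <oo ) vol (G i j)); last first.
  pose J : nat -> set (nat * nat) := fun i => [set (i, j) | j in setT].
  rewrite (_ : setT = \bigcup_k J k); last first.
    by rewrite predeqE => -[a b]; split => // _; exists a => //; exists b.
  rewrite esum_bigcupT /=; last 2 first.
    - apply/trivIsetP => i j _ _ ij.
      rewrite predeqE => -[k m] /=; split => //= -[] [_] _ [<-{k} _].
      by move=> [m' _] [] /esym/eqP; rewrite (negbTE ij).
    - by move=> /= [k m]; exact: box_volume_ge0.
  rewrite -(image_id [set: nat]) -fun_true esum_pred_image//; last first.
    by move=> k _; apply: esum_ge0 => x _; exact: volG_ge0.
  apply: eq_eseriesr => /= j _.
  rewrite -(esum_pred_image (vol \o uncurry G) (pair j) predT)//=; last first.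
    by move=> ? ? _ _; exact: (@can_inj _ _ _ snd).
    by move=> m _; exact: box_volume_ge0.
  by congr esum; rewrite predeqE => -[a b]; split; move=> [i _ <-]; exists i.
apply: lee_lim.
- apply: is_cvg_nneseries => k *.
  by apply: nneseries_ge0 => m *; exact: (volG_ge0 (k, m)).
- by apply: is_cvg_nneseries => k *; apply: adde_ge0 => //; exact: leb_outer_ge0.
- by near=> k; apply: lee_sum => i _; exact: (PG i).2.
Unshelve. all: by end_near. Qed.

HB.instance Definition _ := isOuterMeasure.Build R Rn leb_outer
  leb_outer0 leb_outer_ge0 le_leb_outer leb_outer_sigma_subadditive.

End lebesgue_outer_measure.

(* 'cV[R]_n.+1 equipped with the sigma-algebra of Lebesgue measurable sets *)
Definition lebT (R : realType) (n : nat) : Type :=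
  caratheodory_type (@leb_outer R n).

HB.instance Definition _ (R : realType) (n : nat) :=
  Measurable.on (lebT R n).

Definition leb (R : realType) (n : nat) : {measure set (lebT R n) -> \bar R} :=
  ((@leb_outer R n : {outer_measure set _ -> \bar R})
    : set (caratheodory_type (@leb_outer R n)) -> \bar R).

Section analysis.
Context {R : realType} {n : nat}.
Local Notation Rn := 'cV[R]_n.+1.
Local Notation mu := (leb R n).
Local Open Scope ereal_scope.
Implicit Types (p : Rn -> \bar R) (Omega : set Rn).

(** Variable exponents *)

Definition exponent p Omega : Prop :=
  measurable_fun (Omega : set (lebT R n)) (p : lebT R n -> \bar R) /\ forall x, Omega x -> 1 <= p x.

(* Same definitions as ess_inf and ess_sup in the library, but relative to
   Omega. *)
Definition ess_inf_on Omega (f : Rn -> \bar R) : \bar R :=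
  ereal_sup [set y | \forall x \ae mu, Omega x -> y <= f x].

Definition ess_sup_on Omega (f : Rn -> \bar R) : \bar R :=
  ereal_inf [set y | \forall x \ae mu, Omega x -> f x <= y].

(* For x = y the bound reads |p x - p x| <= 0, since ln 0 = 0 and 0^-1 = 0.
   As +oo - +oo is infinite, log_Hoelder forces p to be finite on Omega. *)
Definition log_Hoelder p Omega : Prop :=
  exists C0 Coo poo : R,
    (forall x y, Omega x -> Omega y -> (enorm (x - y)%R < 2^-1)%R ->
       `|p x - p y| <= (C0 / - ln (enorm (x - y)))%:E) /\
    (forall x, Omega x ->
       `|p x - poo%:E| <= (Coo / ln (expR 1 + enorm x))%:E).

(** Variable Lebesgue spaces *)

(* The infimum ranges over y >= 0, so that the norm is 0 when Omega is
   negligible. *)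
Definition Linfty_norm Omega (f : Rn -> \bar R) : \bar R :=
  ereal_inf [set y | 0 <= y /\ \forall x \ae mu, Omega x -> `|f x| <= y].

Definition modular p Omega (f : Rn -> \bar R) : \bar R :=
  let Omega_oo := [set x | Omega x /\ p x = +oo] in
  \int[mu]_(x in Omega `\` Omega_oo) `|f x| `^ fine (p x)
  + Linfty_norm Omega_oo f.

Definition Lp_norm p Omega (f : Rn -> \bar R) : \bar R :=
  ereal_inf [set l%:E | l in
    [set l : R | (0 < l)%R /\ modular p Omega (fun x => l^-1%:E * f x) <= 1]].

(* L^1_loc(Omega), for real-valued functions *)
Definition loc_integrable Omega (f : Rn -> R) : Prop :=
  measurable_fun (Omega : set (lebT R n)) (f : lebT R n -> R) /\
  forall K : set Rn, K `<=` Omega -> compact K ->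
    \int[mu]_(x in K) `|(f x)%:E| < +oo.

(** Matrix weights *)

Definition pos_semidef (d : nat) (A : 'M[R]_d) : Prop :=
  A^T%R = A /\ forall v : 'cV[R]_d, (0 <= (v^T *m A *m v) 0 0)%R.

Definition matrix_weight (d : nat) (W : Rn -> 'M[R]_d) Omega : Prop :=
  [/\ forall x, Omega x -> pos_semidef (W x),
      forall i j,
        measurable_fun (Omega : set (lebT R n)) (fun x : lebT R n => W x i j) &
      loc_integrable Omega (fun x => opnorm (W x))].

(* the cube with lower corner a and side length l, its sides being parallel to
   the coordinate axes *)
Definition cube (a : Rn) (l : R) : set Rn :=
  [set x | forall i, (a i 0 <= x i 0 <= a i 0 + l)%R].

Definition Ap_const p (d : nat) (W : Rn -> 'M[R]_d) Omega : \bar R :=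
  ereal_sup [set c | exists (a : Rn) (l : R), [/\ (0 < l)%R, cube a l `<=` Omega &
    c = (mu (cube a l))^-1 *
        Lp_norm p Omega (fun x =>
          Lp_norm (fun y => hoelder_conjugate (p y)) Omega
            (fun y => (opnorm (W x *m invmx (W y)) * \1_(cube a l) y)%:E)
          * (\1_(cube a l) x)%:E)]].

(* The library sets invmx A = A when A is singular, hence the explicit
   requirement that W^-1 exists almost everywhere. *)
Definition matrix_Ap_on p (d : nat) (W : Rn -> 'M[R]_d) Omega : Prop :=
  (\forall x \ae mu, Omega x -> W x \in unitmx) /\ Ap_const p W Omega < +oo.

(* W is a matrix weight on Omega satisfying the A_p condition on some larger
   domain Omega'; p and W are total functions, whose values on Omega' are the
   extensions in question. *)
Definition matrix_Ap p (d : nat) (W : Rn -> 'M[R]_d) Omega : Prop :=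
  exists Omega' : set Rn,
    [/\ open Omega', Omega `<=` Omega', exponent p Omega',
        matrix_weight W Omega' & matrix_Ap_on p W Omega'].

(** Smooth functions and weak derivatives *)

Definition basis_vec (j : 'I_n.+1) : Rn := delta_mx j 0%R.

Definition iter_partial (s : seq 'I_n.+1) (f : Rn -> R) : Rn -> R :=
  foldr (fun j g => 'D_(basis_vec j) g) f s.

(* For open Omega: all the iterated partial derivatives exist and are
   continuous on Omega. *)
Definition smooth_on Omega (f : Rn -> R) : Prop :=
  forall (s : seq 'I_n.+1) x, Omega x ->
    {for x, continuous (iter_partial s f)} /\
    forall j, derivable (iter_partial s f) x (basis_vec j).

Definition test_function Omega (phi : Rn -> R) : Prop :=
  [/\ smooth_on setT phi, compact (closure [set x | phi x != 0%R]) &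
      closure [set x | phi x != 0%R] `<=` Omega].

Definition weak_partial Omega (j : 'I_n.+1) (f g : Rn -> R) : Prop :=
  loc_integrable Omega g /\
  forall phi, test_function Omega phi ->
    \int[mu]_(x in Omega) (f x * 'D_(basis_vec j) phi x)%:E =
    - \int[mu]_(x in Omega) (g x * phi x)%:E.

Section vector_valued.
Context {d : nat}.
Implicit Types (f : Rn -> 'cV[R]_d) (W : Rn -> 'M[R]_d).

Definition weak_jacobian Omega f (G : Rn -> 'M[R]_(d, n.+1)) : Prop :=
  forall i j, weak_partial Omega j (fun x => f x i 0%R) (fun x => G x i j).

(* W^{1,1}_loc(Omega; R^d) *)
Definition sobolev11loc Omega f : Prop :=
  (forall i, loc_integrable Omega (fun x => f x i 0%R)) /\
  exists G, weak_jacobian Omega f G.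

(* the weak Jacobian matrix, unique up to a negligible set *)
Definition weakD Omega f : Rn -> 'M[R]_(d, n.+1) :=
  xget (cst 0%R) [set G | weak_jacobian Omega f G].

(* the norm of L^p(W, Omega) *)
Definition weighted_norm p W Omega f : \bar R :=
  Lp_norm p Omega (fun x => (enorm (W x *m f x))%:E).

Definition sobolev_norm p W Omega f : \bar R :=
  weighted_norm p W Omega f +
  Lp_norm p Omega (fun x => (opnorm (W x *m weakD Omega f x))%:E).

Definition sobolevW p W Omega : set (Rn -> 'cV[R]_d) :=
  [set f | sobolev11loc Omega f /\ sobolev_norm p W Omega f < +oo].

Definition smooth_vector Omega : set (Rn -> 'cV[R]_d) :=
  [set f | forall i, smooth_on Omega (fun x => f x i 0%R)].

(* the closure of smooth_vector Omega `&` sobolevW p W Omega in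
   sobolevW p W Omega *)
Definition sobolevH p W Omega : set (Rn -> 'cV[R]_d) :=
  [set f | sobolevW p W Omega f /\
    forall e : R, (0 < e)%R ->
      exists2 g, (smooth_vector Omega `&` sobolevW p W Omega) g &
                 sobolev_norm p W Omega (fun x => f x - g x)%R < e%:E].

End vector_valued.

End analysis.

(* Main.v *)
Require Import Defs.
From mathcomp Require Import all_boot all_order all_algebra.
From mathcomp Require Import all_classical all_reals all_analysis.
From mathcomp Require Import measurable_realfun ring lra.

(* Meyers-Serrin: a field f is cut by a smooth partition of unity subordinate to
   an exhaustion of Omega by compact sets, every piece is mollified at its own
   scale, and the sum of the mollified pieces is smooth and close to f. All
   the work lies in showing that mollification T_k converges in the weighted
   modular rho(W v) = int |W(x) v(x)|^p(x) dx for v of compact support.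

   On a cube Q of side 1/k, |W(x) T_k v(x)| is at most a constant times
   |Q|^-1 int_Q |W(x) W(y)^-1| |W(y) v(y)| dy. The A_p condition, in the form of
   Hoelder's inequality between the norms of L^p' and L^p, bounds the modular
   of this function of x; log-Hoelder continuity is what allows one to
   normalize by a constant on each cube. Summing over a grid of cubes with
   bounded overlap gives a uniform bound for rho(W T_k v), and a density
   argument reduces the convergence to bounded v, then to indicators of
   finite unions of boxes, which are almost everywhere locally constant. *)

Set Implicit Arguments.
Unset Strict Implicit.
Unset Printing Implicit Defensive.

Import Order.TTheory GRing.Theory Num.Theory.
Import numFieldNormedType.Exports.

(** The exponent may equal 1, so no bound for the maximal operator is available, and the modular is
    not homogeneous. On a single cube the modular of an average is therefore estimated only for data
    of modular at most 1, and with an additive error, the measure of the cube; these errors add up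
    to a volume that does not depend on the scale. The bound obtained on the unit ball of the
    modular is turned by scaling into continuity at 0, uniform in [k], which is what the density
    argument consumes. Since the exponent is bounded, small modulars and small norms amount to the
    same; norms appear only at the two ends, in the A_p condition and in the Sobolev norm. The
    weight does not commute with mollification, but at a fixed x the matrix W(x) is constant and
    passes under the integral: this is where |W(x) W(y)^-1| comes from. Finally, [weakD] is an
    arbitrary choice among the weak Jacobians, so that their uniqueness almost everywhere is needed;
    it follows from the same convergence theorem, with exponent 1 and identity weight. *)

(** * Outer measure of boxes *)

Section box_measure.
Local Open Scope classical_set_scope.
Local Open Scope ring_scope.
Context {R : realType} {n : nat}.
Local Notation Rn := 'cV[R]_n.+1.
Implicit Types (ab : Rn * Rn) (x : 'I_n.+1 -> R).

Let side ab (i : 'I_n.+1) : set R := `]ab.1 i 0, ab.2 i 0]%classic.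

Let len ab (i : 'I_n.+1) : R := Num.max 0 (ab.2 i 0 - ab.1 i 0).

Let len_ge0 ab i : 0 <= len ab i. Proof. by rewrite /len le_max lexx. Qed.

(* the indicator of a box, integrated over its first s coordinates *)
Let part s ab x : R :=
  \prod_(i : 'I_n.+1) (if (i < s)%N then len ab i else \1_(side ab i) (x i)).

Let upd x (j : 'I_n.+1) (t : R) i := if i == j then t else x i.

(** The common factor of [part j] and [part j.+1]; what remains is the indicator of side [j] in the
    former and its length in the latter. *)
Let rest (j : 'I_n.+1) ab x : R :=
  \prod_(i | i != j) (if (i < j)%N then len ab i else \1_(side ab i) (x i)).

Let rest_ge0 j ab x : 0 <= rest j ab x.
Proof. by apply: prodr_ge0 => i _; case: ifP => // _; rewrite indicE ler0n. Qed.

Let part_upd (j : 'I_n.+1) ab x t :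
  part j ab (upd x j t) = rest j ab x * \1_(side ab j) t.
Proof.
rewrite /part (bigD1 j)//= ltnn mulrC; congr (_ * _); last first.
  by rewrite /upd eqxx.
by apply: eq_bigr => i ij; rewrite /upd (negbTE ij).
Qed.

Let partS (j : 'I_n.+1) ab x : part j.+1 ab x = rest j ab x * len ab j.
Proof.
rewrite /part (bigD1 j)//= ltnSn mulrC; congr (_ * _).
by apply: eq_bigr => i ij; rewrite ltnS leq_eqVlt -(inj_eq val_inj)/= in ij *;
  rewrite (negbTE ij).
Qed.

Let int_part (j : 'I_n.+1) ab x :
  (\int[lebesgue_measure]_t (part j ab (upd x j t))%:E = (part j.+1 ab x)%:E)%E.
Proof.
under eq_integral do rewrite part_upd EFinM.
have mS : measurable (side ab j) by exact: measurable_itv.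
rewrite ge0_integralZl_EFin ?rest_ge0//; last first.
  by apply/measurable_EFinP; exact: measurable_indic.
rewrite integral_indic// setIT partS EFinM; congr (_ * _)%E.
rewrite /side/= lebesgue_measure_itv/= lte_fin /len maxEge subr_le0.
by case: ltP => // _; rewrite EFinN.
Qed.

(** Induction on [s]: for s = 0 the inequality says that the boxes cover, and integrating it in the
    next coordinate, with monotone convergence on the right, gives the next case. At s = n+1 only
    volumes are left, so one-dimensional integration alone yields the lower bound for the outer
    measure of a box. *)
Let part_cover (B : nat -> Rn * Rn) ab s : box ab `<=` \bigcup_k box (B k) ->
  (s <= n.+1)%N -> forall x, ((part s ab x)%:E <= \sum_(k <oo) (part s (B k) x)%:E)%E.
Proof.
move=> abB; have pge0 s' ab' x : 0 <= part s' ab' x.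
  by apply: prodr_ge0 => i _; case: ifP => // _; rewrite indicE ler0n.
elim: s => [_ x|s IH sn x].
  have part0 ab' : part 0 ab' x = \1_(box ab') (\col_i x i).
    rewrite /part indicE; case: (boolP (_ \in _)) => [|] xb.
      rewrite big1// => i _/=; rewrite indicE mem_set//=.
      by move: xb; rewrite inE => /(_ i); rewrite mxE /side/= in_itv.
    have : ~ box ab' (\col_i x i) by move=> h; rewrite mem_set in xb.
    move/existsNP => [i xi]; rewrite (bigD1 i)//= indicE memNset ?mul0r//.
    by rewrite /side/= in_itv/=; rewrite mxE in xi.
  rewrite part0 indicE; case: (boolP (_ \in _)) => [|_]; last first.
    by apply: nneseries_ge0 => k _ _; rewrite lee_fin ?pge0.
  rewrite inE => /abB[k _ xk]; rewrite (nneseriesD1 (n := k))//; last first.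
    by move=> i _; rewrite lee_fin ?pge0.
  rewrite {1}part0 indicE mem_set// leeDl//.
  by apply: nneseries_ge0 => i _ _; rewrite lee_fin ?pge0.
pose j := Ordinal sn.
rewrite -[s.+1]/(j.+1) -int_part.
under eq_eseriesr do rewrite -int_part.
have mp ab' : measurable_fun setT (fun t => (part j ab' (upd x j t))%:E).
  apply/measurable_EFinP; under eq_fun do rewrite part_upd.
  by apply: measurable_funM => //; apply: measurable_indic; exact: measurable_itv.
rewrite -integral_nneseries//; last by move=> k t _; rewrite lee_fin ?pge0.
apply: ge0_le_integral => //.
- by move=> t _; rewrite lee_fin ?pge0.
- exact: mp.
- by apply: (ge0_emeasurable_sum (P := xpredT)) => [*|k _]; [rewrite lee_fin pge0|exact: mp].
- by move=> t _; apply: IH; rewrite ltnW.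
- by move=> k; exact: mp.
Qed.

Lemma leb_outer_box ab : leb_outer (box ab) = (box_volume ab)%:E.
Proof.
apply/eqP; rewrite eq_le; apply/andP; split.
  apply: ereal_inf_lbound; exists (fun k => if k == 0%N then ab else (0, 0)).
    by move=> x abx; exists 0%N.
  rewrite (nneseriesD1 (n := 0%N))//; last by move=> *; exact: box_volume_ge0.
  rewrite eseries0 ?adde0// => -[|k]//= _ _.
  by rewrite /box_volume (bigD1 ord0)//= subrr maxxx mul0r.
apply: le_ereal_inf_tmp => _ [B abB <-].
have := part_cover abB (leqnn _) (fun=> 0).
have partT ab' : part n.+1 ab' (fun=> 0) = box_volume ab'.
  by apply: eq_bigr => i _; rewrite ltn_ord.
by rewrite partT; under eq_eseriesr do rewrite partT.
Qed.

End box_measure.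

(** * Lebesgue measurable sets *)

Section lebesgue_measurable_sets.
Local Open Scope classical_set_scope.
Local Open Scope ring_scope.
Context {R : realType} {n : nat}.
Local Notation Rn := 'cV[R]_n.+1.
Local Notation X := (lebT R n).
Local Notation mu := (leb R n).
Implicit Types (ab : Rn * Rn) (a b c x y : Rn).

(** Caratheodory's criterion: every box of a cover is cut along the hyperplane into [lo] and [hi].
    Half-open sides make both pieces boxes, and the volumes add up even if the hyperplane misses the
    box, because negative side lengths count as 0. *)
Lemma measurable_halfspace (i : 'I_n.+1) (t : R) :
  measurable [set x : X | x i 0 <= t].
Proof.
apply: le_caratheodory_measurable => A /=.
pose lo (ab : Rn * Rn) : Rn * Rn :=
  (ab.1, \col_j if j == i then Num.min (ab.2 j 0) t else ab.2 j 0).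
pose hi (ab : Rn * Rn) : Rn * Rn :=
  (\col_j (if j == i then Num.max (ab.1 j 0) t else ab.1 j 0), ab.2).
have vol_split ab : box_volume (lo ab) + box_volume (hi ab) = box_volume ab.
  rewrite /box_volume (bigD1 i)//= [X in _ + X](bigD1 i)//= [RHS](bigD1 i)//=.
  rewrite !mxE eqxx.
  under eq_bigr => j ji do rewrite mxE (negbTE ji).
  under [X in _ + _ * X]eq_bigr => j ji do rewrite mxE (negbTE ji).
  rewrite -mulrDl; congr (_ * _).
  move: (ab.1 i 0) (ab.2 i 0) => a b.
  by rewrite /Num.min /Num.max; repeat case: ifPn; rewrite -?leNgt => *; lra.
apply: le_ereal_inf_tmp => _ [B AB <-].
have vge0 k : (0 <= (box_volume k)%:E :> \bar R)%E := box_volume_ge0 k.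
have -> : (\sum_(k <oo) (box_volume (B k))%:E =
  \sum_(k <oo) (box_volume (lo (B k)))%:E + \sum_(k <oo) (box_volume (hi (B k)))%:E)%E.
  rewrite -nneseriesD//; apply: eq_eseriesr => k _.
  by rewrite -EFinD vol_split.
apply: leeD; apply: ereal_inf_lbound.
- exists (lo \o B) => // x [/AB[k _ Bkx] xt]; exists k => // j.
  have := Bkx j; rewrite /= mxE; case: eqP => [->|//] /andP[-> /=].
  by rewrite le_min => ->.
- exists (hi \o B) => // x [/AB[k _ Bkx] xt]; exists k => // j.
  have := Bkx j; rewrite /= mxE; case: eqP => [->|//] /andP[+ ->/=].
  by rewrite andbT gt_max => ->; rewrite ltNge; apply/negP.
Qed.

Lemma measurable_fun_coord (i : 'I_n.+1) :
  measurable_fun [set: X] (fun x : X => x i 0).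
Proof.
apply: (measurability _ (RGenCInfty.measurableE R)) => _ [_ [t ->] <-].
rewrite setTI [X in measurable X](_ : _ = ~` \bigcup_k [set x : X | x i 0 <= t - k.+1%:R^-1]).
  by apply: measurableC; apply: bigcupT_measurable => k; exact: measurable_halfspace.
apply/seteqP; split => x /=; rewrite in_itv/= andbT.
  move=> tx [k _ /=]; apply/negP; rewrite -ltNge (lt_le_trans _ tx)//.
  by rewrite ltrBlDr ltrDl invr_gt0 ltr0n.
move=> xN; rewrite leNgt; apply/negP => /ltr_add_invr[k kt]; apply: xN.
by exists k => //=; rewrite lerBrDr ltW.
Qed.

Lemma measurable_box ab : measurable (box ab : set X).
Proof.
rewrite (_ : box ab = \bigcap_(i in [set: 'I_n.+1])
   [set x : X | ab.1 i 0 < x i 0 <= ab.2 i 0]); last first.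
  by apply/seteqP; split => [x h i _ //|x h i]; exact: h.
apply: fin_bigcap_measurable => [|i _]; first exact: finite_finset.
have := measurable_fun_coord i measurableT (measurable_itv `]ab.1 i 0, ab.2 i 0]).
by rewrite setTI; congr measurable; apply/seteqP; split => x /=; rewrite in_itv.
Qed.

Lemma leb_box ab : mu (box ab) = (box_volume ab)%:E.
Proof. exact: leb_outer_box. Qed.

Lemma ball_cVE x e y : 0 < e -> ball x e y <-> forall i, `|x i 0 - y i 0| < e.
Proof.
move=> e0; split=> [[_ h] i|h]; first exact: (h i 0).
by split=> // i j; rewrite ord1; exact: h.
Qed.

(** An open set is the union of the boxes with rational corners that it contains, and there are
    countably many of those. *)
Lemma open_measurable_leb (A : set Rn) : open A -> measurable (A : set X).
Proof.
move=> oA.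
pose I := [set q : 'cV[rat]_n.+1 * 'cV[rat]_n.+1 |
  box (map_mx ratr q.1 : Rn, map_mx ratr q.2) `<=` A].
rewrite (_ : A = \bigcup_(q in I) box (map_mx ratr q.1 : Rn, map_mx ratr q.2)).
  rewrite bigcup_mkcond; apply: countable_bigcupT_measurable => // q.
  by case: ifP => // _; exact: measurable_box.
apply/seteqP; split => [x Ax|x [q Iq]]; last exact: Iq.
have /nbhs_ballP[e /= e0 xeA] := open_nbhs_nbhs (conj oA Ax).
have [a xa] : {a : 'I_n.+1 -> rat & forall i, x i 0 - e < ratr (a i) < x i 0}.
  apply: (@choice _ _ (fun i q => x i 0 - e < ratr q < x i 0)) => i.
  have xe : x i 0 - e < x i 0 by rewrite ltrBlDr ltrDl.
  by have [q] := rat_in_itvoo xe; rewrite in_itv/= => ?; exists q.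
have [b xb] : {b : 'I_n.+1 -> rat & forall i, x i 0 < ratr (b i) < x i 0 + e}.
  apply: (@choice _ _ (fun i q => x i 0 < ratr q < x i 0 + e)) => i.
  have xe : x i 0 < x i 0 + e by rewrite ltrDl.
  by have [q] := rat_in_itvoo xe; rewrite in_itv/= => ?; exists q.
exists (\col_i a i, \col_i b i); last first.
  by move=> i; rewrite !mxE; have /andP[_ ->] := xa i; have /andP[/ltW -> _] := xb i.
move=> y /= aby; apply: xeA; apply/ball_cVE => // i.
have := aby i; rewrite !mxE => /andP[ay yb].
have /andP[xa1 xa2] := xa i; have /andP[xb1 xb2] := xb i.
by rewrite ltr_norml; apply/andP; split; lra.
Qed.

Lemma closed_measurable_leb (A : set Rn) : closed A -> measurable (A : set X).
Proof.
move=> cA; rewrite -[A]setCK; apply: measurableC.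
by apply: open_measurable_leb; exact: closed_openC.
Qed.

Lemma compact_measurable_leb (A : set Rn) : compact A -> measurable (A : set X).
Proof.
by move=> cA; apply: closed_measurable_leb; apply: compact_closed => //; exact: norm_hausdorff.
Qed.

Lemma continuous_measurable_leb (D : set Rn) (f : Rn -> R) : open D ->
  (forall x, D x -> {for x, continuous f}) ->
  measurable_fun (D : set X) (f : X -> R).
Proof.
move=> oD cf.
apply: (measurability _ (RGenOInfty.measurableE R)) => _ [_ [t ->] <-].
apply: open_measurable_leb; rewrite openE => y [Dy fy].
apply: filterI; first exact: open_nbhs_nbhs.
by apply: cf => //; apply: open_nbhs_nbhs; split => //; exact: interval_open.
Qed.

Lemma continuousT_measurable_leb (f : Rn -> R) : continuous f ->
  measurable_fun setT (f : X -> R).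
Proof. by move=> cf; apply: continuous_measurable_leb => [|x _]; [exact: openT|exact: cf]. Qed.

Lemma normcV_coord x i : `|x i 0| <= `|x|.
Proof.
by rewrite [leRHS]mx_normrE; exact: (le_bigmax _ (fun ij => `|x ij.1 ij.2|) (i, 0)).
Qed.

Lemma normcV_le x (e : R) : 0 <= e -> (forall i, `|x i 0| <= e) -> `|x| <= e.
Proof.
move=> e0 xe; rewrite [leLHS]mx_normrE; apply/bigmax_leP; split=> // -[i j] _ /=.
by rewrite ord1.
Qed.

Lemma compact_box (K : set Rn) : compact K -> exists2 N : R, 0 < N &
  K `<=` box (const_mx (- N), const_mx N).
Proof.
move=> /compact_bounded[M [_ Mb]]; exists (`|M| + 1); first by rewrite ltr_wpDl.
move=> x Kx i; rewrite !mxE.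
have xM : `|x| <= `|M| + 1/2.
  by apply: Mb => //; rewrite (le_lt_trans (ler_norm _))// ltrDl; lra.
have : `|x i 0| <= `|M| + 1/2.
  exact: le_trans (normcV_coord _ _) xM.
by rewrite ler_norml => /andP[h1 h2]; apply/andP; split; lra.
Qed.

Lemma compact_leb_lty (K : set Rn) : compact K -> (mu K < +oo)%E.
Proof.
move=> cK; have [N N0 KN] := compact_box cK.
apply: (@le_lt_trans _ _ (mu (box (const_mx (- N), const_mx N)))).
  by apply: le_leb_outer.
by rewrite leb_box ltry.
Qed.

(** Such hyperplanes carry the faces of boxes; their being negligible makes indicators of boxes
    continuous almost everywhere. A bounded piece of the hyperplane is covered by one box of
    thickness [e]. *)
Lemma leb_hyperplane (i : 'I_n.+1) (t : R) : mu [set x : X | x i 0 = t] = 0%E.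
Proof.
have mH : measurable [set x : X | x i 0 = t].
  have := measurable_fun_coord i measurableT (@measurable_set1 R t).
  by rewrite setTI; congr measurable.
pose bx (N : nat) (e : R) : Rn * Rn := (\col_j (if j == i then t - e else - N%:R),
  \col_j (if j == i then t else N%:R)).
pose H N := [set x : X | x i 0 = t /\ forall j, j != i -> - N%:R < x j 0 <= N%:R].
have HE : [set x : X | x i 0 = t] `<=` \bigcup_N H N.
  move=> x /= xt; have [N N0 xN] := compact_box (@compact_set1 _ (x : Rn)).
  exists (Num.truncn N).+1 => //; split => // j ji.
  have /(_ j) := xN x erefl; rewrite !mxE => /andP[x1 x2].
  have h : N < (Num.truncn N).+1%:R by rewrite truncnS_gt.
  by apply/andP; split; lra.
have H0 N : leb_outer (H N) = 0%E.
  apply/eqP; rewrite eq_le leb_outer_ge0 andbT.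
  pose C : R := \prod_(j < n.+1 | j != i) Num.max 0 (N%:R + N%:R).
  have C0 : 0 <= C by apply: prodr_ge0 => j _; rewrite le_max lexx.
  have bnd (e : R) : 0 < e -> (leb_outer (H N) <= (e * C)%:E)%E.
    move=> e0; apply: (@le_trans _ _ (leb_outer (box (bx N e)))).
      apply: le_leb_outer => x [xt xN] j; rewrite !mxE; case: eqP => [->|/eqP /xN //].
      by rewrite xt lexx andbT ltrBlDr ltrDl.
    rewrite leb_outer_box lee_fin /box_volume (bigD1 i)//= !mxE eqxx.
    have -> : Num.max 0 (t - (t - e)) = e by rewrite max_r; lra.
    apply: ler_wpM2l; first exact: ltW.
    by apply: ler_prod => j ji; rewrite !mxE (negbTE ji) opprK le_max lexx /=.
  (* The thickness is e / (C + 1) because [C] may vanish. *)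
  apply/lee_addgt0Pr => e e0; rewrite add0e.
  apply: le_trans (bnd (e / (C + 1)) _) _; first by rewrite divr_gt0// ltr_wpDl.
  by rewrite lee_fin mulrAC ler_pdivrMr ?ltr_wpDl// mulrDr mulr1 lerDl ltW.
apply/eqP; rewrite eq_le measure_ge0 andbT.
apply: le_trans (le_leb_outer HE) _.
apply: le_trans (leb_outer_sigma_subadditive _) _.
by rewrite eseries0// => k _ _; rewrite H0.
Qed.

End lebesgue_measurable_sets.

(** * Monotonicity and translation invariance of the integral *)

Section lower_integral.
Local Open Scope classical_set_scope.
Local Open Scope ring_scope.
Local Open Scope ereal_scope.
Context d (T : measurableType d) (R : realType).
Variable mu : {measure set T -> \bar R}.
Import HBNNSimple.

(* The integral of a nonnegative function is a lower integral, hence monotone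
   even for functions that are not measurable. *)
Lemma lower_integral_le (D1 D2 : set T) (f g : T -> \bar R) :
  D1 `<=` D2 -> (forall x, D1 x -> 0 <= f x) -> (forall x, D2 x -> 0 <= g x) ->
  (forall x, D1 x -> f x <= g x) ->
  \int[mu]_(x in D1) f x <= \int[mu]_(x in D2) g x.
Proof.
move=> D12 f0 g0 fg; rewrite !ge0_integralE//.
apply: ereal_sup_le => _ [h hf <-]; exists h => // x.
apply: le_trans (hf x) _; rewrite /patch.
case: ifPn => [/set_mem xD1|_].
  by rewrite mem_set ?fg//; exact: D12.
by case: ifPn => [/set_mem/g0//|_]; exact: lexx.
Qed.

End lower_integral.

Section translation.
Local Open Scope classical_set_scope.
Local Open Scope ring_scope.
Context {R : realType} {n : nat}.
Local Notation Rn := 'cV[R]_n.+1.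
Local Notation X := (lebT R n).
Local Notation mu := (leb R n).
Implicit Types (c x y : Rn).

Lemma leb_outer_shift c (A : set Rn) :
  leb_outer [set x | A (x + c)] = leb_outer A.
Proof.
suff le c' (B : set Rn) : (leb_outer [set x : Rn | B (x + c')%R] <= leb_outer B)%E.
  apply/eqP; rewrite eq_le le /=.
  have := le (- c) [set x | A (x + c)]; congr (_ <= _)%E.
  by congr leb_outer; apply/funext => x /=; rewrite subrK.
apply: le_ereal_inf_tmp => _ [C BC <-]; apply: ereal_inf_lbound.
exists (fun k => ((C k).1 - c', (C k).2 - c')).
  move=> x /BC[k _ Ck]; exists k => // i /=.
  by have := Ck i; rewrite !mxE; lra.
apply: eq_eseriesr => k _; congr EFin; apply: eq_bigr => i _.
by rewrite !mxE; congr Num.max; lra.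
Qed.

(** Caratheodory's condition for the preimage, tested on [B], is the condition for [A] tested on a
    translate of [B]. *)
Lemma measurable_shift c : measurable_fun setT ((fun x => x + c) : X -> X).
Proof.
move=> _ A mA; rewrite setTI; apply: le_caratheodory_measurable => B /=.
have mA' : forall Y : set Rn,
  leb_outer Y = (leb_outer (Y `&` A) + leb_outer (Y `&` ~` A))%E := mA.
rewrite -(leb_outer_shift (- c) B) (mA' [set x | B (x - c)]).
rewrite le_eqVlt; apply/orP; left; apply/eqP; congr (_ + _)%E;
  rewrite -(leb_outer_shift (- c)); congr leb_outer;
  by apply/funext => x /=; rewrite /preimage/= subrK.
Qed.

Local Open Scope ereal_scope.

Lemma integral_shift c (f : X -> \bar R) : measurable_fun setT f ->
  \int[mu]_x f (x + c)%R = \int[mu]_x f x.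
Proof.
suff ge0 (g : X -> \bar R) : measurable_fun setT g -> (forall x, 0 <= g x) ->
    \int[mu]_x g (x + c)%R = \int[mu]_x g x.
  move=> mf; rewrite integralE [RHS]integralE.
  congr (_ - _)%E.
    rewrite -[RHS](ge0 f^\+)//; last exact: measurable_funepos.
    by apply: eq_integral => x _; rewrite !funeposE.
  rewrite -[RHS](ge0 f^\-)//; last exact: measurable_funeneg.
  by apply: eq_integral => x _; rewrite !funenegE.
move=> mg g0.
transitivity (\int[pushforward mu ((fun x => x + c)%R : X -> X)]_x g x).
  by rewrite (ge0_integral_pushforward (measurable_shift c))// => x _; exact: g0.
by congr (integral _ _ _); apply/funext => A; exact: leb_outer_shift.
Qed.

End translation.

(** * The function exp(-1/t) and its derivatives *)

Section flat_function.
Local Open Scope classical_set_scope.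
Local Open Scope ring_scope.
Context {R : realType}.
Implicit Types (p q : {poly R}) (t : R).

(* p(1/t) exp(-1/t) extended by 0: a class of functions stable under
   differentiation that contains the usual flat function (p = 1) *)
Definition flat p t : R := if 0 < t then p.[t^-1] * expR (- t^-1) else 0.

(** With s = 1/t >= 1, a polynomial of size N is O(s^N), while exp(-s) <= (N+1)! / s^(N+1); a factor
    1/s = t remains. A linear bound is what differentiability at 0 asks for. *)
Lemma flat_le p : exists2 C, 0 <= C & forall t, 0 < t -> t <= 1 -> `|flat p t| <= C * t.
Proof.
pose N := size p.
exists ((\sum_(i < N) `|p`_i|) * N.+1`!%:R) => [|t t0 t1].
  by rewrite mulr_ge0// sumr_ge0.
have s1 : 1 <= t^-1 by rewrite invf_ge1.
have s0 : 0 < t^-1 by rewrite invr_gt0.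
rewrite /flat t0; set s := t^-1 in s1 s0 *.
rewrite normrM (gtr0_norm (expR_gt0 _)).
have pl : `|p.[s]| <= (\sum_(i < N) `|p`_i|) * s ^+ N.
  rewrite horner_coef mulr_suml (le_trans (ler_norm_sum _ _ _))//.
  apply: ler_sum => i _; rewrite normrM ler_wpM2l// ger0_norm ?exprn_ge0 ?(ltW s0)//.
  by rewrite ler_weXn2l// ltnW.
have el : expR (- s) <= N.+1`!%:R / s ^+ N.+1.
  rewrite expRN -[leRHS]invrK lef_pV2 ?posrE ?expR_gt0 ?invr_gt0 ?divr_gt0 ?exprn_gt0 ?ltr0n ?fact_gt0//.
  apply: le_trans (expR_ge1Dxn N (ltW s0)).
  by rewrite invf_div lerDr.
apply: le_trans (ler_pM _ _ pl el) _; rewrite ?expR_ge0//.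
rewrite -!mulrA ler_wpM2l ?sumr_ge0//.
have -> : t = s^-1 by rewrite invrK.
have sN : s ^+ N != 0 by rewrite expf_neq0 ?gt_eqF.
rewrite le_eqVlt; apply/orP; left; apply/eqP; rewrite exprS; field.
by rewrite sN gt_eqF.
Qed.

(** For t > 0 the derivative of p(1/t) exp(-1/t) is t^-2 (p - p')(1/t) exp(-1/t), which is again of
    the form [flat]. *)
Lemma is_derive_flat p t :
  is_derive t (1 : R) (flat p) (flat ('X ^+ 2 * (p - p^`())) t).
Proof.
have [t0|t0|->] := ltgtP t 0.
- rewrite {2}/flat ltNge (ltW t0)/=.
  apply: near_eq_is_derive (is_derive_cst (0 : R) t 1).
  by near=> z; rewrite /flat ltNge ltW//; near: z; exact: lt_nbhsl.
- have D : is_derive t (1 : R) (fun t => p.[t^-1] * expR (- t^-1))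
     (flat ('X ^+ 2 * (p - p^`())) t).
    have d1 : is_derive t (1:R) (fun z : R => z^-1) (- t ^- 2).
      apply: is_derive_eq (is_deriveV (f := id) (lt0r_neq0 t0) (is_derive_id t 1)) _.
      by rewrite [LHS]mulr1.
    have d2 : is_derive t (1:R) (fun z : R => p.[z^-1]) (p^`().[t^-1] * - t ^- 2).
      exact: (@is_derive1_comp _ (horner p) (fun z => z^-1)).
    have d3 : is_derive t (1:R) (fun z : R => expR (- z^-1)) (expR (- t^-1) * - - t ^- 2).
      exact: (@is_derive1_comp _ expR (fun z => - z^-1)).
    apply: is_derive_eq (is_deriveM d2 d3) _.
    rewrite /flat t0 !hornerE /GRing.scale/= exprVn; ring.
  apply: near_eq_is_derive D.
  by near=> z; rewrite /flat ifT//; near: z; exact: lt_nbhsr.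
- rewrite {2}/flat ltxx.
  have [C C0 Cle] := flat_le ('X * p).
  suff h0 : h^-1 *: (flat p (h *: 1 + 0) - flat p 0) @[h --> 0^'] --> (0 : R).
    by apply: DeriveDef; [exact: cvgP h0|exact: cvg_lim h0].
  apply/cvgrPdist_le => e e0; near=> h.
  rewrite sub0r normrN {2}/flat ltxx subr0 addr0 /GRing.scale/= mulr1.
  have [h0|h0] := ltP 0 h; last by rewrite /flat ltNge h0/= mulr0 normr0 ltW.
  (* The difference quotient at 0 is itself a [flat] function, so the linear bound makes it tend to
     0. *)
  have -> : h^-1 * flat p h = flat ('X * p) h by rewrite /flat h0 mulrA hornerM hornerX.
  apply: le_trans (Cle _ h0 _) _.
    by rewrite ltW// (le_lt_trans (ler_norm _))//; near: h; exact: dnbhs0_lt.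
  apply: (@le_trans _ _ ((C + 1) * (e / (C + 1)))); last first.
    by rewrite mulrC divfK// gt_eqF// ltr_wpDl.
  apply: ler_pM => //; first exact: ltW; first by rewrite lerDl.
  apply/ltW/(le_lt_trans (ler_norm _)); near: h; apply: dnbhs0_lt.
  by rewrite divr_gt0// ltr_wpDl.
Unshelve. all: by end_near. Qed.

End flat_function.

(** * Smooth functions *)

Section smooth_functions.
Local Open Scope classical_set_scope.
Local Open Scope ring_scope.
Context {R : realType} {n : nat}.
Local Notation Rn := 'cV[R]_n.+1.
Implicit Types (f g : Rn -> R) (U V : set Rn) (x v : Rn) (j : 'I_n.+1).

Lemma is_derive_lineP f x v df :
  is_derive x v f df <-> is_derive (0 : R) (1 : R) (fun h => f (h *: v + x)) df.
Proof.
have E : (fun h : R => h^-1 *: (f (h *: v + x) - f x)) =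
    (fun h : R => h^-1 *: (f ((h *: (1 : R) + 0) *: v + x) - f ((0 : R) *: v + x))).
  by apply/funext => h; rewrite addr0 scale0r add0r [h *: (1 : R)]mulr1.
by split => -[d1 d2]; apply: DeriveDef; move: d1 d2; rewrite /derivable /derive E.
Qed.

(** By induction on the list, every iterated partial derivative agrees on [U] with a member of [S];
    as [U] is open, this agreement suffices to differentiate once more. Smoothness is thus proved by
    exhibiting one class of continuous functions stable under differentiation. *)
Lemma smooth_coind U (S : set (Rn -> R)) : open U ->
  (forall f, S f -> (forall x, U x -> {for x, continuous f}) /\
    forall j, exists2 g, S g & forall x, U x -> is_derive x (basis_vec j) f (g x)) ->
  forall f, S f -> smooth_on U f.
Proof.
move=> oU SP f Sf.
have nU x (P : set Rn) : U x -> (forall y, U y -> P y) -> \forall y \near x, P y.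
  by move=> Ux UP; apply: filterS (open_nbhs_nbhs (conj oU Ux)).
have it s : exists2 g, S g & forall x, U x -> g x = iter_partial s f x.
  elim: s => [|j s [g Sg gE]]; first by exists f.
  have [_ /(_ j)[h Sh hE]] := SP g Sg; exists h => // x Ux /=.
  case: (hE x Ux) => _ <-; apply: near_eq_derive.
  by apply: nU Ux _ => y Uy; rewrite gE.
move=> s x Ux; have [g Sg gE] := it s; have [cg dg] := SP g Sg; split.
  change (iter_partial s f @ x --> iter_partial s f x); rewrite -(gE x Ux).
  apply: cvg_trans (cg x Ux).
  have N : \forall y \near x, g y = iter_partial s f y by exact: nU Ux gE.
  exact: near_eq_cvg N.
move=> j; have [h _ hE] := dg j; case: (hE x Ux) => + _.
by apply: near_eq_derivable; apply: nU Ux _ => y Uy; rewrite gE.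
Qed.

Lemma smooth_on_continuous U f x : smooth_on U f -> U x -> {for x, continuous f}.
Proof. by move=> sf Ux; have [] := sf [::] x Ux. Qed.

Lemma smooth_on_is_derive U f x j : smooth_on U f -> U x ->
  is_derive x (basis_vec j) f ('D_(basis_vec j) f x).
Proof. by move=> sf Ux; apply: DeriveDef => //; have [_] := sf [::] x Ux; apply. Qed.

Lemma smooth_on_partial U f j : smooth_on U f -> smooth_on U ('D_(basis_vec j) f).
Proof.
move=> sf s x Ux; have := sf (rcons s j) x Ux.
by rewrite /iter_partial foldr_rcons.
Qed.

Lemma smooth_on_sub U V f : V `<=` U -> smooth_on U f -> smooth_on V f.
Proof. by move=> VU sf s x /VU; exact: sf. Qed.

(** As [U] need not be open, the coinduction takes place on the union [W] of the open sets on which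
    [f] agrees with a smooth function; the functions locally equal to smooth ones form a class
    stable under partial derivatives. *)
Lemma smooth_on_local U f :
  (forall x, U x -> exists V, exists2 g, (open V /\ V x) &
     smooth_on V g /\ (forall y, V y -> f y = g y)) ->
  smooth_on U f.
Proof.
move=> Uf; pose W := \bigcup_(V in [set V | open V /\ exists2 g, smooth_on V g &
  forall y, V y -> f y = g y]) V.
have oW : open W by apply: bigcup_open => V [].
apply: (@smooth_on_sub W) => [x /Uf[V [g [oV Vx] [sg fg]]]|].
  by exists V => //; split => //; exists g.
pose S := [set f | forall x, W x -> exists V, exists2 g, (open V /\ V x) &
     smooth_on V g /\ (forall y, V y -> f y = g y)].
apply: (@smooth_coind W S) => [//|h Sh|x [V [oV [g sg fg]] Vx]]; last by exists V, g.
have nV V x (P : set Rn) : open V -> V x -> (forall y, V y -> P y) -> \forall y \near x, P y.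
  by move=> oV Vx VP; apply: filterS (open_nbhs_nbhs (conj oV Vx)).
split=> [x Wx|j].
  have [V [g [oV Vx] [sg hg]]] := Sh x Wx.
  change (h @ x --> h x); rewrite (hg x Vx).
  apply: cvg_trans (smooth_on_continuous sg Vx).
  have N : \forall y \near x, g y = h y by apply: (nV _ _ _ oV Vx) => y Vy; rewrite hg.
  exact: near_eq_cvg N.
exists ('D_(basis_vec j) h) => x Wx; have [V [g [oV Vx] [sg hg]]] := Sh x Wx.
  exists V, ('D_(basis_vec j) g); first by [].
  split; first exact: smooth_on_partial.
  by move=> y Vy; apply: near_eq_derive; exact: nV oV Vy _.
apply: DeriveDef => //; case: (smooth_on_is_derive j sg Vx) => + _.
by apply: near_eq_derivable; apply: nV oV Vx _ => y Vy; rewrite hg.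
Qed.

Lemma eq_smooth_on U f g : open U -> (forall x, U x -> f x = g x) ->
  smooth_on U g -> smooth_on U f.
Proof. by move=> oU fg sg; apply: smooth_on_local => x Ux; exists U, g. Qed.

(** The algebra generated by [B]: by Leibniz' rule it is stable under differentiation as soon as the
    derivatives of the generators belong to it, so the coinduction applies to it. *)
Inductive smooth_alg (B : set (Rn -> R)) : set (Rn -> R) :=
| smooth_alg_base f : B f -> smooth_alg B f
| smooth_alg_cst c : smooth_alg B (fun=> c)
| smooth_alg_add f g : smooth_alg B f -> smooth_alg B g -> smooth_alg B (fun x => f x + g x)
| smooth_alg_mul f g : smooth_alg B f -> smooth_alg B g -> smooth_alg B (fun x => f x * g x).

Lemma smooth_on_alg U (B : set (Rn -> R)) : open U ->
  (forall f, B f -> (forall x, U x -> {for x, continuous f}) /\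
    forall j, exists2 g, smooth_alg B g &
      forall x, U x -> is_derive x (basis_vec j) f (g x)) ->
  forall f, smooth_alg B f -> smooth_on U f.
Proof.
move=> oU BP; apply: smooth_coind => // f.
elim=> {f} [f /BP//|c|f g Sf [cf df] Sg [cg dg]|f g Sf [cf df] Sg [cg dg]].
- split=> [x _|j]; first exact: cst_continuous.
  by exists (fun=> 0) => [|x _]; [exact: smooth_alg_cst|exact: is_derive_cst].
- split=> [x Ux|j]; first exact: (continuousD (cf x Ux) (cg x Ux)).
  have [f' Sf' f'E] := df j; have [g' Sg' g'E] := dg j.
  exists (fun x => f' x + g' x) => [|x Ux]; first exact: smooth_alg_add.
  exact: is_deriveD (f'E x Ux) (g'E x Ux).
- split=> [x Ux|j]; first exact: (continuousM (cf x Ux) (cg x Ux)).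
  have [f' Sf' f'E] := df j; have [g' Sg' g'E] := dg j.
  exists (fun x => f x * g' x + g x * f' x) => [|x Ux].
    by apply: smooth_alg_add; exact: smooth_alg_mul.
  exact: is_deriveM (f'E x Ux) (g'E x Ux).
Qed.

Lemma smooth_on_alg_smooth U f : open U -> smooth_alg (smooth_on U) f -> smooth_on U f.
Proof.
move=> oU; apply: smooth_on_alg => // g sg; split=> [x Ux|j].
  exact: smooth_on_continuous sg Ux.
exists ('D_(basis_vec j) g) => [|x Ux]; last exact: smooth_on_is_derive sg Ux.
exact/smooth_alg_base/smooth_on_partial.
Qed.

Lemma smooth_onM U f g : open U -> smooth_on U f -> smooth_on U g ->
  smooth_on U (fun x => f x * g x).
Proof.
by move=> oU sf sg; apply: smooth_on_alg_smooth => //; apply: smooth_alg_mul;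
  exact: smooth_alg_base.
Qed.

Lemma smooth_onD U f g : open U -> smooth_on U f -> smooth_on U g ->
  smooth_on U (fun x => f x + g x).
Proof.
by move=> oU sf sg; apply: smooth_on_alg_smooth => //; apply: smooth_alg_add;
  exact: smooth_alg_base.
Qed.

Lemma smooth_on_cst U c : open U -> smooth_on U (fun=> c).
Proof. by move=> oU; apply: smooth_on_alg_smooth => //; exact: smooth_alg_cst. Qed.

Lemma smooth_onB U f g : open U -> smooth_on U f -> smooth_on U g ->
  smooth_on U (fun x => f x - g x).
Proof.
move=> oU sf sg; apply: (@eq_smooth_on _ _ (fun x => f x + -1 * g x) oU).
  by move=> x _; rewrite mulN1r.
apply: (smooth_onD oU sf); exact: smooth_onM oU (smooth_on_cst _ oU) sg.
Qed.

Lemma smooth_on_sum U (I : Type) (r : seq I) (F : I -> Rn -> R) : open U ->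
  (forall i, smooth_on U (F i)) -> smooth_on U (fun x => \sum_(i <- r) F i x).
Proof.
move=> oU sF; elim: r => [|i r IH].
  by under eq_fun do rewrite big_nil; exact: (smooth_on_cst _ oU).
by under eq_fun do rewrite big_cons; exact: (smooth_onD oU (sF i) IH).
Qed.

Lemma smooth_on_prod U (I : Type) (r : seq I) (F : I -> Rn -> R) : open U ->
  (forall i, smooth_on U (F i)) -> smooth_on U (fun x => \prod_(i <- r) F i x).
Proof.
move=> oU sF; elim: r => [|i r IH].
  by under eq_fun do rewrite big_nil; exact: (smooth_on_cst _ oU).
by under eq_fun do rewrite big_cons; exact: (smooth_onM oU (sF i) IH).
Qed.

(** The generators comprise all polynomials [q] at once, since differentiation changes the
    polynomial and multiplies by a constant. *)
Lemma smooth_flat_coord (p : {poly R}) (i : 'I_n.+1) (a b : R) :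
  smooth_on setT (fun x => flat p (a * x i 0 + b)).
Proof.
pose B := [set f | exists q, f = fun x : Rn => flat q (a * x i 0 + b)].
apply: (@smooth_on_alg _ B openT); last by apply: smooth_alg_base; exists p.
move=> _ [q ->]; split=> [x _|j].
  apply: (@continuous_comp _ _ _ (fun x : Rn => a * x i 0 + b) (flat q)).
    apply: (@continuousD _ _ _ (fun x : Rn => a * x i 0) (cst b)); last exact: cst_continuous.
    apply: (@continuousM _ _ (cst a) (fun x : Rn => x i 0)); first exact: cst_continuous.
    exact: coord_continuous.
  by apply: differentiable_continuous; apply/derivable1_diffP; case: (is_derive_flat q (a * x i 0 + b)).
pose q' := 'X ^+ 2 * (q - q^`()).
exists (fun x => flat q' (a * x i 0 + b) * (a * (i == j)%:R)) => [|x _].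
  apply: smooth_alg_mul; last exact: smooth_alg_cst.
  by apply: smooth_alg_base; exists q'.
apply/is_derive_lineP.
pose l (h : R) := a * (h * (i == j)%:R + x i 0) + b.
have -> : (fun h : R => flat q (a * (h *: basis_vec j + x) i 0 + b)) = flat q \o l.
  by apply/funext => h; rewrite /l /= !mxE eqxx andbT.
have l0 : l 0 = a * x i 0 + b by rewrite /l mul0r add0r.
rewrite -l0; apply: is_derive1_comp; first exact: is_derive_flat.
have -> : l = horner ((a * (i == j)%:R) *: 'X + (a * x i 0 + b)%:P).
  by apply/funext => h; rewrite /l hornerD hornerZ hornerX hornerC; ring.
apply: is_derive_eq (is_derive_poly _ _) _.
by rewrite derivD derivZ derivX derivC addr0 hornerZ hornerC mulr1.
Qed.

End smooth_functions.

(** * Test functions *)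

Section test_functions.
Local Open Scope classical_set_scope.
Local Open Scope ring_scope.
Context {R : realType} {n : nat}.
Local Notation Rn := 'cV[R]_n.+1.
Local Notation X := (lebT R n).
Local Notation mu := (leb R n).
Implicit Types (f g phi : Rn -> R) (U K : set Rn) (x y : Rn) (j : 'I_n.+1).

(** Transposition carries Heine-Borel over from row vectors. *)
Lemma cV_bounded_closed_compact (A : set Rn) (M : R) :
  (forall x, A x -> `|x| <= M) -> closed A -> compact A.
Proof.
move=> AM cA.
pose B : set 'rV[R]_n.+1 := [set y | A y^T].
have ctr m k : continuous (trmx : 'M[R]_(m.+1, k.+1) -> 'M[R]_(k.+1, m.+1)).
  move=> x Y /nbhs_ballP[e /= e0 xY]; apply/nbhs_ballP; exists e => // y [_ xy].
  by apply: xY; split=> // a b; rewrite !mxE; exact: xy.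
have -> : A = trmx @` B.
  apply/seteqP; split=> [x Ax|_ [y By <-]//].
  by exists x^T; rewrite /B/= ?trmxK.
apply: continuous_compact; first exact/continuous_subspaceT/ctr.
apply: bounded_closed_compact; last by apply: preimage_closed => // y _; exact: ctr.
exists M; split; first exact: num_real.
move=> N MN y /AM yM; apply: le_trans (ltW MN); apply: le_trans yM.
rewrite [leLHS]mx_normrE; apply/bigmax_leP; split=> // -[a b] _ /=.
have -> : y a b = y^T b 0 by rewrite mxE ord1.
exact: normcV_coord.
Qed.

Lemma compact_closedV K : compact K -> closed K.
Proof. by apply: compact_closed; exact: norm_hausdorff. Qed.

Lemma test_functionP U phi K : smooth_on setT phi -> compact K -> K `<=` U ->
  (forall x, ~ K x -> phi x = 0) -> test_function U phi.
Proof.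
move=> sphi cK KU phi0.
have SK : closure [set x | phi x != 0] `<=` K.
  rewrite [X in _ `<=` X](closure_id K).1; last exact: compact_closedV.
  apply: closure_subset => x /= phix; apply: contrapT => /phi0 phix0.
  by rewrite phix0 eqxx in phix.
split=> //; last exact: subset_trans KU.
by apply: subclosed_compact cK SK; exact: closed_closure.
Qed.

Lemma test_function_compact U phi : test_function U phi ->
  exists K, [/\ compact K, K `<=` U & forall x, ~ K x -> phi x = 0].
Proof.
move=> [_ cK KU]; eexists; split; [exact: cK|exact: KU|move=> x xK].
by apply/eqP; apply: contra_notT xK => phix; exact: subset_closure.
Qed.

Lemma test_function_sub U V phi : U `<=` V -> test_function U phi -> test_function V phi.
Proof. by move=> UV [s c KU]; split=> //; exact: subset_trans KU UV. Qed.

Lemma test_function_partial U phi j : test_function U phi ->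
  test_function U ('D_(basis_vec j) phi).
Proof.
move=> tphi; have [K [cK KU phi0]] := test_function_compact tphi.
have [sphi _ _] := tphi.
apply: (test_functionP _ cK KU); first exact: smooth_on_partial.
move=> x xK; have oK : open (~` K).
  by apply: closed_openC; exact: compact_closedV.
rewrite (@near_eq_derive _ _ _ _ (cst 0)) ?derive_cst//.
by apply: filterS (open_nbhs_nbhs (conj oK xK)) => y /phi0.
Qed.

(** [f] is arbitrary outside [U]: the product is smooth on [U] as a product, and off the compact
    support of [phi] because it vanishes there. *)
Lemma test_functionM U f phi : open U -> smooth_on U f -> test_function U phi ->
  test_function U (fun x => f x * phi x).
Proof.
move=> oU sf tphi; have [K [cK KU phi0]] := test_function_compact tphi.
have [sphi _ _] := tphi.
apply: (test_functionP _ cK KU) => [|x /phi0->]; last by rewrite mulr0.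
apply: smooth_on_local => x _; have [Kx|nKx] := pselect (K x).
  exists U, (fun x => f x * phi x); first by split=> //; exact: KU.
  split; last by [].
  by apply: (smooth_onM oU sf); exact: smooth_on_sub sphi.
have oK : open (~` K).
  by apply: closed_openC; exact: compact_closedV.
exists (~` K), (fun=> 0); first by [].
split; first exact: smooth_on_cst.
by move=> y /phi0 ->; rewrite mulr0.
Qed.

Lemma derive_reflect (a : R) f c x j : smooth_on setT f ->
  is_derive x (basis_vec j) (fun y => a * f (c - y)) (- a * 'D_(basis_vec j) f (c - x)).
Proof.
move=> sf; apply/is_derive_lineP.
have /is_derive_lineP dF := smooth_on_is_derive j sf (I : setT (c - x)).
set F := fun h : R => f (h *: basis_vec j + (c - x)) in dF.
have -> : (fun h : R => a * f (c - (h *: basis_vec j + x))) = (fun h => a *: (F \o -%R) h).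
  by apply/funext => h; rewrite /F /= scaleNr; congr (a * f _); rewrite opprD addrCA.
have dN : is_derive (0 : R) (1 : R) (-%R : R -> R) (- 1).
  exact: is_deriveNid.
rewrite -oppr0 in dF; have dc := is_derive1_comp dF dN.
apply: is_derive_eq (is_deriveZ a dc) _.
by rewrite /GRing.scale/= mulrN1 mulNr mulrN.
Qed.

Lemma smooth_reflect f c : smooth_on setT f -> smooth_on setT (fun y => f (c - y)).
Proof.
(* The factor [a] absorbs the sign that each differentiation produces. *)
move=> sf; pose S := [set g | exists a f', smooth_on setT f' /\
  g = fun y : Rn => a * f' (c - y)].
apply: (@smooth_coind _ _ setT S openT); last first.
  by exists 1, f; split => //; apply/funext => y; rewrite mul1r.
move=> _ [a [f' [sf' ->]]]; split=> [x _|j].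
  apply: (@continuousM _ _ (cst a) (fun y => f' (c - y))); first exact: cst_continuous.
  apply: (@continuous_comp _ _ _ (fun y => c - y) f').
    apply: (@continuousB _ _ _ (cst c) id); first exact: cst_continuous.
    exact: cvg_id.
  exact: smooth_on_continuous sf' I.
exists (fun x => - a * 'D_(basis_vec j) f' (c - x)) => [|x _]; last exact: derive_reflect.
by exists (- a), ('D_(basis_vec j) f'); split; [exact: smooth_on_partial|].
Qed.

Lemma compact_sub_reflect K c : compact K -> compact [set y | K (c - y)].
Proof.
move=> cK; have -> : [set y | K (c - y)] = (fun y : Rn => c - y) @` K.
  apply/seteqP; split=> [y Ky|_ [y Ky <-]]; last by rewrite /= subKr.
  by exists (c - y) => //; rewrite subKr.
apply: continuous_compact => //; apply: continuous_subspaceT => x.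
apply: (@continuousB _ _ _ (cst c) id); first exact: cst_continuous.
exact: cvg_id.
Qed.

Lemma test_function_reflect phi c : test_function setT phi ->
  test_function setT (fun y => phi (c - y)).
Proof.
move=> tphi; have [K [cK KU phi0]] := test_function_compact tphi.
have [sphi _ _] := tphi.
refine (@test_functionP setT _ _ (smooth_reflect c sphi) (@compact_sub_reflect K c cK) _ _).
  exact: subsetT.
by move=> x /phi0.
Qed.

Lemma test_function_bounded U phi : test_function U phi ->
  exists2 C, 0 <= C & forall x, `|phi x| <= C.
Proof.
move=> tphi; have [K [cK KU phi0]] := test_function_compact tphi.
have [sphi _ _] := tphi.
have /compact_bounded[M [_ Mb]] : compact (phi @` K).
  apply: continuous_compact => //; apply: continuous_subspaceT => x.
  exact: smooth_on_continuous sphi I.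
exists (`|M| + 1) => [|x]; first by rewrite addr_ge0.
have [Kx|/phi0->] := pselect (K x); last by rewrite normr0 addr_ge0.
by apply: Mb; [rewrite (le_lt_trans (ler_norm _))// ltrDl|exists x].
Qed.

(** Compactness, in its near-covering form, gives one radius for all points of [K]; at two points
    outside [K] the values are both 0. *)
Lemma test_function_unif_continuous U phi (e : R) : test_function U phi -> 0 < e ->
  \forall d \near (0 : R)^'+, forall x y, `|x - y| <= d -> `|phi x - phi y| <= e.
Proof.
move=> tphi e0; have [K [cK KU phi0]] := test_function_compact tphi.
have [sphi _ _] := tphi.
have /compact_near_coveringP nK := cK.
have h : \forall d \near (0 : R)^'+,
    K `<=` (fun x => forall y, `|x - y| <= d -> `|phi x - phi y| <= e).
  apply: (nK _ _ (fun d x => forall y, `|x - y| <= d -> `|phi x - phi y| <= e)) => x Kx.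
  have /cvgrPdist_le/(_ (e / 2)) := smooth_on_continuous sphi (I : setT x).
  rewrite divr_gt0// => /(_ isT)/nbhs_ballP[r /= r0 xr].
  exists (ball x (r / 2), [set d : R | d < r / 2]).
    split; first by apply: nbhsx_ballx; rewrite divr_gt0.
    by apply: nbhs_right_lt; rewrite divr_gt0.
  move=> [x' d] [/= xx' dr] y x'y.
  have xy : ball x r y.
    rewrite -ball_normE/= in xx' *.
    rewrite (le_lt_trans (ler_distD x' _ _))// (splitr r) ltrD//.
    exact: le_lt_trans x'y dr.
  rewrite (le_trans (ler_distD (phi x) _ _))// (splitr e) lerD//.
    rewrite distrC; apply: xr; apply: le_ball xx'.
    by rewrite ler_pdivrMr//; lra.
  exact: xr.
apply: filterS h => d hd x y xy.
have [Kx|/phi0 x0] := pselect (K x); first exact: hd.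
have [Ky|/phi0 y0] := pselect (K y); last by rewrite x0 y0 subrr normr0 ltW.
by rewrite distrC; apply: hd => //; rewrite distrC.
Qed.

Lemma integrable_compact_supp f (C : R) K : compact K ->
  measurable_fun setT (f : X -> R) -> (forall x, `|f x| <= C) ->
  (forall x, ~ K x -> f x = 0) -> mu.-integrable setT (EFin \o (f : X -> R)).
Proof.
move=> cK mf fC f0.
have mK := compact_measurable_leb cK.
suff : mu.-integrable (K : set X) (EFin \o (f : X -> R)).
  move=> /(integrable_mkcond _ mK).1; congr (integrable _ _ _).
  apply/funext => x; rewrite /patch; case: ifPn => // /negP.
  by rewrite inE /= => /f0 ->.
apply: measurable_bounded_integrable => //.
- exact: compact_leb_lty.
- exact: measurable_funTS.
- exists C; split; first exact: num_real.
  by move=> M CM x _; apply: le_trans (ltW CM).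
Qed.

Lemma test_function_measurable U phi : test_function U phi ->
  measurable_fun setT (phi : X -> R).
Proof.
move=> [s _ _]; apply: continuousT_measurable_leb => x.
exact: smooth_on_continuous s I.
Qed.

Lemma test_function_integrable U phi : test_function U phi ->
  mu.-integrable setT (EFin \o (phi : X -> R)).
Proof.
move=> tphi; have [K [cK KU phi0]] := test_function_compact tphi.
have [C C0 phiC] := test_function_bounded tphi.
exact: (integrable_compact_supp cK (test_function_measurable tphi) phiC phi0).
Qed.

End test_functions.

(** * Convolution *)

Section convolution.
Local Open Scope classical_set_scope.
Local Open Scope ring_scope.
Context {R : realType} {n : nat}.
Local Notation Rn := 'cV[R]_n.+1.
Local Notation X := (lebT R n).
Local Notation mu := (leb R n).
Implicit Types (phi u v : Rn -> R) (K : set Rn) (x y : Rn) (j : 'I_n.+1).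

Lemma continuous_atP (f : Rn -> R) x :
  (forall e, 0 < e -> exists2 d, 0 < d & forall y, `|x - y| < d -> `|f x - f y| <= e) ->
  {for x, continuous f}.
Proof.
move=> h A /nbhs_ballP[e /= e0 eA]; have e20 : 0 < e / 2 by rewrite divr_gt0.
have [d d0 dP] := h _ e20; apply/nbhs_ballP; exists d => // y.
rewrite -ball_normE/= => /dP xy; apply: eA; rewrite -ball_normE/=.
by apply: le_lt_trans xy _; lra.
Qed.

(* An inductive type rather than a definition: unification never unfolds it. *)
Variant summable u : Prop :=
  Summable of mu.-integrable setT (EFin \o (u : X -> R)).

Definition conv phi u x : R := Rintegral mu setT (fun y : X => phi (x - (y : Rn)) * u y).

Lemma summable_integrable u : summable u -> mu.-integrable setT (EFin \o (u : X -> R)).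
Proof. by case. Qed.

Lemma summable_measurable u : summable u -> measurable_fun setT (u : X -> R).
Proof. by case=> /measurable_int /measurable_EFinP. Qed.

Lemma summableD u v : summable u -> summable v -> summable (fun x => u x + v x).
Proof. by move=> [su] [sv]; exact: Summable (integrableD measurableT su sv). Qed.

Lemma summableZ (c : R) u : summable u -> summable (fun x => c * u x).
Proof. by move=> [su]; exact: Summable (integrableZl measurableT _ su). Qed.

Lemma summableB u v : summable u -> summable v -> summable (fun x => u x - v x).
Proof. by move=> [su] [sv]; exact: Summable (integrableB measurableT su sv). Qed.

Lemma summable_le u v : measurable_fun setT (u : X -> R) ->
  (forall x, `|u x| <= v x) -> summable v -> summable u.
Proof.
move=> mu_ uv [sv]; apply: Summable; apply: (le_integrable measurableT _ _ sv).
  exact/measurable_EFinP.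
by move=> x _; rewrite lee_fin (le_trans (uv x))// ler_norm.
Qed.

Lemma summable_norm u : summable u -> summable (fun x => `|u x|).
Proof. by move=> [su]; exact: Summable (integrable_norm su). Qed.

Lemma summable_compact_supp u (C : R) K : compact K ->
  measurable_fun setT (u : X -> R) -> (forall x, `|u x| <= C) ->
  (forall x, ~ K x -> u x = 0) -> summable u.
Proof. by move=> cK mu_ uC u0; exact: Summable (integrable_compact_supp cK mu_ uC u0). Qed.

Lemma test_function_summable (U : set Rn) phi : test_function U phi -> summable phi.
Proof. by move=> tphi; exact: Summable (test_function_integrable tphi). Qed.

Lemma summable_boundedM phi u (C : R) : measurable_fun setT (phi : X -> R) ->
  (forall x, `|phi x| <= C) -> summable u -> summable (fun x => phi x * u x).
Proof.
move=> mphi phiC su; apply: (@summable_le _ (fun x => C * `|u x|)).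
- exact: measurable_funM mphi (summable_measurable su).
- by move=> x; rewrite normrM ler_wpM2r.
- exact: summableZ (summable_norm su).
Qed.

Lemma summable_conv phi u x : test_function setT phi -> summable u ->
  summable (fun y => phi (x - y) * u y).
Proof.
move=> tphi su; have tr := test_function_reflect x tphi.
have [C _ phiC] := test_function_bounded tr.
exact: summable_boundedM (test_function_measurable tr) phiC su.
Qed.

Lemma convD phi u v x : test_function setT phi -> summable u -> summable v ->
  conv phi (fun x => u x + v x) x = conv phi u x + conv phi v x.
Proof.
move=> tphi su sv; rewrite /conv.
rewrite -(RintegralD measurableT (summable_integrable (summable_conv x tphi su))
  (summable_integrable (summable_conv x tphi sv))).
by apply: eq_Rintegral => y _; rewrite mulrDr.
Qed.

Lemma convZ phi (c : R) u x : test_function setT phi -> summable u ->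
  conv phi (fun x => c * u x) x = c * conv phi u x.
Proof.
move=> tphi su; rewrite /conv -(RintegralZl _ measurableT (summable_integrable (summable_conv x tphi su))).
by apply: eq_Rintegral => y _; rewrite mulrCA.
Qed.

Lemma convB phi u v x : test_function setT phi -> summable u -> summable v ->
  conv phi (fun x => u x - v x) x = conv phi u x - conv phi v x.
Proof.
move=> tphi su sv; rewrite /conv.
rewrite -(RintegralB measurableT (summable_integrable (summable_conv x tphi su))
  (summable_integrable (summable_conv x tphi sv))).
by apply: eq_Rintegral => y _; rewrite mulrBr.
Qed.

Lemma conv_continuous phi u : test_function setT phi -> summable u ->
  continuous (conv phi u).
Proof.
move=> tphi su x; apply: continuous_atP => e e0.
pose M := Rintegral mu setT (fun y : X => `|u y|).
have M0 : 0 <= M by apply: Rintegral_ge0.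
have e'0 : 0 < e / (M + 1) by rewrite divr_gt0// ltr_wpDl.
have /filter_ex[/= d [d0 dP]] : \forall d \near (0 : R)^'+, 0 < d /\
    forall x y, `|x - y| <= d -> `|phi x - phi y| <= e / (M + 1).
  apply: filterI; first exact: nbhs_right_gt.
  exact: test_function_unif_continuous tphi e'0.
exists d => // x' xx'.
have sd := summableB (summable_conv x tphi su) (summable_conv x' tphi su).
rewrite /conv -(RintegralB measurableT (summable_integrable (summable_conv x tphi su))
  (summable_integrable (summable_conv x' tphi su))).
apply: (le_trans (le_normr_Rintegral measurableT (summable_integrable sd))).
apply: (@le_trans _ _ (Rintegral mu setT (fun y : X => e / (M + 1) * `|u y|))).
  apply: (le_Rintegral measurableT (summable_integrable (summable_norm sd))
    (summable_integrable (summableZ _ (summable_norm su)))).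
  move=> y _; rewrite -mulrBl normrM ler_wpM2r//; apply: dP.
  by rewrite opprB addrA subrK ltW.
rewrite (RintegralZl _ measurableT (summable_integrable (summable_norm su))).
by rewrite -/M mulrAC ler_pdivrMr ?ltr_wpDl// ler_pM2l// lerDl.
Qed.

Lemma is_derive_line phi x j (h : R) : smooth_on setT phi ->
  is_derive h (1 : R) (fun h => phi (h *: basis_vec j + x))
    ('D_(basis_vec j) phi (h *: basis_vec j + x)).
Proof.
move=> sphi; set v := basis_vec j.
have /is_derive_lineP := smooth_on_is_derive j sphi (I : setT (h *: v + x)).
set G := fun t : R => _; rewrite -[in X in X -> _](subrr h) => dG.
have -> : (fun h => phi (h *: v + x)) = G \o (fun t => t - h).
  by apply/funext => t; rewrite /G /= addrA -scalerDl subrK.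
have d1 : is_derive h (1 : R) (fun t : R => t - h) 1.
  exact: (is_derive_shift h 1 (- h)).
have := @is_derive1_comp _ G (fun t => t - h) h _ _ dG d1; by rewrite mulr1.
Qed.

(** Differentiation under the integral sign along the line through [x], dominated by [C * |u|] with
    [C] a bound for the partial derivative of [phi]. *)
Lemma conv_is_derive phi u x j : test_function setT phi -> summable u ->
  is_derive x (basis_vec j) (conv phi u) (conv ('D_(basis_vec j) phi) u x).
Proof.
move=> tphi su; set v := basis_vec j.
have [sphi _ _] := tphi.
have tdphi := test_function_partial j tphi.
have [C C0 dphiC] := test_function_bounded tdphi.
pose f (h : R) (y : X) : R := phi (h *: v + x - y) * u y.
have fE h : EFin \o f h = EFin \o (fun y : X => phi ((h *: v + x) - (y : Rn)) * u y) by [].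
have df h y : is_derive h (1 : R) (f ^~ y) ('D_v phi (h *: v + x - y) * u y).
  have := is_derive_line (x - y) j h sphi; rewrite -/v addrA => d1.
  have -> : f ^~ y = (fun h : R => u y *: phi (h *: v + (x - y))).
    by apply/funext => t; rewrite /f addrA mulrC.
  by apply: is_derive_eq (is_deriveZ (u y) d1) _; rewrite mulrC.
have d1E h y : partial1of2 f h y = 'D_v phi (h *: v + x - y) * u y.
  by rewrite partial1of2E; case: (df h y).
have I0 : (`](-1 : R), 1[%classic : set R) 0 by rewrite /= in_itv/= ltrN10 ltr01.
have := @cvg_differentiation_under_integral R _ X mu f setT measurableT 0 (-1) 1 I0
  (fun h _ => summable_integrable (summable_conv (h *: v + x) tphi su))
  (fun h y _ _ => let: DeriveDef d _ := df h y in d)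
  (fun y => C * `|u y|) (fun y => mulr_ge0 C0 (normr_ge0 _))
  (summable_integrable (summableZ C (summable_norm su))).
have dC (h : R) (y : X) : `](-1 : R), 1[%classic h -> setT y -> `|partial1of2 f h y| <= C * `|u y|.
  by move=> _ _; rewrite d1E normrM ler_wpM2r.
move=> /(_ dC) lim; apply/is_derive_lineP.
have E : Rintegral mu setT (fun y => partial1of2 f 0 y) = conv ('D_v phi) u x.
  by apply: eq_Rintegral => y _; rewrite d1E scale0r add0r.
rewrite E in lim.
have lim' : h^-1 *: (conv phi u ((h *: (1 : R) + 0) *: v + x) - conv phi u ((0 : R) *: v + x))
    @[h --> (0 : R)^'] --> conv ('D_v phi) u x.
  apply: cvg_trans lim; apply: near_eq_cvg; near=> h.
  by rewrite [h *: (1 : R)]mulr1.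
by apply: DeriveDef; [exact: cvgP lim'|exact: cvg_lim lim'].
Unshelve. all: by end_near. Qed.

(** The convolutions of test functions with [u] form a class stable under differentiation, which
    only changes the test function. *)
Lemma conv_smooth phi u : test_function setT phi -> summable u ->
  smooth_on setT (conv phi u).
Proof.
move=> tphi su; pose S := [set g | exists2 psi, test_function setT psi & g = conv psi u].
apply: (@smooth_coind _ _ setT S openT); last by exists phi.
move=> _ [psi tpsi ->]; split=> [x _|j]; first exact: conv_continuous.
exists (conv ('D_(basis_vec j) psi) u) => [|x _]; last exact: conv_is_derive.
by exists ('D_(basis_vec j) psi) => //; exact: test_function_partial.
Qed.

Lemma conv_shift phi x : test_function setT phi ->
  Rintegral mu setT (fun y : X => phi (x - (y : Rn))) =
  Rintegral mu setT (fun y : X => phi (- (y : Rn))).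
Proof.
move=> tphi; have mr := test_function_measurable (test_function_reflect x tphi).
rewrite /Rintegral -(integral_shift x ((measurable_EFinP _ _).2 mr)).
by congr fine; apply: eq_integral => y _ /=; rewrite opprD addrCA subrr addr0.
Qed.

(** Fubini's theorem is avoided: the convolution of the function with the indicator of a large ball
    is constant near 0, by translation invariance, and the integral in question is its derivative at
    0. *)
Lemma integral_partial phi j : test_function setT phi ->
  Rintegral mu setT (fun y : X => 'D_(basis_vec j) phi y) = 0.
Proof.
pose v : Rn := basis_vec j.
suff h psi : test_function setT psi ->
    Rintegral mu setT (fun y : X => 'D_v psi (- (y : Rn))) = 0.
  move=> tphi; have [sphi _ _] := tphi.
  have := h _ (test_function_reflect 0 tphi).
  have -> : (fun y : X => 'D_v (fun y => phi (0 - y)) (- (y : Rn))) =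
      (fun y : X => - 1 * 'D_v phi y).
    apply/funext => y; have := derive_reflect 1 0 (- y) j sphi.
    by under eq_fun do rewrite mul1r; rewrite sub0r opprK -/v; case.
  rewrite (RintegralZl (-1) measurableT (test_function_integrable (test_function_partial j tphi))).
  by rewrite mulN1r => /eqP; rewrite oppr_eq0 => /eqP.
move=> {phi} tpsi.
have [K [cK _ psi0]] := test_function_compact tpsi.
have [N N0 KN] := compact_box cK.
(* The radius [N + 1] leaves room for all translations by vectors of norm at most 1. *)
pose B : set Rn := [set x | `|x| <= N + 1].
have cB : compact B.
  apply: (cV_bounded_closed_compact (M := N + 1)) => //.
  apply: (@preimage_closed _ _ (fun x : Rn => `|x|) _ _ (@closed_le _ (N + 1))) => x _.
  exact: norm_continuous.
have mB := compact_measurable_leb cB.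
have sB : summable (\1_B : Rn -> R).
  apply: (summable_compact_supp (C := 1) cB); first exact: measurable_indic.
    by move=> x; rewrite indicE normr_nat lern1 leq_b1.
  by move=> x xB; rewrite indicE memNset.
have convE phi x : test_function setT phi -> (forall x, ~ K x -> phi x = 0) -> `|x| <= 1 ->
    conv phi \1_B x = Rintegral mu setT (fun y : X => phi (- (y : Rn))).
  move=> tphi phi0 x1; rewrite -(conv_shift x tphi); apply: eq_Rintegral => y _.
  have [By|nBy] := pselect (B y); first by rewrite indicE mem_set// mulr1.
  rewrite phi0 ?mul0r// => Kxy; apply: nBy => /=.
  have -> : (y : Rn) = x - (x - y) by rewrite subKr.
  apply: le_trans (ler_normB _ _) _; rewrite addrC lerD//.
  apply: normcV_le; first exact: ltW.
  by move=> i; have := KN _ Kxy i; rewrite !mxE ler_norml => /andP[/ltW -> ->].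
have <- := convE _ 0 (test_function_partial j tpsi) _ _; last 2 first.
- move=> x nKx; rewrite (@near_eq_derive _ _ _ _ (cst 0)) ?derive_cst//.
  have oK : open (~` K) by apply: closed_openC; exact: compact_closedV.
  by apply: filterS (open_nbhs_nbhs (conj oK nKx)) => y /psi0.
- by rewrite normr0.
case: (conv_is_derive 0 j tpsi sB) => _ <-.
rewrite (@near_eq_derive _ _ _ _ (cst (Rintegral mu setT (fun y : X => psi (- (y : Rn)))))) ?derive_cst//.
apply/nbhs_ballP; exists 1 => /=; first exact: ltr01.
move=> x; rewrite -ball_normE/= sub0r normrN => x1.
by rewrite convE// ltW.
Qed.

End convolution.

(** * Mollifiers *)

Section mollifiers.
Local Open Scope classical_set_scope.
Local Open Scope ring_scope.
Context {R : realType} {n : nat}.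
Local Notation Rn := 'cV[R]_n.+1.
Local Notation X := (lebT R n).
Local Notation mu := (leb R n).
Implicit Types (u v : Rn -> R) (x y : Rn) (k : nat).

Lemma summable_indic (A : set X) : measurable A -> (mu A < +oo)%E ->
  summable (\1_A : Rn -> R).
Proof.
move=> mA muA; apply: Summable; apply/integrableP; split.
  exact/measurable_EFinP/measurable_indic.
rewrite (eq_integral (fun x : X => (\1_A x)%:E)); last by move=> x _; rewrite gee0_abs ?lee_fin.
by rewrite integral_indic// setIT.
Qed.

(** Supported in the cube of half-side 1/(k+1), a ball of the maximum norm, so that mollification
    fits a grid of cubes. The bump is written down at each scale and normalized by its own integral,
    instead of being rescaled. *)
Definition bump k x : R := \prod_i
  (flat 1 (k.+1%:R * x i 0 + 1) * flat 1 (- k.+1%:R * x i 0 + 1)).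

Let flat1_ge0 (t : R) : 0 <= flat 1 t.
Proof. by rewrite /flat; case: ifP => // _; rewrite hornerE mul1r expR_ge0. Qed.

Let flat1_le1 (t : R) : flat 1 t <= 1.
Proof.
rewrite /flat; case: ifP => // t0; rewrite hornerE mul1r -expR0 ler_expR.
by rewrite oppr_le0 invr_ge0 ltW.
Qed.

Let flat1_half (t : R) : 2^-1 <= t -> expR (- 2) <= flat 1 t.
Proof.
move=> t2; have t0 : 0 < t by rewrite (lt_le_trans _ t2)// invr_gt0.
by rewrite /flat t0 hornerE mul1r ler_expR lerN2 -[leRHS]invrK lef_pV2 ?posrE ?invr_gt0.
Qed.

Lemma bump_ge0 k x : 0 <= bump k x.
Proof. by apply: prodr_ge0 => i _; rewrite mulr_ge0. Qed.

Lemma bump_le1 k x : bump k x <= 1.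
Proof.
apply: prodr_ile1 => i _; rewrite mulr_ge0//=.
by apply: mulr_ile1.
Qed.

Lemma bump_eq0 k x : k.+1%:R^-1 < `|x| -> bump k x = 0.
Proof.
move=> kx; apply/eqP; apply: contraTT kx; rewrite -leNgt => b0.
apply: normcV_le => [|i]; first by rewrite invr_ge0.
move: b0; rewrite /bump prodf_seq_neq0 => /allP/(_ i).
rewrite mem_index_enum /= => /(_ isT); rewrite mulf_eq0 negb_or => /andP[].
rewrite /flat; case: ifP => [h1 _|_]; last by rewrite eqxx.
case: ifP => [h2 _|_]; last by rewrite eqxx.
have k0 : 0 < k.+1%:R :> R by rewrite ltr0n.
by rewrite ler_norml -(ler_pM2l k0) -[_ <= k.+1%:R^-1](ler_pM2l k0) mulrN mulfV ?gt_eqF//; lra.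
Qed.

(** On the half-size cube both arguments of [flat 1] are at least 1/2, where [flat 1] is at least
    exp(-2). *)
Definition bump_min : R := \prod_(i < n.+1) (expR (- 2) * expR (- 2)).

Lemma bump_min_gt0 : 0 < bump_min.
Proof. by apply: prodr_gt0 => i _; rewrite mulr_gt0// expR_gt0. Qed.

Lemma bump_ge k x : (forall i, `|x i 0| <= (2 * k.+1%:R)^-1) -> bump_min <= bump k x.
Proof.
move=> xk; apply: ler_prod => i _.
rewrite mulr_ge0 ?expR_ge0//=.
have k0 : 0 < k.+1%:R :> R by rewrite ltr0n.
have : `|k.+1%:R * x i 0| <= 2^-1.
  by rewrite normrM gtr0_norm// mulrC -ler_pdivlMr// -invfM.
rewrite ler_norml => /andP[h1 h2].
by apply: ler_pM; rewrite ?expR_ge0//; apply: flat1_half; lra.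
Qed.

Lemma bump_test k : test_function setT (bump k).
Proof.
pose B : set Rn := [set x | `|x| <= k.+1%:R^-1].
apply: (@test_functionP _ _ setT _ B).
- apply: (smooth_on_prod _ openT) => i.
  exact: (smooth_onM openT (smooth_flat_coord _ _ _ _) (smooth_flat_coord _ _ _ _)).
- apply: (cV_bounded_closed_compact (M := k.+1%:R^-1)) => //.
  apply: (@preimage_closed _ _ (fun x : Rn => `|x|) _ _ (@closed_le _ _)) => x _.
  exact: norm_continuous.
- exact: subsetT.
- by move=> x /negP; rewrite -ltNge; exact: bump_eq0.
Qed.

Definition bump_int k : R := Rintegral mu setT (bump k : X -> R).

(** The half-size cube has volume (k+1)^-(n+1). This bound takes the place of a scaling identity: it
    bounds the normalized mollifier by (k+1)^(n+1) up to a constant independent of [k]. *)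
Lemma bump_int_ge k : bump_min / k.+1%:R ^+ n.+1 <= bump_int k.
Proof.
pose r : R := (2 * k.+1%:R)^-1.
have r0 : 0 < r by rewrite invr_gt0 mulr_gt0.
pose B : set X := box (const_mx (- r), const_mx r).
have mB : measurable B by exact: measurable_box.
have muB : mu B = (k.+1%:R ^- n.+1)%:E.
  rewrite leb_box /box_volume; congr EFin.
  rewrite (eq_bigr (fun=> k.+1%:R^-1)) => [|i _].
    by rewrite prodr_const card_ord exprVn.
  rewrite !mxE opprK max_r; last by rewrite addr_ge0// ltW.
  by rewrite /r; field; rewrite nat1r pnatr_eq0.
have sB : summable (\1_B : Rn -> R).
  by apply: summable_indic => //; rewrite muB ltry.
have iB := summable_integrable (summableZ bump_min sB).
have -> : bump_min / k.+1%:R ^+ n.+1 = Rintegral mu setT (fun x : X => bump_min * \1_B x).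
  rewrite (RintegralZl _ measurableT (summable_integrable sB)).
  by rewrite /Rintegral integral_indic// setIT muB.
apply: (le_Rintegral measurableT iB (test_function_integrable (bump_test k))) => x _.
have [Bx|nBx] := pselect (B x); last by rewrite indicE memNset// mulr0 bump_ge0.
rewrite indicE mem_set// mulr1; apply: bump_ge => i.
by have := Bx i; rewrite !mxE ler_norml => /andP[/ltW -> ->].
Qed.

Lemma bump_int_gt0 k : 0 < bump_int k.
Proof.
by apply: lt_le_trans (bump_int_ge k); rewrite divr_gt0 ?bump_min_gt0// exprn_gt0.
Qed.

Definition mollifier k x : R := (bump_int k)^-1 * bump k x.

Lemma mollifier_ge0 k x : 0 <= mollifier k x.
Proof. by rewrite mulr_ge0 ?bump_ge0// invr_ge0 ltW// bump_int_gt0. Qed.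

Lemma mollifier_le k x : mollifier k x <= bump_min^-1 * k.+1%:R ^+ n.+1.
Proof.
rewrite -[leRHS]mulr1; apply: ler_pM; rewrite ?bump_ge0 ?bump_le1 ?invr_ge0//.
  by rewrite ltW// bump_int_gt0.
rewrite -[X in _ <= _ * X]invrK -invfM lef_pV2 ?posrE ?bump_int_gt0 ?bump_int_ge//.
by rewrite divr_gt0 ?bump_min_gt0// exprn_gt0.
Qed.

Lemma mollifier_eq0 k x : k.+1%:R^-1 < `|x| -> mollifier k x = 0.
Proof. by move=> kx; rewrite /mollifier bump_eq0 ?mulr0. Qed.

Lemma mollifier_test k : test_function setT (mollifier k).
Proof.
apply: (test_functionM openT _ (bump_test k)).
exact: smooth_on_cst openT.
Qed.

Lemma integral_mollifier k x :
  Rintegral mu setT (fun y : X => mollifier k (x - (y : Rn))) = 1.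
Proof.
rewrite (conv_shift _ (mollifier_test k)) /mollifier.
have -> : (fun y : X => (bump_int k)^-1 * bump k (- (y : Rn))) =
    (fun y : X => (bump_int k)^-1 * bump k y).
  apply/funext => y; congr (_ * _); apply: eq_bigr => i _.
  by rewrite mulrC !mxE !mulrN mulNr opprK.
rewrite RintegralZl//; last exact: test_function_integrable (bump_test k).
by rewrite mulVf// gt_eqF// bump_int_gt0.
Qed.

Definition mollify k u : Rn -> R := conv (mollifier k) u.

Lemma mollify_smooth k u : summable u -> smooth_on setT (mollify k u).
Proof. exact: conv_smooth (mollifier_test k). Qed.

Lemma mollify_measurable k u : summable u -> measurable_fun setT (mollify k u : X -> R).
Proof.
move=> su; apply: continuousT_measurable_leb.
exact: conv_continuous (mollifier_test k) su.
Qed.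

Lemma mollify_eq0 k u x :
  (forall y, `|x - y| <= k.+1%:R^-1 -> u y = 0) -> mollify k u x = 0.
Proof.
move=> u0; rewrite /mollify /conv.
rewrite (_ : (fun y : X => _) = cst 0) ?Rintegral_cst// ?mul0r//.
apply/funext => y /=; have [xy|xy] := leP `|x - y| k.+1%:R^-1.
  by rewrite u0 ?mulr0.
by rewrite mollifier_eq0 ?mul0r.
Qed.

Lemma mollify_norm_le k u x : summable u ->
  `|mollify k u x| <= mollify k (fun y => `|u y|) x.
Proof.
move=> su; have sc := summable_conv x (mollifier_test k) su.
apply: le_trans (le_normr_Rintegral measurableT (summable_integrable sc)) _.
rewrite le_eqVlt; apply/orP; left; apply/eqP; apply: eq_Rintegral => y _.
by rewrite normrM ger0_norm// mollifier_ge0.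
Qed.

(** [mollify k u x] averages the values of [u] within distance 1/(k+1) of [x], with nonnegative
    weights of total mass 1. Sup bounds, convergence at points of continuity and the values of
    cutoffs are all instances of this. *)
Lemma mollify_dist k u x (c e : R) : summable u -> 
  (forall y, `|x - y| <= k.+1%:R^-1 -> `|u y - c| <= e) ->
  `|mollify k u x - c| <= e.
Proof.
move=> su ue; have tm := mollifier_test k.
have tr := test_function_reflect x tm.
have sm : summable (fun y => mollifier k (x - y)) by exact: test_function_summable tr.
have sc := summable_conv x tm su.
have smc : summable (fun y => mollifier k (x - y) * c).
  by under eq_fun do rewrite mulrC; exact: summableZ.
have cE : c = Rintegral mu setT (fun y : X => mollifier k (x - (y : Rn)) * c).
  by rewrite (RintegralZr _ measurableT (summable_integrable sm)) integral_mollifier mul1r.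
rewrite {1}cE /mollify /conv.
rewrite -(RintegralB measurableT (summable_integrable sc) (summable_integrable smc)).
have sd := summableB sc smc.
apply: le_trans (le_normr_Rintegral measurableT (summable_integrable sd)) _.
have sme : summable (fun y => mollifier k (x - y) * e).
  by under eq_fun do rewrite mulrC; exact: summableZ.
apply: (@le_trans _ _ (Rintegral mu setT (fun y : X => mollifier k (x - (y : Rn)) * e))).
  apply: (le_Rintegral measurableT (summable_integrable (summable_norm sd)) (summable_integrable sme)).
  move=> y _; rewrite -mulrBr normrM ger0_norm ?mollifier_ge0//.
  have [xy|xy] := leP `|x - y| k.+1%:R^-1; last by rewrite mollifier_eq0 ?mul0r.
  by rewrite ler_wpM2l ?mollifier_ge0// ue.
by rewrite (RintegralZr _ measurableT (summable_integrable sm)) integral_mollifier mul1r.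
Qed.

Lemma mollify_le k u x (C : R) : summable u -> (forall y, `|u y| <= C) ->
  `|mollify k u x| <= C.
Proof.
move=> su uC; rewrite -[mollify k u x]subr0.
by apply: mollify_dist => // y _; rewrite subr0.
Qed.

Lemma mollify_ge0 k u x : (forall y, 0 <= u y) -> 0 <= mollify k u x.
Proof. by move=> u0; apply: Rintegral_ge0 => y _; rewrite mulr_ge0// mollifier_ge0. Qed.

Lemma mollify_cvg u x : summable u -> {for x, continuous u} ->
  mollify k u x @[k --> \oo] --> u x.
Proof.
move=> su cu; apply/cvgrPdist_le => e e0.
have /nbhs_ballP[r /= r0 ur] : nbhs x (u @^-1` ball (u x) e) by apply: cu; exact: nbhsx_ballx.
near=> k; rewrite distrC; apply: mollify_dist => // y xy.
have : ball x r y.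
  rewrite -ball_normE/=; apply: le_lt_trans xy _.
  near: k; exact: near_infty_natSinv_lt (PosNum r0).
by move/ur; rewrite -ball_normE/= distrC => /ltW.
Unshelve. all: by end_near. Qed.

End mollifiers.

(** * Exhaustion by compact sets and cutoff functions *)

Section exhaustion.
Local Open Scope classical_set_scope.
Local Open Scope ring_scope.
Context {R : realType} {n : nat}.
Local Notation Rn := 'cV[R]_n.+1.
Local Notation X := (lebT R n).
Local Notation mu := (leb R n).
Implicit Types (U K : set Rn) (x y : Rn) (i j k : nat).

(** Points of norm at most [i] at distance at least 1/(i+1) from the complement of [U]; the
    quantified form also makes sense when the complement is empty. *)
Definition exhaust U i : set Rn :=
  [set x | `|x| <= i%:R /\ forall y, ~ U y -> i.+1%:R^-1 <= `|x - y|].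

Lemma closed_norm_le x (r : R) : closed [set y : Rn | `|x - y| <= r].
Proof.
apply: (@preimage_closed _ _ (fun y : Rn => `|x - y|) _ _ (@closed_le _ r)) => y _.
apply: continuous_comp; last exact: norm_continuous.
by apply: (@continuousB _ _ _ (cst x) id); [exact: cst_continuous|exact: cvg_id].
Qed.

Lemma closed_norm_ge x (r : R) : closed [set y : Rn | r <= `|y - x|].
Proof.
apply: (@preimage_closed _ _ (fun y : Rn => `|y - x|) _ _ (@closed_ge _ r)) => y _.
apply: continuous_comp; last exact: norm_continuous.
by apply: (@continuousB _ _ _ id (cst x)); [exact: cvg_id|exact: cst_continuous].
Qed.

Lemma exhaust_compact U i : compact (exhaust U i).
Proof.
apply: (@cV_bounded_closed_compact _ _ _ i%:R) => [x []//|].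
rewrite (_ : exhaust U i = [set x : Rn | `|0 - x| <= i%:R] `&`
    \bigcap_(y in ~` U) [set x | i.+1%:R^-1 <= `|x - y|]).
  apply: closedI; first exact: closed_norm_le.
  by apply: closed_bigI => y _; exact: closed_norm_ge.
by apply/seteqP; split=> x /=; rewrite sub0r normrN.
Qed.

Lemma exhaust_measurable U i : measurable (exhaust U i : set X).
Proof. exact/compact_measurable_leb/exhaust_compact. Qed.

Lemma exhaust_sub U i : exhaust U i `<=` U.
Proof.
move=> x [_ h]; apply: contrapT => /h; rewrite subrr normr0 leNgt.
by rewrite invr_gt0 ltr0n.
Qed.

(** A distance by which one may leave level [i] and still be in level [i.+1]. *)
Definition gap i : R := i.+1%:R^-1 - i.+2%:R^-1.

Lemma gapE i : gap i = (i.+1%:R * i.+2%:R)^-1.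
Proof. by rewrite /gap; field; rewrite !nat1r -!natr1 !natr1 -natrD; rewrite !pnatr_eq0. Qed.

Lemma exhaust_ball U i x y : exhaust U i x -> `|x - y| <= gap i -> exhaust U i.+1 y.
Proof.
move=> [xi xU] xy; split.
  have g1 : gap i <= 1.
    by rewrite gapE invf_le1 ?mulr_gt0// mulr_ege1 ?ler1n.
  have -> : y = x - (x - y) by rewrite subKr.
  by rewrite (le_trans (ler_normB _ _))// -natr1 lerD// (le_trans xy).
move=> z /xU xz.
by rewrite -(lerD2l `|x - y|) (le_trans _ (ler_distD y x z))// (le_trans _ xz)// -lerBrDr.
Qed.

Lemma exhaust_mono U i j : (i <= j)%N -> exhaust U i `<=` exhaust U j.
Proof.
move=> ij x [xi xU]; split; first by rewrite (le_trans xi)// ler_nat.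
by move=> y /xU; apply: le_trans; rewrite lef_pV2 ?posrE// ler_nat.
Qed.

Lemma gap_gt0 i : 0 < gap i.
Proof. by rewrite gapE invr_gt0 mulr_gt0. Qed.

Lemma exhaust_cover U x : open U -> U x -> exists i, exhaust U i x.
Proof.
move=> oU Ux; have /nbhs_ballP[r /= r0 xr] := open_nbhs_nbhs (conj oU Ux).
pose i := maxn (Num.truncn `|x|).+1 (Num.truncn r^-1).+1.
exists i; split.
  rewrite (le_trans (ltW (truncnS_gt _)))// ler_nat; exact: leq_maxl.
move=> y nUy; have : r <= `|x - y|.
  by rewrite leNgt; apply/negP => xy; apply: nUy; apply: xr; rewrite -ball_normE.
apply: le_trans; rewrite -[leRHS]invrK lef_pV2 ?posrE ?invr_gt0//.
rewrite (le_trans (ltW (truncnS_gt _)))// ler_nat.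
by apply: leqW; exact: leq_maxr.
Qed.

(** For such [k], mollification enlarges a support contained in level [i] by at most one level. *)
Lemma gap_le i k : (i.+1 * i.+2 <= k)%N -> k.+1%:R^-1 <= gap i.
Proof.
move=> ik; rewrite gapE lef_pV2 ?posrE ?mulr_gt0// -natrM ler_nat.
exact: leqW.
Qed.

Lemma gap_mono i j : (i <= j)%N -> gap j <= gap i.
Proof.
by move=> ij; rewrite !gapE lef_pV2 ?posrE ?mulr_gt0// -!natrM ler_nat leq_mul.
Qed.

Lemma mollify_exhaust_eq0 U i k (u : Rn -> R) x : (i.+1 * i.+2 <= k)%N ->
  (forall y, ~ exhaust U i y -> u y = 0) -> ~ exhaust U i.+1 x -> mollify k u x = 0.
Proof.
move=> ik u0 xi; apply: mollify_eq0 => y xy; apply: u0 => yi; apply: xi.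
by apply: exhaust_ball yi _; rewrite distrC (le_trans xy)// gap_le.
Qed.

(** The scale is below [gap i.+1]: the result is 0 outside level [i.+2] and, because the gaps
    decrease, 1 on level [i]. *)
Definition cutoff U i : Rn -> R := mollify (i.+2 * i.+3) \1_(exhaust U i.+1).

Lemma summable_exhaust U i : summable (\1_(exhaust U i) : Rn -> R).
Proof.
apply: summable_indic; first exact: exhaust_measurable.
exact: compact_leb_lty (@exhaust_compact _ _).
Qed.

Lemma cutoff_eq1 U i x : exhaust U i x -> cutoff U i x = 1.
Proof.
move=> xi; apply/eqP; rewrite -subr_eq0 -normr_le0.
apply: mollify_dist; first exact: summable_exhaust.
move=> y xy; rewrite indicE mem_set ?subrr ?normr0//.
apply: exhaust_ball xi _; rewrite (le_trans xy)//.
by rewrite (le_trans (gap_le (leqnn _)))// gap_mono.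
Qed.

Lemma cutoff_eq0 U i x : ~ exhaust U i.+2 x -> cutoff U i x = 0.
Proof.
by apply: mollify_exhaust_eq0 => // y yi; rewrite indicE memNset.
Qed.

Lemma cutoff_test U i : test_function U (cutoff U i).
Proof.
apply: (test_functionP _ (@exhaust_compact U i.+2)); last exact: cutoff_eq0.
  exact: mollify_smooth (summable_exhaust _ _).
exact: exhaust_sub.
Qed.

Lemma cutoff_ge0 U i x : 0 <= cutoff U i x.
Proof. by apply: mollify_ge0 => y; rewrite indicE. Qed.

Lemma cutoff_le1 U i x : cutoff U i x <= 1.
Proof.
apply: le_trans (ler_norm _) _; apply: mollify_le; first exact: summable_exhaust.
by move=> y; rewrite indicE normr_nat lern1 leq_b1.
Qed.

End exhaustion.

(** * Weak derivatives *)

Section weak_derivatives.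
Local Open Scope classical_set_scope.
Local Open Scope ring_scope.
Context {R : realType} {n : nat}.
Local Notation Rn := 'cV[R]_n.+1.
Local Notation X := (lebT R n).
Local Notation mu := (leb R n).
Implicit Types (f g phi zeta : Rn -> R) (U K : set Rn) (x y : Rn) (j : 'I_n.+1).

Lemma loc_integrable_summable U K f : open U -> loc_integrable U f -> compact K -> K `<=` U ->
  summable (fun x => f x * \1_K x).
Proof.
move=> oU [mf fK] cK KU; have mK := compact_measurable_leb cK.
have iK : mu.-integrable (K : set X) (EFin \o (f : X -> R)).
  apply/integrableP; split; last exact: fK.
  by apply/measurable_EFinP; exact: measurable_funS (open_measurable_leb oU) KU mf.
apply: Summable; move/(integrable_mkcond _ mK) : iK; congr (integrable _ _ _).
apply/funext => x; rewrite /patch /= indicE; case: ifPn => _; first by rewrite mulr1.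
by rewrite mulr0.
Qed.

Lemma loc_integrable_testM U f zeta : open U -> loc_integrable U f -> test_function U zeta ->
  summable (fun x => f x * zeta x).
Proof.
move=> oU lf tz; have [K [cK KU z0]] := test_function_compact tz.
have [C _ zC] := test_function_bounded tz.
have := summable_boundedM (test_function_measurable tz) zC (loc_integrable_summable oU lf cK KU).
congr summable; apply/funext => x; rewrite mulrCA; congr (_ * _).
have [Kx|/z0 ->] := pselect (K x); last by rewrite mul0r.
by rewrite indicE mem_set// mulr1.
Qed.

Lemma loc_integrableB U f g : open U -> loc_integrable U f -> loc_integrable U g ->
  loc_integrable U (fun x => f x - g x).
Proof.
move=> oU [mf fK] [mg gK]; split; first exact: measurable_funB.
move=> K KU cK; have mK := compact_measurable_leb cK.
have mfK : measurable_fun (K : set X) (f : X -> R).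
  exact: measurable_funS (open_measurable_leb oU) KU mf.
have mgK : measurable_fun (K : set X) (g : X -> R).
  exact: measurable_funS (open_measurable_leb oU) KU mg.
have i1 : mu.-integrable (K : set X) (EFin \o (f : X -> R)).
  by apply/integrableP; split; [exact/measurable_EFinP|exact: fK].
have i2 : mu.-integrable (K : set X) (EFin \o (g : X -> R)).
  by apply/integrableP; split; [exact/measurable_EFinP|exact: gK].
by have /integrableP[_] := integrableB mK i1 i2.
Qed.

Lemma integral_supp U h : open U -> summable h -> (forall x, ~ U x -> h x = 0) ->
  (\int[mu]_(x in (U : set X)) (h x)%:E)%E = (Rintegral mu setT (h : X -> R))%:E.
Proof.
move=> oU [sh] h0; have hfin := integrable_fin_num measurableT sh.
rewrite /Rintegral (fineK hfin) [LHS]integral_mkcond; apply: eq_integral => x _.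
by rewrite /patch /=; case: ifPn => // /negP; rewrite inE /= => /h0 ->.
Qed.

Lemma test_function_eq0 U phi x : test_function U phi -> ~ U x -> phi x = 0.
Proof.
by move=> /test_function_compact[K [_ KU phi0]] nU; apply: phi0 => /KU.
Qed.

Lemma weak_partialE U j f g phi : open U -> loc_integrable U f ->
  weak_partial U j f g -> test_function U phi ->
  Rintegral mu setT (fun x : X => f x * 'D_(basis_vec j) phi x) =
  - Rintegral mu setT (fun x : X => g x * phi x).
Proof.
move=> oU lf [lg fg] tphi; have := fg _ tphi.
have td := test_function_partial j tphi.
have z1 x : ~ U x -> f x * 'D_(basis_vec j) phi x = 0.
  by move=> nU; rewrite (test_function_eq0 td nU) mulr0.
have z2 x : ~ U x -> g x * phi x = 0.
  by move=> nU; rewrite (test_function_eq0 tphi nU) mulr0.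
rewrite (integral_supp oU (loc_integrable_testM oU lf td) z1).
by rewrite (integral_supp oU (loc_integrable_testM oU lg tphi) z2) -EFinN => -[].
Qed.

Lemma weak_partialP U j f g : open U -> loc_integrable U f -> loc_integrable U g ->
  (forall phi, test_function U phi ->
    Rintegral mu setT (fun x : X => f x * 'D_(basis_vec j) phi x) =
    - Rintegral mu setT (fun x : X => g x * phi x)) ->
  weak_partial U j f g.
Proof.
move=> oU lf lg fg; split=> // phi tphi.
have td := test_function_partial j tphi.
have z1 x : ~ U x -> f x * 'D_(basis_vec j) phi x = 0.
  by move=> nU; rewrite (test_function_eq0 td nU) mulr0.
have z2 x : ~ U x -> g x * phi x = 0.
  by move=> nU; rewrite (test_function_eq0 tphi nU) mulr0.
rewrite (integral_supp oU (loc_integrable_testM oU lf td) z1).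
by rewrite (integral_supp oU (loc_integrable_testM oU lg tphi) z2) fg.
Qed.

Lemma weak_partialB U j f1 f2 g1 g2 : open U ->
  loc_integrable U f1 -> loc_integrable U f2 ->
  weak_partial U j f1 g1 -> weak_partial U j f2 g2 ->
  weak_partial U j (fun x => f1 x - f2 x) (fun x => g1 x - g2 x).
Proof.
move=> oU l1 l2 w1 w2; have [lg1 _] := w1; have [lg2 _] := w2.
apply: (weak_partialP oU (loc_integrableB oU l1 l2) (loc_integrableB oU lg1 lg2)).
move=> phi tphi; have td := test_function_partial j tphi.
under eq_Rintegral do rewrite mulrBl.
under [in RHS]eq_Rintegral do rewrite mulrBl.
rewrite (RintegralB measurableT (summable_integrable (loc_integrable_testM oU l1 td))
  (summable_integrable (loc_integrable_testM oU l2 td))).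
rewrite (RintegralB measurableT (summable_integrable (loc_integrable_testM oU lg1 tphi))
  (summable_integrable (loc_integrable_testM oU lg2 tphi))).
rewrite (weak_partialE oU l1 w1 tphi) (weak_partialE oU l2 w2 tphi).
by rewrite opprB opprK addrC.
Qed.

Lemma test_functionMs U zeta psi : open U -> test_function U zeta -> smooth_on setT psi ->
  test_function U (fun x => psi x * zeta x).
Proof. by move=> oU tz sp; apply: test_functionM => //; exact: smooth_on_sub sp. Qed.

Lemma derive_testM zeta psi x j : smooth_on setT zeta -> smooth_on setT psi ->
  'D_(basis_vec j) (fun x => psi x * zeta x) x =
  psi x * 'D_(basis_vec j) zeta x + zeta x * 'D_(basis_vec j) psi x.
Proof.
move=> sz sp.
by case: (is_deriveM (smooth_on_is_derive j sp (I : setT x)) (smooth_on_is_derive j sz (I : setT x))).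
Qed.

(** [psi * zeta] is a test function in [U] whatever the support of [psi]; inserting it into the
    definition of the weak derivative and expanding gives the product rule for [f * zeta], valid on
    the whole space. *)
Lemma weak_partial_cutoff U j f g zeta psi : open U -> loc_integrable U f ->
  weak_partial U j f g -> test_function U zeta -> test_function setT psi ->
  Rintegral mu setT (fun x : X => (f x * zeta x) * 'D_(basis_vec j) psi x) =
  - Rintegral mu setT (fun x : X => (g x * zeta x + f x * 'D_(basis_vec j) zeta x) * psi x).
Proof.
move=> oU lf w tz tp; have [lg _] := w.
have [sz _ _] := tz; have [sp _ _] := tp.
have tpz := test_functionMs oU tz sp.
have tdz := test_function_partial j tz.
have tdp := test_function_partial j tp; have [sdp _ _] := tdp.
have := weak_partialE oU lf w tpz.
pose a x := f x * zeta x * 'D_(basis_vec j) psi x.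
pose b x := f x * 'D_(basis_vec j) zeta x * psi x.
pose c x := g x * zeta x * psi x.
have sa : summable a.
  have := loc_integrable_testM oU lf (test_functionMs oU tz sdp).
  by congr summable; apply/funext => x; rewrite /a; ring.
have sb : summable b.
  have := loc_integrable_testM oU lf (test_functionMs oU tdz sp).
  by congr summable; apply/funext => x; rewrite /b; ring.
have sc : summable c.
  have := loc_integrable_testM oU lg tpz.
  by congr summable; apply/funext => x; rewrite /c; ring.
rewrite (_ : (fun x : X => f x * 'D_(basis_vec j) (fun x => psi x * zeta x) x) =
  (fun x : X => a x + b x)); last first.
  by apply/funext => x; rewrite derive_testM// /a /b; ring.
rewrite (_ : (fun x : X => g x * (psi x * zeta x)) = c); last first.
  by apply/funext => x; rewrite /c; ring.
rewrite (RintegralD measurableT (summable_integrable sa) (summable_integrable sb)).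
move=> /eqP; rewrite eq_sym -subr_eq eq_sym => /eqP ->.
rewrite (_ : (fun x : X => (g x * zeta x + f x * 'D_(basis_vec j) zeta x) * psi x) =
  (fun x : X => c x + b x)); last first.
  by apply/funext => x; rewrite /c /b; ring.
rewrite (RintegralD measurableT (summable_integrable sc) (summable_integrable sb)).
by rewrite opprD.
Qed.

(** Differentiating the convolution differentiates the mollifier; the weak product rule, tested
    against the reflected mollifier y -> [mollifier k (x - y)], moves the derivative onto
    [f * zeta]. *)
Lemma mollify_is_derive U j f g zeta k x : open U -> loc_integrable U f ->
  weak_partial U j f g -> test_function U zeta ->
  is_derive x (basis_vec j) (mollify k (fun x => f x * zeta x))
    (mollify k (fun x => g x * zeta x + f x * 'D_(basis_vec j) zeta x) x).
Proof.
move=> oU lf w tz; have tm : test_function setT (mollifier k : Rn -> R) := mollifier_test k.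
have [sm _ _] := tm.
have := conv_is_derive x j tm (loc_integrable_testM oU lf tz).
congr (is_derive _ _ _ _); rewrite /mollify /conv.
have tr := test_function_reflect x tm.
have := weak_partial_cutoff oU lf w tz tr.
rewrite (_ : (fun y : X => f y * zeta y * 'D_(basis_vec j) (fun y => mollifier k (x - y)) y) =
  (fun y : X => - 1 * ('D_(basis_vec j) (mollifier k) (x - y) * (f y * zeta y)))); last first.
  apply/funext => y; have := derive_reflect 1 x y j sm.
  by under eq_fun do rewrite mul1r; case=> _ ->; ring.
rewrite (RintegralZl _ measurableT (summable_integrable (summable_conv x
  (test_function_partial j tm) (loc_integrable_testM oU lf tz)))).
rewrite mulN1r => /oppr_inj ->.
by apply: eq_Rintegral => y _; rewrite mulrC.
Qed.

Lemma smooth_loc_integrable U f : open U -> smooth_on U f -> loc_integrable U f.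
Proof.
move=> oU sf; have mf : measurable_fun (U : set X) (f : X -> R).
  by apply: continuous_measurable_leb => // x; exact: smooth_on_continuous.
split=> // K KU cK.
have mK := compact_measurable_leb cK.
have /compact_bounded[M [_ Mb]] : compact (f @` K).
  apply: continuous_compact => //; apply: continuous_in_subspaceT => x /set_mem/KU.
  exact: smooth_on_continuous.
suff : mu.-integrable (K : set X) (EFin \o (f : X -> R)) by case/integrableP.
apply: measurable_bounded_integrable => //.
- exact: compact_leb_lty.
- exact: measurable_funS (open_measurable_leb oU) KU mf.
exists M; split; first exact: num_real.
by move=> N MN x /= Kx; apply: Mb => //; exists x.
Qed.

(** Integration by parts: [f * phi] is a test function, so its partial derivative has integral
    zero. *)
Lemma smooth_weak_partial U j f : open U -> smooth_on U f ->
  weak_partial U j f ('D_(basis_vec j) f).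
Proof.
move=> oU sf; have lf := smooth_loc_integrable oU sf.
have lg := smooth_loc_integrable oU (smooth_on_partial j sf).
apply: weak_partialP => // phi tphi.
have td := test_function_partial j tphi.
have s1 := loc_integrable_testM oU lf td; have s2 := loc_integrable_testM oU lg tphi.
apply/eqP; rewrite -addr_eq0; apply/eqP.
rewrite -(RintegralD measurableT (summable_integrable s1) (summable_integrable s2)).
have tp := test_function_sub (@subsetT _ U) (test_functionM oU sf tphi).
rewrite -[RHS](integral_partial j tp); apply: eq_Rintegral => x _.
have [sphi _ _] := tphi.
have [Ux|nUx] := pselect (U x); last first.
  rewrite (test_function_eq0 td nUx) (test_function_eq0 tphi nUx) !mulr0 addr0.
  by rewrite (test_function_eq0 (test_function_partial j (test_functionM oU sf tphi)) nUx).
case: (is_deriveM (smooth_on_is_derive j sf Ux) (smooth_on_is_derive j sphi (I : setT x))) => _ ->.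
by congr (_ + _); rewrite [RHS]mulrC.
Qed.

End weak_derivatives.

(** * The entrywise norm of matrices *)

Section matrix_l1_norm.
Local Open Scope ring_scope.
Context {R : realType}.
Implicit Types (m k l : nat).

(** Equivalent to the Euclidean and operator norms with constants depending only on the dimensions,
    and visibly measurable, subadditive and submultiplicative. The modular estimates use it
    throughout; the constants are paid when passing from and to the norms of the theorem. *)
Definition nm1 m k (A : 'M[R]_(m, k)) : R := \sum_i \sum_j `|A i j|.

Lemma nm1_ge0 m k (A : 'M[R]_(m, k)) : 0 <= nm1 A.
Proof. by apply: sumr_ge0 => i _; apply: sumr_ge0. Qed.

Lemma nm1_entry m k (A : 'M[R]_(m, k)) i j : `|A i j| <= nm1 A.
Proof.
rewrite /nm1 (bigD1 i)//= (bigD1 j)//= -addrA lerDl addr_ge0 ?sumr_ge0// => i' _.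
exact: sumr_ge0.
Qed.

Lemma nm1D m k (A B : 'M[R]_(m, k)) : nm1 (A + B) <= nm1 A + nm1 B.
Proof.
rewrite -big_split/=; apply: ler_sum => i _; rewrite -big_split/=; apply: ler_sum => j _.
by rewrite mxE ler_normD.
Qed.

Lemma nm1Z m k (c : R) (A : 'M[R]_(m, k)) : nm1 (c *: A) = `|c| * nm1 A.
Proof.
rewrite /nm1 mulr_sumr; apply: eq_bigr => i _; rewrite mulr_sumr.
by apply: eq_bigr => j _; rewrite mxE normrM.
Qed.

Lemma nm1N m k (A : 'M[R]_(m, k)) : nm1 (- A) = nm1 A.
Proof. by rewrite -scaleN1r nm1Z normrN1 mul1r. Qed.

Lemma nm1_0 m k : nm1 (0 : 'M[R]_(m, k)) = 0.
Proof. by rewrite -(scale0r 0) nm1Z normr0 mul0r. Qed.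

Lemma nm1_mul m k l (A : 'M[R]_(m, k)) (B : 'M[R]_(k, l)) :
  nm1 (A *m B) <= nm1 A * nm1 B.
Proof.
rewrite /nm1 mulr_suml; apply: ler_sum => i _; rewrite mulr_suml.
under eq_bigr do rewrite mxE.
apply: (@le_trans _ _ (\sum_j \sum_h `|A i h| * `|B h j|)).
  apply: ler_sum => j _; rewrite (le_trans (ler_norm_sum _ _ _))//.
  by apply: ler_sum => h _; rewrite normrM.
rewrite exchange_big/=; apply: ler_sum => h _; rewrite -mulr_sumr ler_wpM2l//.
by rewrite [leRHS](bigD1 h)//= lerDl sumr_ge0// => h' _; apply: sumr_ge0.
Qed.

Lemma nm1_sum m k (I : Type) (r : seq I) (F : I -> 'M[R]_(m, k)) :
  nm1 (\sum_(i <- r) F i) <= \sum_(i <- r) nm1 (F i).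
Proof.
elim: r => [|i r IH]; first by rewrite !big_nil nm1_0.
by rewrite !big_cons (le_trans (nm1D _ _))// lerD2l.
Qed.

Lemma nm1_cols m k (A : 'M[R]_(m, k)) : nm1 A = \sum_j nm1 (col j A).
Proof.
rewrite /nm1 exchange_big/=; apply: eq_bigr => j _; apply: eq_bigr => i _.
by rewrite big_ord1 mxE.
Qed.

Lemma enorm_ge0 m (v : 'cV[R]_m) : 0 <= enorm v.
Proof. exact: sqrtr_ge0. Qed.

Lemma enorm_le_nm1 m (v : 'cV[R]_m) : enorm v <= nm1 v.
Proof.
rewrite -(ger0_norm (nm1_ge0 v)) -sqrtr_sqr ler_sqrt ?sqr_ge0//.
rewrite [leRHS]expr2 {1}/nm1 mulr_suml; apply: ler_sum => i _.
rewrite big_ord1 -real_normK ?num_real// expr2 ler_wpM2l//.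
exact: nm1_entry.
Qed.

Lemma coord_le_enorm m (v : 'cV[R]_m) i : `|v i 0| <= enorm v.
Proof.
rewrite -sqrtr_sqr ler_sqrt; first by rewrite (bigD1 i)//= lerDl sumr_ge0// => j _; exact: sqr_ge0.
by apply: sumr_ge0 => j _; exact: sqr_ge0.
Qed.

Lemma nm1_le_enorm m (v : 'cV[R]_m) : nm1 v <= m%:R * enorm v.
Proof.
rewrite /nm1 (le_trans (ler_sum _ (G := fun=> enorm v) _))//.
  by move=> i _; rewrite big_ord1 coord_le_enorm.
by rewrite sumr_const card_ord mulr_natl.
Qed.

Lemma enorm_mul_le m k (A : 'M[R]_(m, k)) (v : 'cV[R]_k) :
  enorm v <= 1 -> enorm (A *m v) <= nm1 A.
Proof.
move=> v1; rewrite (le_trans (enorm_le_nm1 _))//; apply: ler_sum => i _.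
rewrite big_ord1 mxE (le_trans (ler_norm_sum _ _ _))//; apply: ler_sum => j _.
by rewrite normrM ler_piMr// (le_trans (coord_le_enorm _ _)).
Qed.

Lemma enorm_delta m (j : 'I_m) : enorm (delta_mx j 0 : 'cV[R]_m) = 1.
Proof.
rewrite /enorm (bigD1 j)//= big1 => [|i ij]; last by rewrite mxE (negbTE ij) expr0n.
by rewrite mxE !eqxx expr1n addr0 sqrtr1.
Qed.

Lemma opnorm_le_nm1 m k (A : 'M[R]_(m, k)) : opnorm A <= nm1 A.
Proof.
apply: ge_sup; last by move=> _ [v v1 <-]; exact: enorm_mul_le.
exists (enorm (A *m 0)), 0 => //.
by rewrite /= /enorm big1 ?sqrtr0// => i _; rewrite mxE expr0n.
Qed.

Lemma enorm_le_opnorm m k (A : 'M[R]_(m, k)) (v : 'cV[R]_k) :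
  enorm v <= 1 -> enorm (A *m v) <= opnorm A.
Proof.
move=> v1; apply: ub_le_sup; last by exists v.
by exists (nm1 A) => _ [w w1 <-]; exact: enorm_mul_le.
Qed.

Lemma opnorm_ge0 m k (A : 'M[R]_(m, k)) : 0 <= opnorm A.
Proof.
apply: le_trans (enorm_le_opnorm A (v := 0) _); first exact: enorm_ge0.
by rewrite /enorm big1 ?sqrtr0// => i _; rewrite mxE expr0n.
Qed.

Lemma nm1_le_opnorm m k (A : 'M[R]_(m, k)) : nm1 A <= (m * k)%:R * opnorm A.
Proof.
rewrite /nm1 (le_trans (ler_sum _ (G := fun=> k%:R * opnorm A) _))//.
  move=> i _; rewrite (le_trans (ler_sum _ (G := fun=> opnorm A) _))//.
    move=> j _; have := coord_le_enorm (A *m delta_mx j 0) i.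
    rewrite -colE mxE => /le_trans; apply; rewrite colE.
    by apply: enorm_le_opnorm; rewrite enorm_delta.
  by rewrite sumr_const card_ord mulr_natl.
by rewrite sumr_const card_ord natrM -mulrA [leRHS]mulr_natl.
Qed.

End matrix_l1_norm.

(** * Modulars with bounded exponent *)

Section variable_exponent_modular.
Local Open Scope classical_set_scope.
Local Open Scope ring_scope.
Context d (T : measurableType d) (R : realType).
Variable mu : {measure set T -> \bar R}.
Implicit Types (P u v : T -> R) (D : set T).

Lemma measurable_fun_powR D u P : measurable D -> (forall x, D x -> P x != 0) ->
  measurable_fun D u -> measurable_fun D P -> measurable_fun D (fun x => u x `^ P x).
Proof.
move=> mD P0 mu_ mP.
(* The power as an exponential away from the zeros of [u]; at a zero it is 0, because the exponent
   does not vanish. *)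
apply: (eq_measurable_fun (fun x => \1_(~` [set 0]) (u x) * expR (P x * ln (u x)))).
  move=> x /set_mem Dx; rewrite /powR indicE.
  have [->|u0] := eqVneq (u x) 0.
    by rewrite memNset ?mul0r ?(negbTE (P0 x Dx))//= => /(_ erefl).
  by rewrite mem_set ?mul1r//=; apply/eqP.
apply: measurable_funM.
  by apply: measurableT_comp => //; apply: measurable_indic; exact: measurableC.
apply: measurableT_comp => //; apply: measurable_funM => //.
by apply: measurableT_comp => //; exact: measurable_ln.
Qed.

(** Meant for nonnegative [u]. The exponent is real-valued, so no essential supremum enters. *)
Definition rho P D u : \bar R := (\int[mu]_(x in D) (u x `^ P x)%:E)%E.

Lemma rho_ge0 P D u : (0 <= rho P D u)%E.
Proof. by apply: integral_ge0 => x _; rewrite lee_fin powR_ge0. Qed.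

Lemma le_rho P D1 D2 u v : D1 `<=` D2 -> (forall x, D1 x -> 0 <= P x) ->
  (forall x, D1 x -> 0 <= u x <= v x) -> (rho P D1 u <= rho P D2 v)%E.
Proof.
move=> D12 P0 uv; apply: lower_integral_le => // x Dx; rewrite lee_fin ?powR_ge0//.
have /andP[u0 uv'] := uv x Dx.
by apply: ge0_ler_powR; rewrite ?P0// nnegrE// (le_trans u0).
Qed.

Section bounded_exponent.
Variables (P : T -> R) (D : set T) (PM : R).
Hypotheses (mD : measurable D) (mP : measurable_fun D P)
  (P1 : forall x, D x -> 1 <= P x) (PPM : forall x, D x -> P x <= PM).

Let P0 x : D x -> 0 <= P x. Proof. by move=> /P1; apply: le_trans. Qed.
Let Pn0 x : D x -> P x != 0.
Proof. by move=> /P1 h; rewrite gt_eqF// (lt_le_trans _ h). Qed.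

Lemma measurable_powR_exponent u : measurable_fun D u ->
  measurable_fun D (fun x => u x `^ P x).
Proof. by move=> mu_; exact: measurable_fun_powR. Qed.

(** Together with [rhoZ_le1] the substitute for homogeneity: exponents between 1 and [PM] make a
    factor c >= 1 cost at most c^PM, and a factor c <= 1 gain at least c. *)
Lemma rhoZ_le u (c : R) : measurable_fun D u -> (forall x, D x -> 0 <= u x) -> 1 <= c ->
  (rho P D (fun x => c * u x)%R <= (c `^ PM)%:E * rho P D u)%E.
Proof.
move=> mu_ u0 c1; rewrite /rho -ge0_integralZl_EFin ?powR_ge0//; last 2 first.
- by move=> x _; rewrite lee_fin powR_ge0.
- by apply/measurable_EFinP; exact: measurable_powR_exponent.
apply: lower_integral_le => // x Dx; rewrite ?mule_ge0 ?lee_fin ?powR_ge0//.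
by rewrite powRM ?u0 ?(le_trans _ c1)// ler_wpM2r ?powR_ge0// ler_powR// PPM.
Qed.

Lemma rhoZ_le1 u (c : R) : measurable_fun D u -> (forall x, D x -> 0 <= u x) ->
  0 <= c <= 1 -> (rho P D (fun x => c * u x)%R <= c%:E * rho P D u)%E.
Proof.
move=> mu_ u0 /andP[c0 c1]; rewrite /rho -ge0_integralZl_EFin//; last 2 first.
- by move=> x _; rewrite lee_fin powR_ge0.
- by apply/measurable_EFinP; exact: measurable_powR_exponent.
apply: lower_integral_le => // x Dx; rewrite ?mule_ge0 ?lee_fin ?powR_ge0//.
move: c0; rewrite le_eqVlt => /predU1P[<-|c0].
  by rewrite !mul0r powR0// Pn0.
by apply: ge1r_powRZ; rewrite ?c0// ?u0// P1.
Qed.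

(** Pointwise, u + v is at most twice the larger of the two, which costs 2^PM. *)
Lemma rhoD_le u v : measurable_fun D u -> measurable_fun D v ->
  (forall x, D x -> 0 <= u x) -> (forall x, D x -> 0 <= v x) ->
  (rho P D (fun x => u x + v x)%R <= (2 `^ PM)%:E * (rho P D u + rho P D v))%E.
Proof.
move=> mu_ mv u0 v0; rewrite /rho -ge0_integralD//; last 4 first.
- by move=> x _; rewrite lee_fin powR_ge0.
- by apply/measurable_EFinP; exact: measurable_powR_exponent.
- by move=> x _; rewrite lee_fin powR_ge0.
- by apply/measurable_EFinP; exact: measurable_powR_exponent.
rewrite -ge0_integralZl_EFin ?powR_ge0//; last 2 first.
- by move=> x _; rewrite adde_ge0// lee_fin powR_ge0.
- by apply: emeasurable_funD; apply/measurable_EFinP; exact: measurable_powR_exponent.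
apply: lower_integral_le => // x Dx.
- by rewrite lee_fin powR_ge0.
- by rewrite -EFinD -EFinM lee_fin mulr_ge0 ?addr_ge0 ?powR_ge0.
rewrite -EFinD -EFinM lee_fin.
wlog uv : u v {mu_ mv} u0 v0 / u x <= v x.
  move=> h; have [uv|vu] := leP (u x) (v x); first exact: h.
  by rewrite addrC [X in _ * X]addrC; apply: h => //; exact: ltW.
apply: (@le_trans _ _ ((2 * v x) `^ P x)).
  apply: ge0_ler_powR; rewrite ?P0// ?nnegrE ?addr_ge0 ?mulr_ge0 ?u0 ?v0//.
  by rewrite mulr_natl mulr2n lerD2r.
rewrite powRM ?v0//; apply: ler_pM; rewrite ?powR_ge0//.
  by rewrite ler_powR ?PPM// ler1n.
by rewrite lerDr powR_ge0.
Qed.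

End bounded_exponent.

End variable_exponent_modular.

Section measurable_matrix_functions.
Local Open Scope classical_set_scope.
Local Open Scope ring_scope.
Context d (T : measurableType d) (R : realType).
Variable D : set T.
Implicit Types (m k l : nat).

Lemma measurable_inv (f : T -> R) : measurable_fun D f -> measurable_fun D (fun x => (f x)^-1).
Proof.
move=> mf; rewrite (_ : (fun x => _) = (fun x => f x * (f x ^+ 2) `^ (- 1))).
  apply: measurable_funM => //.
  by apply: (measurableT_comp (measurable_powR (- 1))); exact: measurable_funX.
apply/funext => x; rewrite powR_inv1 ?sqr_ge0//.
have [->|f0] := eqVneq (f x) 0; first by rewrite invr0 mul0r.
by rewrite expr2 invfM mulrA divff// mul1r.
Qed.

Definition measurable_mx m k (A : T -> 'M[R]_(m, k)) : Prop :=
  forall i j, measurable_fun D (fun x => A x i j).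

Lemma measurable_mx_cst m k (A : 'M[R]_(m, k)) : measurable_mx (fun=> A).
Proof. by move=> i j; exact: measurable_cst. Qed.

Lemma measurable_mxD m k (A B : T -> 'M[R]_(m, k)) :
  measurable_mx A -> measurable_mx B -> measurable_mx (fun x => A x + B x).
Proof.
move=> mA mB i j; under eq_fun do rewrite mxE.
exact: measurable_funD (mA i j) (mB i j).
Qed.

Lemma measurable_mxN m k (A : T -> 'M[R]_(m, k)) :
  measurable_mx A -> measurable_mx (fun x => - A x).
Proof.
move=> mA i j; under eq_fun do rewrite mxE.
exact: measurable_funN (mA i j).
Qed.

Lemma measurable_mxZ m k (f : T -> R) (A : T -> 'M[R]_(m, k)) :
  measurable_fun D f -> measurable_mx A -> measurable_mx (fun x => f x *: A x).
Proof.
move=> mf mA i j; under eq_fun do rewrite mxE.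
exact: measurable_funM mf (mA i j).
Qed.

Lemma measurable_mxM m k l (A : T -> 'M[R]_(m, k)) (B : T -> 'M[R]_(k, l)) :
  measurable_mx A -> measurable_mx B -> measurable_mx (fun x => A x *m B x).
Proof.
move=> mA mB i j; under eq_fun do rewrite mxE.
by apply: measurable_sum => h; exact: measurable_funM (mA i h) (mB h j).
Qed.

Lemma measurable_nm1 m k (A : T -> 'M[R]_(m, k)) :
  measurable_mx A -> measurable_fun D (fun x => nm1 (A x)).
Proof.
move=> mA; apply: measurable_sum => i; apply: measurable_sum => j.
exact: measurableT_comp (mA i j).
Qed.

Lemma measurable_det m (A : T -> 'M[R]_m) :
  measurable_mx A -> measurable_fun D (fun x => \det (A x)).
Proof.
move=> mA; apply: measurable_sum => s; apply: measurable_funM; first exact: measurable_cst.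
by apply: measurable_prod => i _; exact: mA.
Qed.

Lemma measurable_mx_adj m (A : T -> 'M[R]_m) :
  measurable_mx A -> measurable_mx (fun x => \adj (A x)).
Proof.
move=> mA i j; under eq_fun do rewrite mxE.
apply: measurable_funM; first exact: measurable_cst.
by apply: measurable_det => k l; under eq_fun do rewrite !mxE; exact: mA.
Qed.

End measurable_matrix_functions.

(** * Hoelder's inequality for variable exponents *)

Section young_inequality.
Local Open Scope classical_set_scope.
Local Open Scope ring_scope.
Local Open Scope ereal_scope.
Context d (T : measurableType d) (R : realType).
Variable mu : {measure set T -> \bar R}.

(** Where P > 1, Young's inequality gives ab <= a^(P/(P-1)) + b^P. Where P = 1 the conjugate
    exponent is infinite, and a <= 1 almost everywhere gives ab <= b. The two normalizations then
    bound the integral by 1 + 1. *)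
Lemma integral_young_le2 (D : set T) (P a b : T -> R) :
  measurable D -> measurable_fun D P -> measurable_fun D a -> measurable_fun D b ->
  (forall x, D x -> 1 <= P x)%R -> (forall x, D x -> 0 <= a x)%R ->
  (forall x, D x -> 0 <= b x)%R ->
  {ae mu, forall x, D x -> P x = 1%R -> (a x <= 1)%R} ->
  rho mu (fun x => P x / (P x - 1))%R (D `&` [set x | 1 < P x]%R) a <= 1 ->
  rho mu P D b <= 1 ->
  \int[mu]_(x in D) (a x * b x)%:E <= 2%:E.
Proof.
move=> mD mP ma mb P1 a0 b0 a1 ra rb.
pose S := D `&` [set x | 1 < P x]%R; pose S' := D `&` [set x | P x = 1]%R.
have mS : measurable S.
  have := mP mD _ (measurable_itv `]1%R, +oo[); congr measurable.
  by apply/seteqP; split=> x [Dx]; rewrite /= in_itv/= andbT.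
have mS' : measurable S' by exact: mP mD _ (measurable_set1 1%R).
have DE : D = S `|` S'.
  apply/seteqP; split=> [x Dx|x [[]//|[]//]].
  by have := P1 x Dx; rewrite le_eqVlt => /predU1P[h|h]; [right|left].
have SD : S `<=` D by move=> x [].
have S'D : S' `<=` D by move=> x [].
have dS : [disjoint S & S'].
  by apply/disj_setPS => x [[_ /= h] [_ /= h']]; move: h; rewrite h' ltxx.
have mab : measurable_fun D (fun x => (a x * b x)%:E).
  by apply/measurable_EFinP; exact: measurable_funM.
have mbP : measurable_fun D (fun x => (b x `^ P x)%:E).
  apply/measurable_EFinP; apply: measurable_fun_powR => // x /P1 h.
  by rewrite gt_eqF// (lt_le_trans _ h).
have maq : measurable_fun S (fun x => (a x `^ (P x / (P x - 1)))%:E).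
  apply/measurable_EFinP; apply: measurable_fun_powR => //.
  - move=> x [Dx /= h]; rewrite mulf_neq0// ?invr_eq0 ?subr_eq0 gt_eqF//.
    by rewrite (lt_trans _ h).
  - exact: measurable_funS ma.
  - apply: measurable_funM; first exact: measurable_funS mP.
    apply: measurable_inv; apply: measurable_funB; last exact: measurable_cst.
    exact: measurable_funS mP.
have e2 : 2%:E = 1 + 1 :> \bar R by rewrite -EFinD.
rewrite e2; apply: le_trans (leeD ra rb).
rewrite /rho -/S {2}DE (ge0_integral_setU mu mS mS' _ _ dS); last 2 first.
- by rewrite -DE.
- by move=> x _; rewrite lee_fin powR_ge0.
rewrite addeA {1}DE (ge0_integral_setU mu mS mS' _ _ dS); last 2 first.
- by rewrite -DE.
- by rewrite -DE => x Dx; rewrite lee_fin mulr_ge0 ?a0 ?b0.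
apply: leeD.
  have n1 x : S x -> 0 <= (a x `^ (P x / (P x - 1)))%:E by rewrite lee_fin powR_ge0.
  have n2 x : S x -> 0 <= (b x `^ P x)%:E by rewrite lee_fin powR_ge0.
  rewrite -ge0_integralD//; last exact: measurable_funS mbP.
  apply: ge0_le_integral => //.
  - by move=> x [Dx _]; rewrite lee_fin mulr_ge0 ?a0 ?b0.
  - exact: measurable_funS mab.
  - by apply: emeasurable_funD => //; exact: measurable_funS mbP.
  move=> x [Dx /= h]; rewrite -EFinD lee_fin.
  have Pp : (0 < P x)%R by rewrite (lt_trans _ h).
  have P1p : (0 < P x - 1)%R by rewrite subr_gt0.
  have qp : (0 < P x / (P x - 1))%R by rewrite divr_gt0.
  have := conjugate_powR (a0 x Dx) (b0 x Dx) qp Pp.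
  rewrite invf_div.
  have -> : ((P x - 1) / P x + (P x)^-1 = 1)%R by field; rewrite gt_eqF.
  move=> /(_ erefl)/le_trans; apply; apply: lerD.
    by rewrite ler_piMr ?powR_ge0// ler_pdivrMr// mul1r gerBl.
  by rewrite ler_piMr ?powR_ge0// invf_le1// ltW.
apply: ae_ge0_le_integral => //.
- by move=> x [Dx _]; rewrite lee_fin mulr_ge0 ?a0 ?b0.
- exact: measurable_funS mab.
- by move=> x _; rewrite lee_fin powR_ge0.
- exact: measurable_funS mbP.
apply: filterS a1 => x ax [Dx /= h]; rewrite lee_fin h powRr1 ?b0//.
by rewrite ler_piMl ?b0// ax.
Qed.

End young_inequality.

(** * Averages over cubes and the A_p condition *)

Section cubes.
Local Open Scope classical_set_scope.
Local Open Scope ring_scope.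
Context {R : realType} {n : nat}.
Local Notation Rn := 'cV[R]_n.+1.
Local Notation X := (lebT R n).
Local Notation mu := (leb R n).
Implicit Types (a : Rn) (l : R).

Lemma measurable_cube a l : measurable (cube a l : set X).
Proof.
rewrite (_ : cube a l = \bigcap_(i in [set: 'I_n.+1])
   [set x : X | a i 0 <= x i 0 <= a i 0 + l]); last first.
  by apply/seteqP; split => [x h i _ //|x h i]; exact: h.
apply: fin_bigcap_measurable => [|i _]; first exact: finite_finset.
have := measurable_fun_coord i measurableT (measurable_itv `[a i 0, a i 0 + l]).
by rewrite setTI; congr measurable; apply/seteqP; split => x /=; rewrite in_itv.
Qed.

Lemma leb_cube_ge a l : 0 <= l -> ((l ^+ n.+1)%:E <= mu (cube a l))%E.
Proof.
move=> l0; have -> : (l ^+ n.+1)%:E = mu (box (a, a + const_mx l)).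
  rewrite leb_box /box_volume (eq_bigr (fun=> l)) => [|i _]; first by rewrite prodr_const card_ord.
  by rewrite /= !mxE addrAC subrr add0r max_r.
by apply: le_leb_outer => x bx i; have := bx i; rewrite /= !mxE => /andP[/ltW -> ->].
Qed.

(** The half-open box with the same corners misses some faces of the closed cube; doubling the sides
    is a crude remedy that only affects constants. *)
Lemma leb_cube_le a l : 0 < l -> (mu (cube a l) <= ((2 * l) ^+ n.+1)%:E)%E.
Proof.
move=> l0; have -> : ((2 * l) ^+ n.+1)%:E = mu (box (a - const_mx l, a + const_mx l)).
  rewrite leb_box /box_volume (eq_bigr (fun=> 2 * l)) => [|i _]; first by rewrite prodr_const card_ord.
  by rewrite /= !mxE max_r; lra.
apply: le_leb_outer => x bx i; have := bx i; rewrite /= !mxE => /andP[h ->].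
by rewrite andbT (lt_le_trans _ h)// ltrBlDr ltrDl.
Qed.

End cubes.

Section almost_everywhere_leb.
Local Open Scope classical_set_scope.
Context {R : realType} {n : nat}.
Local Notation X := (lebT R n).
Local Notation mu := (leb R n).
Implicit Types A B : X -> Prop.

Lemma leb_aeS A B : (forall x, A x -> B x) ->
  {ae mu, forall x, A x} -> {ae mu, forall x, B x}.
Proof. by move=> AB; apply: (@filterS _ _ (ae_filter_ringOfSetsType mu)). Qed.

Lemma leb_aeI A B : {ae mu, forall x, A x} -> {ae mu, forall x, B x} ->
  {ae mu, forall x, A x /\ B x}.
Proof. exact: (@filterI _ _ (ae_filter_ringOfSetsType mu)). Qed.

End almost_everywhere_leb.

Section averaging.
Local Open Scope classical_set_scope.
Local Open Scope ring_scope.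
Context {R : realType} {n : nat}.
Local Notation Rn := 'cV[R]_n.+1.
Local Notation X := (lebT R n).
Local Notation mu := (leb R n).

(* What the A_p condition is used for: on a cube Q, the function
   x |-> |Q|^-1 int_Q |W(x) v(y)| dy has bounded modular as soon as |W v| has. *)
Definition averaging (d : nat) (P : Rn -> R) (W : Rn -> 'M[R]_d) (Omega : set Rn) : Prop :=
  exists2 C : R, 0 < C & forall (a : Rn) (l N : R) (v : Rn -> 'cV[R]_d) (h : Rn -> R),
    0 < l -> cube a l `<=` Omega -> 0 < N ->
    measurable_mx (cube a l : set X) (v : X -> 'cV[R]_d) ->
    (forall x, cube a l x -> 0 <= h x) ->
    (forall x, cube a l x ->
      ((h x)%:E <= \int[mu]_(y in cube a l : set X) (nm1 (W x *m v y))%:E)%E) ->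
    (rho mu P (cube a l : set X) (fun y : X => N^-1 * nm1 (W y *m v y))%R <= 1)%E ->
    (rho mu P (cube a l : set X) (fun x : X => (C * N * l ^+ n.+1)^-1 * h x)%R <= 1)%E.

Lemma hoelder_conjugate_gt1 (r : R) : 1 < r -> hoelder_conjugate r%:E = (r / (r - 1))%:E.
Proof.
move=> r1; rewrite /hoelder_conjugate/= eqe gt_eqF ?(lt_trans _ r1)//.
by rewrite -EFinB inver subr_eq0 gt_eqF.
Qed.

Lemma Lp_norm_ge0 (p : Rn -> \bar R) (Omega : set Rn) f : (0 <= Lp_norm p Omega f)%E.
Proof. by apply: le_ereal_inf_tmp => _ [l [l0 _] <-]; rewrite lee_fin ltW. Qed.

Lemma Linfty_norm_ge0 (Omega : set Rn) f : (0 <= Linfty_norm Omega f)%E.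
Proof. by apply: le_ereal_inf_tmp => y []. Qed.

Lemma Lp_norm_lt (p : Rn -> \bar R) (Omega : set Rn) f (t : R) :
  (Lp_norm p Omega f < t%:E)%E ->
  exists l, [/\ 0 < l, l < t & (modular p Omega (fun x => l^-1%:E * f x) <= 1)%E].
Proof. by move=> /ereal_inf_lt[_ [l [l0 lm] <-]]; rewrite lte_fin => lt; exists l. Qed.

Section matrix_Ap.
Variables (d : nat) (p : Rn -> \bar R) (W : Rn -> 'M[R]_d) (Omega Omega' : set Rn).
Hypotheses (oOmega' : open Omega') (sub : Omega `<=` Omega') (ep : exponent p Omega')
  (mW : forall i j, measurable_fun (Omega' : set X) (fun x : X => W x i j))
  (uW : \forall x \ae mu, Omega' x -> W x \in unitmx)
  (pfin : forall x, Omega x -> p x = (fine (p x))%:E).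
Let P x := fine (p x).
(** The inverse of the weight as a rational function of its entries, hence measurable. Where [W x]
    is singular it is 0, since 0^-1 = 0, unlike [invmx]. *)
Let V x := (\det (W x))^-1 *: \adj (W x).
(** The successor keeps [dd] positive even for d = 0. *)
Let dd : R := (d * d).+1%:R.
Let H x y := opnorm (W x *m invmx (W y)).

Let P1 x : Omega x -> 1 <= P x.
Proof. by move=> Ox; rewrite -lee_fin -pfin//; apply: ep.2; exact: sub. Qed.

Let nm1V x y : nm1 (W x *m V y) <= dd * H x y.
Proof.
have [uy|nuy] := boolP (W y \in unitmx).
  have -> : V y = invmx (W y) by rewrite /invmx uy.
  apply: le_trans (nm1_le_opnorm _) _.
  by rewrite ler_wpM2r ?opnorm_ge0// ler_nat leqnSn.
have -> : V y = 0.
  by rewrite /V; move: nuy; rewrite unitmxE unitfE negbK => /eqP ->; rewrite invr0 scale0r.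
by rewrite mulmx0 nm1_0 mulr_ge0 ?opnorm_ge0.
Qed.

(** Hoelder's inequality in y for fixed [x], with some [s < t] admissible in the infimum that
    defines the norm. [H] enters only through monotonicity of lower integrals, hence without
    measurability; Young's inequality is applied to the measurable function [al] below it. *)
Lemma integral_le_conjugate_norm (a : Rn) (l N t : R) (v : Rn -> 'cV[R]_d) x :
  cube a l `<=` Omega -> 0 < N ->
  measurable_mx (cube a l : set X) (v : X -> 'cV[R]_d) ->
  (rho mu P (cube a l : set X) (fun y : X => N^-1 * nm1 (W y *m v y))%R <= 1)%E ->
  (Lp_norm (fun y => hoelder_conjugate (p y)) Omega' (fun y => (H x y * \1_(cube a l) y)%:E) < t%:E)%E ->
  (\int[mu]_(y in cube a l : set X) (nm1 (W x *m v y))%:E <= (4 * dd * N * t)%:E)%E.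
Proof.
set Q := cube a l => QO N0 mv rv.
have mQ : measurable (Q : set X) by exact: measurable_cube.
have QO' : Q `<=` Omega' by exact: subset_trans sub.
have mO' := open_measurable_leb oOmega'.
move=> /Lp_norm_lt[s [s0 st]]; rewrite /modular.
set Oo := [set y | Omega' y /\ hoelder_conjugate (p y) = +oo%E] => ms.
have ms1 := le_trans (leeDl _ (Linfty_norm_ge0 Oo _)) ms.
have ms2 : (Linfty_norm Oo (fun y => s^-1%:E * (H x y * \1_Q y)%:E) < 2%:E)%E.
  apply: (@le_lt_trans _ _ 1%E); last by rewrite lte_fin ltr1n.
  apply: le_trans ms; rewrite leeDr//; apply: integral_ge0 => y _; exact: poweR_ge0.
have mWQ : measurable_mx (Q : set X) (W : X -> 'M[R]_d).
  by move=> i j; exact: measurable_funS mO' QO' (mW i j).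
have mV : measurable_mx (Q : set X) (V : X -> 'M[R]_d).
  apply: measurable_mxZ; last exact: measurable_mx_adj.
  by apply: measurable_inv; exact: measurable_det.
have mP : measurable_fun (Q : set X) (P : X -> R).
  apply: (measurableT_comp (fine_measurable measurableT)).
  exact: measurable_funS mO' QO' ep.1.
(* The 2 compensates for the essential bound extracted from [ms2], known only to be below 2; with
   the factor 2 of Young's inequality it makes the 4 of the conclusion. *)
pose al y := (2 * dd * s)^-1 * nm1 (W x *m V y).
pose be y := N^-1 * nm1 (W y *m v y).
have dd0 : 0 < dd by rewrite ltr0n.
have al0 y : 0 <= al y by rewrite mulr_ge0 ?nm1_ge0// invr_ge0 !mulr_ge0// ltW.
have be0 y : 0 <= be y by rewrite mulr_ge0 ?nm1_ge0// invr_ge0 ltW.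
have mal : measurable_fun (Q : set X) (al : X -> R).
  apply: measurable_funM; first exact: measurable_cst.
  by apply: measurable_nm1; apply: measurable_mxM mV; exact: measurable_mx_cst.
have mbe : measurable_fun (Q : set X) (be : X -> R).
  apply: measurable_funM; first exact: measurable_cst.
  by apply: measurable_nm1; exact: measurable_mxM mWQ mv.
have alH y : al y <= 2^-1 * (s^-1 * H x y).
  have -> : al y = 2^-1 * (s^-1 * (dd^-1 * nm1 (W x *m V y))).
    by rewrite /al !invfM; ring.
  rewrite ler_pM2l ?invr_gt0// ler_pM2l ?invr_gt0// ler_pdivrMl//; exact: nm1V.
have H0 y : 0 <= s^-1 * H x y by rewrite mulr_ge0 ?opnorm_ge0// invr_ge0 ltW.
have alH' y : al y <= s^-1 * H x y.
  apply: le_trans (alH y) _; rewrite ler_piMl//.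
  by rewrite invf_le1// ler1n.
have young : (\int[mu]_(y in Q : set X) (al y * be y)%:E <= 2%:E)%E.
  apply: (@integral_young_le2 _ X R mu Q P al be mQ mP mal mbe).
  - by move=> y /QO; exact: P1.
  - by move=> y _.
  - by move=> y _.
  - have [M [M0 Mae] M2] := ereal_inf_lt ms2.
    apply: leb_aeS Mae => y Mae Qy Py1.
    have Oy : Oo y.
      split; first exact: QO'.
      by rewrite (pfin (QO _ Qy)) -/(P y) Py1 hoelder_conjugate1.
    have := le_lt_trans (Mae Oy) M2; rewrite indicE mem_set// mulr1 -EFinM abse_EFin.
    rewrite ger0_norm// lte_fin => h; apply: le_trans (alH y) _.
    by rewrite ler_pdivrMl// mulr1 ltW.
  - apply: le_trans ms1; apply: lower_integral_le.
    + move=> y [Qy /= Py]; split; first exact: QO'.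
      by move=> [_]; rewrite (pfin (QO _ Qy)) hoelder_conjugate_gt1.
    + by move=> y _; rewrite lee_fin powR_ge0.
    + by move=> y _; exact: poweR_ge0.
    move=> y [Qy /= Py] /=; rewrite indicE mem_set// mulr1 ger0_norm// lee_fin.
    rewrite (pfin (QO _ Qy)) hoelder_conjugate_gt1//= -/(P y).
    apply: ge0_ler_powR; rewrite ?nnegrE//.
    by rewrite divr_ge0 ?subr_ge0 ?(le_trans _ (ltW Py))// ltW.
  - exact: rv.
have c0 : 0 <= 2 * dd * s * N by rewrite !mulr_ge0// ltW.
(* Inserts V(y) W(y) = 1 between W(x) and v(y), which is legitimate for almost every y. *)
apply: (@le_trans _ _ (\int[mu]_(y in Q : set X) ((2 * dd * s * N)%:E * (al y * be y)%:E))%E).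
  apply: (@ae_ge0_le_integral _ X R mu Q mQ).
  - by move=> y _; rewrite lee_fin nm1_ge0.
  - apply/measurable_EFinP; apply: measurable_nm1.
    by apply: measurable_mxM mv; exact: measurable_mx_cst.
  - by move=> y _; rewrite -EFinM lee_fin (mulr_ge0 c0)// mulr_ge0.
  - apply: measurable_funeM; apply/measurable_EFinP; exact: measurable_funM.
  apply: leb_aeS uW => y uy Qy; rewrite -EFinM lee_fin.
  have -> : 2 * dd * s * N * (al y * be y) = nm1 (W x *m V y) * nm1 (W y *m v y).
    by rewrite /al /be; field; rewrite !gt_eqF//.
  have Uy := uy (QO' _ Qy).
  have -> : V y = invmx (W y) by rewrite /invmx Uy.
  apply: le_trans (nm1_mul _ _); rewrite mulmxA -(mulmxA (W x)) mulVmx// mulmx1.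
  by [].
rewrite (@ge0_integralZl_EFin _ X R mu Q mQ); last 3 first.
- by move=> y _; rewrite lee_fin mulr_ge0.
- by apply/measurable_EFinP; exact: measurable_funM.
- exact: c0.
apply: le_trans (lee_wpmul2l _ young) _; first by rewrite lee_fin.
rewrite -EFinM lee_fin.
have -> : 2 * dd * s * N * 2 = 4 * dd * N * s by ring.
by rewrite ler_pM2l ?mulr_gt0// ltW.
Qed.

(** By Hoelder's inequality in y, the inner norm [F] dominates [h] up to the factor [4 * dd * N];
    the outer norm of [F] over the cube is at most the A_p constant times the measure of the
    cube. *)
Lemma averaging_of_Ap : (Ap_const p W Omega' < +oo)%E -> averaging P W Omega.
Proof.
move=> Aoo.
have [K K0 AK] : exists2 K : R, 0 <= K & (Ap_const p W Omega' <= K%:E)%E.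
  case: (Ap_const p W Omega') Aoo => [r| |]// _; last by exists 0 => //; rewrite leNye.
  by exists `|r| => //; rewrite lee_fin ler_norm.
have dd0 : 0 < dd by rewrite ltr0n.
(* [4 * dd] from Hoelder's inequality, [K + 1] to have a strict bound for the outer norm,
   [2 ^+ n.+1] from the upper bound for the measure of a cube. *)
pose C := 4 * dd * ((K + 1) * 2 ^+ n.+1).
exists C; first by rewrite !mulr_gt0// ?exprn_gt0// ltr_wpDl.
move=> a l N v h l0; set Q := cube a l => QO N0 mv h0 hv rv.
have QO' : Q `<=` Omega' by exact: subset_trans sub.
pose F x := Lp_norm (fun y => hoelder_conjugate (p y)) Omega' (fun y => (H x y * \1_Q y)%:E).
pose m := fine (mu (Q : set X)).
have mE : mu (Q : set X) = m%:E.
  rewrite fineK// ge0_fin_numE//; apply: le_lt_trans (leb_cube_le a l0) _; exact: ltry.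
have m0 : 0 < m.
  by rewrite -lte_fin -mE (lt_le_trans _ (leb_cube_ge a (ltW l0)))// lte_fin exprn_gt0.
have LF : (Lp_norm p Omega' (fun x => F x * (\1_Q x)%:E) < ((K + 1) * (2 * l) ^+ n.+1)%:E)%E.
  have : ((mu (Q : set X))^-1 * Lp_norm p Omega' (fun x => F x * (\1_Q x)%:E) <= K%:E)%E.
    by apply: le_trans AK; apply: ereal_sup_ubound; exists a, l.
  rewrite mE inver gt_eqF// lee_pdivrMl// => /le_lt_trans; apply.
  rewrite -EFinM lte_fin mulrC.
  have ml : m <= (2 * l) ^+ n.+1 by rewrite -lee_fin -mE leb_cube_le.
  apply: (@le_lt_trans _ _ (K * (2 * l) ^+ n.+1)); first by rewrite ler_wpM2l.
  by rewrite ltr_pM2r ?ltrDl// exprn_gt0// mulr_gt0.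
have [l1 [l10 l1l]] := Lp_norm_lt LF; rewrite /modular => mF.
have {}mF := le_trans (leeDl _ (Linfty_norm_ge0 _ _)) mF.
(* The estimate is known for every t above [F x], and passes to the limit. *)
have hF x (f : R) : Q x -> F x = f%:E -> h x <= 4 * dd * N * f.
  move=> Qx Ff; rewrite leNgt; apply/negP => fh.
  have c0 : 0 < 4 * dd * N by rewrite !mulr_gt0.
  have ft : f < h x / (4 * dd * N) by rewrite ltr_pdivlMr// mulrC.
  have [t ft1 ft2] : exists2 t, f < t & t < h x / (4 * dd * N).
    by exists ((f + h x / (4 * dd * N)) / 2); rewrite ?midf_lt.
  have Ft : (F x < t%:E)%E by rewrite Ff lte_fin.
  have := le_trans (hv x Qx) (integral_le_conjugate_norm QO N0 mv rv Ft).
  by rewrite lee_fin leNgt => /negP; apply; rewrite mulrC -ltr_pdivlMr.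
apply: le_trans mF; apply: lower_integral_le.
- move=> x Qx; split; first exact: QO'.
  by move=> [_]; rewrite (pfin (QO _ Qx)).
- by move=> x _; rewrite lee_fin powR_ge0.
- by move=> x _; exact: poweR_ge0.
move=> x Qx; rewrite indicE mem_set// mule1 -/(P x).
have Px : 0 < P x by rewrite (lt_le_trans _ (P1 (QO _ Qx))).
have F0 : (0 <= F x)%E by exact: Lp_norm_ge0.
(* An infinite inner norm makes the right-hand side infinite. *)
case Fx : (F x) F0 => [f| |]// F0; last first.
  have -> : (`|l1^-1%:E * +oo| = +oo :> \bar R)%E by rewrite gt0_muley ?lte_fin ?invr_gt0.
  by rewrite poweRyr ?gt_eqF// leey.
have f0 : 0 <= f by rewrite -lee_fin.
rewrite -EFinM abse_EFin poweR_EFin lee_fin ger0_norm; last first.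
  by rewrite mulr_ge0// invr_ge0 ltW.
have Cl : 0 < C * N * l ^+ n.+1.
  by rewrite !mulr_gt0// ?exprn_gt0// ltr_wpDl.
apply: ge0_ler_powR; rewrite ?nnegrE ?(ltW Px)//.
- by rewrite mulr_ge0 ?h0// invr_ge0 ltW.
- by rewrite mulr_ge0// invr_ge0 ltW.
apply: (@le_trans _ _ ((C * N * l ^+ n.+1)^-1 * (4 * dd * N * f))).
  by rewrite ler_pM2l ?invr_gt0// hF.
rewrite ler_pdivrMl// mulrCA ler_pdivlMl// mulrC.
have -> : C * N * l ^+ n.+1 * f = 4 * dd * N * f * ((K + 1) * (2 * l) ^+ n.+1).
  by rewrite /C exprMn; ring.
rewrite ler_wpM2l//; last exact: ltW.
by rewrite mulr_ge0// ltW// !mulr_gt0.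
Qed.

End matrix_Ap.

End averaging.

(** * Finite covers and grids of cubes *)

Section finite_covers.
Local Open Scope classical_set_scope.
Local Open Scope ring_scope.
Local Open Scope ereal_scope.
Context d (T : measurableType d) (R : realType).
Variable mu : {measure set T -> \bar R}.

(** The multiplicity function on the right is at least 1 where the family covers, and at most [c]
    for overlap [c]; the next two lemmas insert these bounds. *)
Lemma sum_integral_cover (I : finType) (J : pred I) (D : set T) (E : I -> set T)
    (f : T -> \bar R) : measurable D -> (forall i, measurable (E i)) ->
  (forall i, J i -> E i `<=` D) -> (forall x, D x -> 0 <= f x) -> measurable_fun D f ->
  \sum_(i | J i) \int[mu]_(x in E i) f x =
  \int[mu]_(x in D) ((\sum_(i | J i) \1_(E i) x)%:E * f x).
Proof.
move=> mD mE ED f0 mf.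
transitivity (\int[mu]_(x in D) \sum_(i <- enum J) ((\1_(E i) x)%:E * f x)).
  rewrite ge0_integral_sum//; last 2 first.
  - move=> i; apply: emeasurable_funM => //; apply/measurable_EFinP.
    exact: measurable_indic.
  - by move=> i x Dx; rewrite mule_ge0 ?f0// lee_fin.
  rewrite big_enum/=; apply: eq_bigr => i Ji.
  have DE : D `&` E i = E i by apply: setIidr; exact: ED.
  rewrite -{1}DE.
  rewrite integral_mkcondr; apply: eq_integral => x /set_mem Dx.
  by rewrite /patch indicE; case: ifPn => _; rewrite ?mul1e ?mul0e.
apply: eq_integral => x /set_mem Dx; rewrite big_enum/= -sumEFin ge0_sume_distrl//.
Qed.

Lemma integral_le_cover (I : finType) (J : pred I) (D : set T) (E : I -> set T)
    (f : T -> \bar R) : measurable D -> (forall i, measurable (E i)) ->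
  (forall i, J i -> E i `<=` D) -> (forall x, D x -> 0 <= f x) -> measurable_fun D f ->
  (forall x, D x -> f x = 0 \/ exists2 i, J i & E i x) ->
  \int[mu]_(x in D) f x <= \sum_(i | J i) \int[mu]_(x in E i) f x.
Proof.
move=> mD mE ED f0 mf cov; rewrite (sum_integral_cover mD mE ED f0 mf).
apply: lower_integral_le => // [x Dx|x Dx].
  by rewrite mule_ge0 ?f0// lee_fin sumr_ge0.
have [->|[i Ji Ei]] := cov x Dx; first by rewrite mule0.
rewrite -{1}[f x]mul1e; apply: lee_wpmul2r; first exact: f0.
by rewrite lee_fin (bigD1 i)//= indicE mem_set// lerDl sumr_ge0.
Qed.

Lemma sum_integral_le_overlap (I : finType) (J : pred I) (D : set T) (E : I -> set T)
    (f : T -> \bar R) (c : R) : measurable D -> (forall i, measurable (E i)) ->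
  (forall i, J i -> E i `<=` D) -> (forall x, D x -> 0 <= f x) -> measurable_fun D f ->
  (forall x, D x -> \sum_(i | J i) \1_(E i) x <= c)%R -> (0 <= c)%R ->
  \sum_(i | J i) \int[mu]_(x in E i) f x <= c%:E * \int[mu]_(x in D) f x.
Proof.
move=> mD mE ED f0 mf ov c0; rewrite (sum_integral_cover mD mE ED f0 mf).
rewrite -ge0_integralZl_EFin//; apply: lower_integral_le => // x Dx.
- by rewrite mule_ge0 ?f0// lee_fin sumr_ge0.
- by rewrite mule_ge0 ?f0.
- by apply: lee_wpmul2r; [exact: f0|rewrite lee_fin ov].
Qed.

Lemma rho_sum_lty (I : Type) (r : seq I) (P : T -> R) (D : set T) (PM : R) (u : I -> T -> R) :
  measurable D -> measurable_fun D P -> (forall x, D x -> 1 <= P x)%R ->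
  (forall x, D x -> P x <= PM)%R -> (forall i, measurable_fun D (u i)) ->
  (forall i x, D x -> 0 <= u i x)%R -> (forall i, rho mu P D (u i) < +oo) ->
  rho mu P D (fun x => \sum_(i <- r) u i x)%R < +oo.
Proof.
move=> mD mP P1 PPM mu_ u0 uoo; elim: r => [|i r IH].
  under eq_fun do rewrite big_nil.
  rewrite /rho integral0_eq ?ltry// => x Dx; rewrite powR0// gt_eqF//.
  by rewrite (lt_le_trans _ (P1 x Dx)).
under eq_fun do rewrite big_cons.
apply: le_lt_trans (rhoD_le mu mD mP P1 PPM (mu_ i) _ _ _) _.
- exact: measurable_sum.
- exact: u0.
- by move=> x Dx; apply: sumr_ge0 => j _; exact: u0.
apply: lte_mul_pinfty; [by rewrite lee_fin powR_ge0|by []|exact: lte_add_pinfty (uoo i) IH].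
Qed.

End finite_covers.

Section grid.
Local Open Scope classical_set_scope.
Local Open Scope ring_scope.
Context {R : realType} {n : nat}.
Local Notation Rn := 'cV[R]_n.+1.
Local Notation X := (lebT R n).
Local Notation mu := (leb R n).

Section cells.
Variables (B delta : R) (M : nat).
Hypothesis delta0 : 0 < delta.
Let index := {ffun 'I_n.+1 -> 'I_M}.
Implicit Types (z : index).

Definition corner z : Rn := \col_i (- B + (z i)%:R * delta).

Definition cell z : set Rn := box (corner z, corner z + const_mx delta).

(** Concentric with the cell and three times as wide: it contains all that a mollifier of radius
    [delta] sees from the cell. It is closed because the averaging property concerns closed
    cubes. *)
Definition cell3 z : set Rn := cube (corner z - const_mx delta) (3 * delta).

Lemma cell_cell3 z x y : cell z x -> `|x - y| <= delta -> cell3 z y.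
Proof.
move=> zx xy i; have := zx i; have := le_trans (normcV_coord _ i) xy; rewrite /= !mxE.
by rewrite ler_norml => /andP[h1 h2] /andP[h3 h4]; apply/andP; split; lra.
Qed.

Lemma cell3_near z x y : cell z x -> cell3 z y -> `|x - y| <= 2 * delta.
Proof.
move=> zx zy; apply: normcV_le => [|i]; first by rewrite mulr_ge0// ltW.
have := zx i; have := zy i; rewrite /= !mxE ler_norml => /andP[h1 h2] /andP[h3 h4].
by have d0 := delta0; apply/andP; split; lra.
Qed.

Lemma cell_cover x : 2 * B <= M%:R * delta ->
  box (const_mx (- B), const_mx B) x -> exists z, cell z x.
Proof.
move=> BM Bx.
have ex i : exists t : 'I_M, - B + t%:R * delta < x i 0 <= - B + t%:R * delta + delta.
  have := Bx i; rewrite /= !mxE => /andP[h1 h2].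
  pose A t := x i 0 <= - B + t%:R * delta + delta.
  have exA : exists t, A t.
    by exists M; rewrite /A; have d0 := delta0; lra.
  case: (ex_minnP exA) => t tA tmin.
  have tx : - B + t%:R * delta < x i 0.
    case: t tA tmin => [|t] tA tmin; first by rewrite mul0r addr0.
    rewrite ltNge; apply/negP => tx; suff /tmin : A t by rewrite ltnn.
    by rewrite /A (le_trans tx)// -natr1 mulrDl mul1r addrA.
  have tM : (t < M)%N.
    rewrite -(ltr_nat R) -(ltr_pM2r delta0); lra.
  by exists (Ordinal tM); rewrite tx.
have [z zP] := @choice _ _ (fun i (t : 'I_M) => - B + t%:R * delta < x i 0 <= - B + t%:R * delta + delta) ex.
by exists [ffun i => z i] => i; rewrite /= !mxE ffunE; exact: zP.
Qed.

(** The indices counted lie among t0, ..., t0 + 3, where [t0] is the least natural number not below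
    [a]. *)
Let count_le4 (a : R) : \sum_(t < M) (a <= t%:R <= a + 3)%R%:R <= 4 :> R.
Proof.
have [N aN] : exists N : nat, a <= N%:R.
  by exists (Num.truncn a).+1; rewrite ltW// truncnS_gt.
case: (ex_minnP (ex_intro (fun N : nat => a <= N%:R) N aN)) => t0 at0 t0min.
apply: (@le_trans _ _ (\sum_(t < M) \sum_(e < 4) ((t : nat) == (t0 + e)%N)%:R)).
  apply: ler_sum => t _; case: andP => [[h1 h2]|_]; last by rewrite sumr_ge0.
  have t0t : (t0 <= t)%N := t0min _ h1.
  have tt0 : (t - t0 < 4)%N.
    rewrite ltn_subLR// -(ltr_nat R) natrD.
    apply: (le_lt_trans h2); move: at0; case: (t0) t0min => [|t1] t0min at0; first lra.
    have : t1%:R < a by rewrite ltNge; apply/negP => /t0min; rewrite ltnn.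
    by rewrite -natr1; lra.
  by rewrite (bigD1 (Ordinal tt0))//= subnKC// eqxx lerDl sumr_ge0.
rewrite exchange_big/= [leRHS](_ : 4 = \sum_(e < 4) (1 : R)); last by rewrite sumr_const card_ord.
apply: ler_sum => e _; have [eM|Me] := ltnP (t0 + e) M.
  rewrite (bigD1 (Ordinal eM))//= eqxx big1 ?addr0// => t.
  by rewrite -(inj_eq val_inj)/= => /negbTE ->.
rewrite big1// => t _; case: eqP => // te.
by have := ltn_ord t; rewrite te ltnNge Me.
Qed.

Lemma cell3_overlap (J : pred index) x : \sum_(z | J z) \1_(cell3 z) x <= 4 ^+ n.+1 :> R.
Proof.
apply: (@le_trans _ _ (\sum_z \1_(cell3 z) x)).
  by rewrite [leRHS](bigID J)/= lerDl sumr_ge0.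
(* [x] belongs to [cell3 z] exactly when every z_i lies in [a_i, a_i + 3]; the sum over z of the
   products then factors into one-dimensional counts. *)
pose a i := (x i 0 + B) / delta - 2.
have E z : \1_(cell3 z) x <= \prod_i (a i <= (z i)%:R <= a i + 3)%R%:R :> R.
  have [xz|nxz] := pselect (cell3 z x); last by rewrite indicE memNset// prodr_ge0.
  rewrite indicE mem_set// big1// => i _.
  have := xz i; rewrite /= !mxE => /andP[h1 h2].
  by rewrite /a lerBlDr ler_pdivrMr// -lerBlDr lerBrDr ler_pdivlMr//;
    case: andP => // -[]; split; lra.
apply: le_trans (ler_sum _ (fun z _ => E z)) _.
rewrite -(bigA_distr_bigA (fun i (t : 'I_M) => (a i <= t%:R <= a i + 3)%R%:R)).
rewrite [leRHS](_ : 4 ^+ n.+1 = \prod_(i < n.+1) 4); last by rewrite prodr_const card_ord.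
apply: ler_prod => i _; rewrite count_le4 andbT.
by apply: sumr_ge0.
Qed.

End cells.

End grid.

(** * Admissible weights and their local integrability *)

Section admissible_weights.
Local Open Scope classical_set_scope.
Local Open Scope ring_scope.
Context {R : realType} {n : nat}.
Local Notation Rn := 'cV[R]_n.+1.
Local Notation X := (lebT R n).
Local Notation mu := (leb R n).

(* The local log-Hoelder condition is stated with the maximum norm. *)
Record admissible (d : nat) (P : Rn -> R) (W : Rn -> 'M[R]_d) (U : set Rn) (PM : R) : Prop :=
  Admissible {
    adm_open : open U;
    adm_measurable : measurable_fun (U : set X) (P : X -> R);
    adm_ge1 : forall x, U x -> 1 <= P x;
    adm_le : forall x, U x -> P x <= PM;
    adm_weight : measurable_mx (U : set X) (W : X -> 'M[R]_d);
    adm_averaging : averaging P W U;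
    adm_log : exists2 C, 0 <= C & forall x y r, U x -> U y -> `|x - y| <= r -> 0 < r ->
      n.+1%:R * r < 2^-1 -> `|P x - P y| <= C / - ln (n.+1%:R * r) }.

Lemma measurable_mxS (m k : nat) (D E : set X) (A : X -> 'M[R]_(m, k)) :
  measurable E -> D `<=` E -> measurable_mx E A -> measurable_mx D A.
Proof. by move=> mE DE mA i j; exact: measurable_funS mE DE (mA i j). Qed.

Section admissible.
Variables (d : nat) (P : Rn -> R) (W : Rn -> 'M[R]_d) (U : set Rn) (PM : R).
Hypothesis adm : admissible P W U PM.

Let mU : measurable (U : set X). Proof. exact: open_measurable_leb (adm_open adm). Qed.

Lemma adm_measurableS (D : set X) : D `<=` U -> measurable_fun D (P : X -> R).
Proof. by move=> DU; exact: measurable_funS mU DU (adm_measurable adm). Qed.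

Lemma adm_weightS (D : set X) : D `<=` U -> measurable_mx D (W : X -> 'M[R]_d).
Proof. by move=> DU; exact: measurable_mxS mU DU (adm_weight adm). Qed.

(** The averaging property is tested on g e_j with g = 1 / (1 + |W|): then |W v| <= 1, while the
    integral in y of |W(x) v(y)| is |W(x) e_j| times the positive number [s]. Local integrability of
    |W|^P is the source of the dominating functions used for bounded fields. *)
Lemma weight_cube_lty (a : Rn) (l : R) : 0 < l -> cube a l `<=` U ->
  (rho mu P (cube a l : set X) (fun x : X => nm1 (W x)) < +oo)%E.
Proof.
move=> l0; set Q := cube a l => QU.
have mQ : measurable (Q : set X) by exact: measurable_cube.
have mP : measurable_fun (Q : set X) (P : X -> R) := adm_measurableS QU.
have mW : measurable_mx (Q : set X) (W : X -> 'M[R]_d) := adm_weightS QU.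
have P1 x : Q x -> 1 <= P x by move=> /QU; exact: (adm_ge1 adm).
have PPM x : Q x -> P x <= PM by move=> /QU; exact: (adm_le adm).
under eq_fun do rewrite nm1_cols.
have mnc j : measurable_fun (Q : set X) (fun x : X => nm1 (col j (W x))).
  apply: measurable_nm1 => i k; under eq_fun do rewrite mxE; exact: mW.
apply: (@rho_sum_lty _ X R mu _ _ P Q PM (fun j x => nm1 (col j (W x))) mQ mP P1 PPM mnc).
  by move=> j x _; exact: nm1_ge0.
move=> j.
have [C C0 av] := adm_averaging adm.
pose g (y : X) := (1 + nm1 (W y))^-1.
have g0 y : 0 < g y by rewrite invr_gt0 ltr_wpDr// nm1_ge0.
have mg : measurable_fun (Q : set X) g.
  apply: measurable_inv; apply: measurable_funD; first exact: measurable_cst.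
  exact: measurable_nm1.
pose v (y : Rn) : 'cV[R]_d := g y *: delta_mx j 0.
have mv : measurable_mx (Q : set X) (v : X -> 'cV[R]_d).
  by apply: measurable_mxZ mg _; exact: measurable_mx_cst.
have Wv x y : nm1 (W x *m v y) = nm1 (col j (W x)) * g y.
  by rewrite -scalemxAr -colE nm1Z gtr0_norm// mulrC.
have Wv1 y : nm1 (W y *m v y) <= 1.
  rewrite Wv ler_pdivrMr ?mul1r; last by rewrite ltr_wpDr// nm1_ge0.
  by rewrite (nm1_cols (W y)) (bigD1 j)//= addrCA lerDl addr_ge0// sumr_ge0// => k _; exact: nm1_ge0.
have Qoo : (mu (Q : set X) < +oo)%E by exact: le_lt_trans (leb_cube_le a l0) (ltry _).
pose m := fine (mu (Q : set X)).
have mE : mu (Q : set X) = m%:E by rewrite fineK// ge0_fin_numE.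
have m0 : 0 < m.
  by rewrite -lte_fin -mE (lt_le_trans _ (leb_cube_ge a (ltW l0)))// lte_fin exprn_gt0.
have ig : (\int[mu]_(y in Q : set X) (g y)%:E <= m%:E)%E.
  rewrite -mE -[leRHS]mul1e -(integral_cst mu mQ 1%E); apply: lower_integral_le => // y _.
    by rewrite lee_fin ltW.
  by rewrite lee_fin invf_le1 ?lerDl ?nm1_ge0// ltr_wpDr// nm1_ge0.
pose s := fine (\int[mu]_(y in Q : set X) (g y)%:E)%E.
have ig0 : (0 <= \int[mu]_(y in Q : set X) (g y)%:E)%E.
  by apply: integral_ge0 => y _; rewrite lee_fin ltW.
have sE : (\int[mu]_(y in Q : set X) (g y)%:E = s%:E)%E.
  by rewrite fineK// ge0_fin_numE// (le_lt_trans ig)// ltry.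
have s0 : 0 < s.
  rewrite lt0r -lee_fin -sE ig0 andbT; apply/eqP => s0.
  have : (\int[mu]_(y in Q : set X) `|(g y)%:E| = 0)%E.
    by under eq_integral => y _ do rewrite gee0_abs ?lee_fin ?(ltW (g0 y))//; rewrite sE s0.
  move=> /(ae_eq_integral_abs mu mQ ((measurable_EFinP _ _).2 mg)) ae0.
  have : (mu (Q : set X) <= 0)%E.
    case: ae0 => N [mN N0 QN]; rewrite -N0; apply: le_measure; rewrite ?inE//.
    move=> y Qy; apply: QN => /= h; have := h Qy.
    by move=> -[] /eqP; rewrite gt_eqF.
  by rewrite mE lee_fin leNgt m0.
(* [N >= 1] gives (1/N)^P <= 1/N, and [N >= m] makes the integral of 1/N over [Q] at most 1. *)
pose N := Num.max 1 m.
have N0 : 0 < N by rewrite lt_max ltr01.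
pose h (x : Rn) := s * nm1 (col j (W x)).
have hh : (rho mu P (Q : set X) (fun x : X => (C * N * l ^+ n.+1)^-1 * h x)%R <= 1)%E.
  apply: (av a l N v h l0 QU N0 mv).
  - by move=> x _; rewrite mulr_ge0 ?nm1_ge0// ltW.
  - move=> x _; under eq_integral do rewrite Wv EFinM.
    rewrite (@ge0_integralZl_EFin _ X R mu Q mQ); last 3 first.
    + by move=> y _; rewrite lee_fin ltW.
    + exact/measurable_EFinP.
    + exact: nm1_ge0.
    by rewrite sE -EFinM lee_fin /h mulrC.
  apply: (@le_trans _ _ (\int[mu]_(x in Q : set X) (N^-1)%:E)%E).
    apply: lower_integral_le => // y Qy; rewrite lee_fin ?powR_ge0 ?invr_ge0 ?(ltW N0)//.
    have Py := P1 y Qy.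
    apply: (@le_trans _ _ (N^-1 `^ P y)).
      apply: ge0_ler_powR; rewrite ?nnegrE ?mulr_ge0 ?invr_ge0 ?nm1_ge0 ?(ltW N0) ?(le_trans _ Py)//.
      by rewrite ler_piMr// invr_ge0 ltW.
    by rewrite ge1r_powR// invr_gt0 N0/= invf_le1// le_max lexx.
  rewrite integral_cst// mE -EFinM lee_fin mulrC ler_pdivrMr// mul1r.
  by rewrite le_max lexx orbT.
pose c := (C * N * l ^+ n.+1) * s^-1.
have Cl : 0 < C * N * l ^+ n.+1 by rewrite !mulr_gt0// exprn_gt0.
have c0 : 0 < c by rewrite mulr_gt0// invr_gt0.
have mh : measurable_fun (Q : set X) (fun x : X => (C * N * l ^+ n.+1)^-1 * h x).
  apply: measurable_funM; first exact: measurable_cst.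
  by apply: measurable_funM; [exact: measurable_cst|exact: mnc].
have h0 x : Q x -> 0 <= (C * N * l ^+ n.+1)^-1 * h x.
  by move=> _; rewrite mulr_ge0 ?invr_ge0 ?(ltW Cl)// mulr_ge0 ?nm1_ge0// ltW.
have c1 : 1 <= Num.max 1 c by rewrite le_max lexx.
apply: (@le_lt_trans _ _ (rho mu P (Q : set X) (fun x : X =>
    Num.max 1 c * ((C * N * l ^+ n.+1)^-1 * h x))%R)).
  apply: le_rho => // [x /P1|x Qx]; first by apply: le_trans.
  rewrite nm1_ge0/=; apply: (@le_trans _ _ (c * ((C * N * l ^+ n.+1)^-1 * h x))).
    rewrite /c /h le_eqVlt; apply/orP; left; apply/eqP.
    by rewrite mulrACA divff ?gt_eqF// mul1r mulrA mulVf ?gt_eqF// mul1r.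
  by apply: ler_wpM2r; [exact: h0|rewrite le_max lexx orbT].
apply: le_lt_trans (rhoZ_le mu mQ mP P1 PPM mh h0 c1) _.
apply: lte_mul_pinfty; [by rewrite lee_fin powR_ge0|by []|].
exact: le_lt_trans hh (ltry 1).
Qed.

Lemma weight_compact_lty (i : nat) :
  (rho mu P (exhaust U i : set X) (fun x : X => nm1 (W x)) < +oo)%E.
Proof.
set K := exhaust U i.
have KU : K `<=` U by exact: exhaust_sub.
have mK : measurable (K : set X) by exact: exhaust_measurable.
have [B B0 KB] := compact_box (@exhaust_compact R n U i).
(* A tripled cell lies within [2 * delta], that is [gap i], of each point of its cell, hence in [U]
   if the cell meets level [i]. *)
pose delta : R := gap i / 2.
have delta0 : 0 < delta by rewrite divr_gt0// gap_gt0.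
pose M := (Num.truncn (2 * B / delta)).+1.
have BM : 2 * B <= M%:R * delta.
  by rewrite -ler_pdivrMr// ltW// truncnS_gt.
pose J := [pred z : {ffun 'I_n.+1 -> 'I_M} | `[< exists2 x, K x & cell B delta z x >]].
have JU z : J z -> cell3 B delta z `<=` U.
  move=> /asboolP[x Kx zx] y zy; apply: (@exhaust_sub _ _ U i.+1).
  apply: exhaust_ball Kx _; apply: le_trans (cell3_near delta0 zx zy) _.
  by rewrite mulrC divfK.
have mE (z : {ffun 'I_n.+1 -> 'I_M}) : measurable (cell B delta z `&` K : set X).
  by apply: measurableI => //; exact: measurable_box.
have l0 : 0 < 3 * delta by rewrite mulr_gt0.
apply: (@le_lt_trans _ _ (\sum_(z | J z) \int[mu]_(x in (cell B delta z `&` K) : set X) (nm1 (W x) `^ P x)%:E)%E).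
  have EK z : J z -> cell B delta z `&` K `<=` K by move=> _ x [].
  have f0 (x : X) : K x -> (0 <= (nm1 (W x) `^ P x)%:E)%E.
    by move=> _; rewrite lee_fin powR_ge0.
  have mf : measurable_fun (K : set X) (fun x : X => (nm1 (W x) `^ P x)%:E).
    apply/measurable_EFinP; apply: (measurable_powR_exponent mK (adm_measurableS KU)).
      by move=> x /KU; exact: (adm_ge1 adm).
    exact: measurable_nm1 (adm_weightS KU).
  refine (@integral_le_cover _ X R mu _ J K _ _ mK mE EK f0 mf _).
  move=> x Kx; right; have [z zx] := cell_cover delta0 BM (KB x Kx).
  by exists z => //; apply/asboolP; exists x.
apply: lte_sum_pinfty => z Jz.
apply: le_lt_trans (weight_cube_lty l0 (JU z Jz)).
apply: lower_integral_le.
- by move=> x [zx _]; apply: cell_cell3 zx _; rewrite subrr normr0 ltW.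
- by move=> x _; rewrite lee_fin powR_ge0.
- by move=> x _; rewrite lee_fin powR_ge0.
- by [].
Qed.

End admissible.
End admissible_weights.

(** * Mollification of vector fields *)

Section vector_mollification.
Local Open Scope classical_set_scope.
Local Open Scope ring_scope.
Context {R : realType} {n : nat}.
Local Notation Rn := 'cV[R]_n.+1.
Local Notation X := (lebT R n).
Local Notation mu := (leb R n).
Implicit Types (k : nat) (x y : Rn).

Lemma mollify_lin k (I : Type) (r : seq I) (c : I -> R) (u : I -> Rn -> R) x :
  (forall i, summable (u i)) ->
  summable (fun y => \sum_(i <- r) c i * u i y) /\
  mollify k (fun y => \sum_(i <- r) c i * u i y) x = \sum_(i <- r) c i * mollify k (u i) x.
Proof.
move=> su; have tm : test_function setT (mollifier k : Rn -> R) := mollifier_test k.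
elim: r => [|i r [sIH IH]].
  under [X in summable X]eq_fun do rewrite big_nil.
  rewrite big_nil; split.
    by have := summableZ 0 (test_function_summable tm); under eq_fun do rewrite mul0r.
  by apply: mollify_eq0 => y _; rewrite big_nil.
under [X in summable X]eq_fun do rewrite big_cons.
split; first by apply: summableD => //; exact: summableZ.
rewrite big_cons -IH -(convZ (c i) x tm (su i)) -(convD x tm (summableZ (c i) (su i)) sIH).
by congr conv; apply/funext => y; rewrite big_cons.
Qed.

Definition summable_vec d (v : Rn -> 'cV[R]_d) : Prop := forall i, summable (fun y => v y i 0).

Definition mollify_vec d k (v : Rn -> 'cV[R]_d) x : 'cV[R]_d :=
  \col_i mollify k (fun y => v y i 0) x.

Lemma summable_vec_measurable d (v : Rn -> 'cV[R]_d) (D : set X) : summable_vec v ->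
  measurable_mx D (v : X -> 'cV[R]_d).
Proof.
move=> sv i j; rewrite ord1; apply: measurable_funTS.
exact: summable_measurable (sv i).
Qed.

Lemma mollify_vec_measurable d k (v : Rn -> 'cV[R]_d) (D : set X) : summable_vec v ->
  measurable_mx D (mollify_vec k v : X -> 'cV[R]_d).
Proof.
move=> sv i j; under eq_fun do rewrite mxE; apply: measurable_funTS.
exact: mollify_measurable (sv i).
Qed.

Lemma summable_vec_mul m d (A : 'M[R]_(m, d)) (v : Rn -> 'cV[R]_d) : summable_vec v ->
  summable_vec (fun y => A *m v y).
Proof.
move=> sv i; under eq_fun do rewrite mxE.
by have [] := mollify_lin 0 (index_enum 'I_d) (A i) 0 sv.
Qed.

(** Used with the constant matrix A = W(x), where [x] is also the point of evaluation. *)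
Lemma mulmx_mollify m d (A : 'M[R]_(m, d)) k (v : Rn -> 'cV[R]_d) x : summable_vec v ->
  A *m mollify_vec k v x = mollify_vec k (fun y => A *m v y) x.
Proof.
move=> sv; apply/matrixP => i j; rewrite !mxE.
have [_ E] := mollify_lin k (index_enum 'I_d) (A i) x sv.
under eq_bigr do rewrite mxE.
rewrite -E /mollify; congr conv; apply/funext => y; rewrite mxE.
by apply: eq_bigr.
Qed.

Lemma summable_nm1 d (v : Rn -> 'cV[R]_d) : summable_vec v -> summable (fun y => nm1 (v y)).
Proof.
move=> sv; have [+ _] := mollify_lin 0 (index_enum 'I_d) (fun=> 1) 0 (fun i => summable_norm (sv i)).
by congr summable; apply/funext => y; apply: eq_bigr => i _; rewrite mul1r big_ord1.
Qed.

Lemma nm1_mollify_le d k (v : Rn -> 'cV[R]_d) x : summable_vec v ->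
  nm1 (mollify_vec k v x) <= mollify k (fun y => nm1 (v y)) x.
Proof.
move=> sv.
have [_ E] := mollify_lin k (index_enum 'I_d) (fun=> 1) x (fun i => summable_norm (sv i)).
have -> : (fun y => nm1 (v y)) = (fun y => \sum_(i <- index_enum 'I_d) 1 * `|v y i 0|).
  by apply/funext => y; apply: eq_bigr => i _; rewrite mul1r big_ord1.
rewrite E; apply: ler_sum => i _; rewrite big_ord1 mul1r mxE.
exact: mollify_norm_le.
Qed.

Lemma mollify_le_integral k (u : Rn -> R) x (Q : set X) : summable u -> (forall y, 0 <= u y) ->
  measurable Q -> (forall y, `|x - y| <= k.+1%:R^-1 -> Q y) ->
  ((mollify k u x)%:E <= (bump_min (R := R) (n := n) ^-1 * k.+1%:R ^+ n.+1)%:E *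
     \int[mu]_(y in Q) (u y)%:E)%E.
Proof.
move=> su u0 mQ xQ; have tm : test_function setT (mollifier k : Rn -> R) := mollifier_test k.
have [sc] := summable_conv x tm su.
have c0 : 0 <= bump_min (R := R) (n := n) ^-1 * k.+1%:R ^+ n.+1.
  by rewrite mulr_ge0 ?exprn_ge0// invr_ge0 ltW// bump_min_gt0.
have hfin := integrable_fin_num measurableT sc.
rewrite /mollify /conv /Rintegral (fineK hfin).
have muQ : measurable_fun Q (fun y : X => (u y)%:E).
  by apply/measurable_EFinP; apply: measurable_funTS; exact: summable_measurable su.
have u0E (y : X) : Q y -> (0 <= (u y)%:E)%E by rewrite lee_fin.
rewrite -(@ge0_integralZl_EFin _ X R mu Q mQ _ u0E muQ _ c0).
rewrite [leRHS]integral_mkcond; apply: lower_integral_le => [//|y _|y _|y _].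
- by rewrite lee_fin mulr_ge0 ?mollifier_ge0.
- by rewrite /patch; case: ifP => // _; rewrite mule_ge0 ?lee_fin.
rewrite /patch; case: ifPn => [_|/negP].
  by rewrite -EFinM lee_fin ler_wpM2r ?mollifier_le.
rewrite inE => nQ; rewrite /= mollifier_eq0 ?mul0r ?lexx//.
by rewrite ltNge; apply/negP => /xQ.
Qed.

End vector_mollification.

(** * The uniform modular bound *)

Section cell_bound.
Local Open Scope classical_set_scope.
Local Open Scope ring_scope.
Context {R : realType} {n : nat}.
Local Notation Rn := 'cV[R]_n.+1.
Local Notation X := (lebT R n).
Local Notation mu := (leb R n).
Variables (d : nat) (P : Rn -> R) (W : Rn -> 'M[R]_d) (U : set Rn) (PM : R).
Hypothesis adm : admissible P W U PM.

Let powR_expR (a b : R) : expR a `^ b = expR (b * a).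
Proof. by rewrite /powR gt_eqF ?expR_gt0// expRK. Qed.

(* The normalization N of |W v| on the cube is chosen such that N^P(x) is
   comparable with m = max(rho(W v), |Q|) for every x in the cube: log-Hoelder
   continuity makes |Q|^(P(x) - P(a)) bounded. *)
Lemma cell_bound : exists2 A : R, 1 <= A &
  forall k (a : Rn) (v : Rn -> 'cV[R]_d) (E : set X) (eta G : R),
  cube a (3 * k.+1%:R^-1) `<=` U -> measurable E -> E `<=` cube a (3 * k.+1%:R^-1) ->
  (forall x y, E x -> `|x - y| <= k.+1%:R^-1 -> cube a (3 * k.+1%:R^-1) y) ->
  0 <= eta -> (forall x, cube a (3 * k.+1%:R^-1) x -> `|P x - P a| <= eta) ->
  eta * ln k.+1%:R <= G -> summable_vec v ->
  (rho mu P (cube a (3 * k.+1%:R^-1) : set X) (fun x : X => nm1 (W x *m v x)) <= 1)%E ->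
  (rho mu P E (fun x : X => nm1 (W x *m mollify_vec k v x)) <=
   (A `^ PM * expR (2 * n.+1%:R * G))%:E *
   (rho mu P (cube a (3 * k.+1%:R^-1) : set X) (fun x : X => nm1 (W x *m v x)) +
    (k.+1%:R ^- n.+1)%:E))%E.
Proof.
have [C C0 av] := adm_averaging adm.
pose Bm : R := (bump_min (R := R) (n := n))^-1.
have Bm0 : 0 < Bm by rewrite invr_gt0 bump_min_gt0.
(* [C] from the averaging property, [3 ^+ n.+1] from the side of the tripled cube, [Bm] from the sup
   bound of the mollifier. *)
pose A0 := C * 3 ^+ n.+1 * Bm.
have A00 : 0 < A0 by rewrite !mulr_gt0// exprn_gt0.
pose A := Num.max 1 A0.
have A1 : 1 <= A by rewrite le_max lexx.
have A0A : A0 <= A by rewrite le_max lexx orbT.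
exists A => // k a v E eta G; set K1 : R := k.+1%:R; set Q := cube a _ => QU mE EQ EnQ eta0 Peta etaG sv.
set w := fun x : X => nm1 (W x *m v x) => rw1.
have K10 : 0 < K1 by rewrite ltr0n.
have K11 : 1 <= K1 by rewrite ler1n.
have l0 : 0 < 3 * K1^-1 by rewrite mulr_gt0// invr_gt0.
have mQ : measurable (Q : set X) by exact: measurable_cube.
have mP : measurable_fun (Q : set X) (P : X -> R) := adm_measurableS adm QU.
have mW : measurable_mx (Q : set X) (W : X -> 'M[R]_d) := adm_weightS adm QU.
have P1 x : Q x -> 1 <= P x by move=> /QU; exact: (adm_ge1 adm).
have PPM x : Q x -> P x <= PM by move=> /QU; exact: (adm_le adm).
have P0 x : Q x -> 0 <= P x by move=> /P1; apply: le_trans.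
have mv : measurable_mx (Q : set X) (v : X -> 'cV[R]_d) by exact: summable_vec_measurable.
have mw : measurable_fun (Q : set X) w by apply: measurable_nm1; exact: measurable_mxM mW mv.
pose r := fine (rho mu P (Q : set X) w).
have rE : rho mu P (Q : set X) w = r%:E.
  by rewrite fineK// ge0_fin_numE ?rho_ge0// (le_lt_trans rw1)// ltry.
have r0 : 0 <= r by rewrite -lee_fin -rE rho_ge0.
have r1 : r <= 1 by rewrite -lee_fin -rE.
pose V := K1 ^- n.+1.
have V0 : 0 < V by rewrite invr_gt0 exprn_gt0.
have V1 : V <= 1 by rewrite invf_le1 ?exprn_gt0// exprn_ege1.
(* The floor [V] keeps [L = - ln m] below (n+1) ln(k+1); it is responsible for the additive error in
   the conclusion. *)
pose m := Num.max r V.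
have m0 : 0 < m by rewrite lt_max V0 orbT.
have m1 : m <= 1 by rewrite ge_max r1 V1.
pose L := - ln m.
have mL : m = expR (- L) by rewrite /L opprK lnK.
have L0 : 0 <= L by rewrite oppr_ge0 ln_le0.
have LK : L <= n.+1%:R * ln K1.
  rewrite lerNl; have -> : - (n.+1%:R * ln K1) = ln V.
    by rewrite /V lnV ?posrE ?exprn_gt0// lnXn// mulr_natl.
  by rewrite ler_ln ?posrE// le_max lexx orbT.
(* On the cube, [q - P x] lies between 0 and [2 * eta]. For N = m^(1/q), with m <= 1, this gives m
   <= N^P <= m exp(2 eta L), and eta L is at most (n+1) [G]. *)
pose q := P a + eta.
have Qa : Q a by move=> i; rewrite lexx lerDl ltW.
have q1 : 1 <= q by rewrite (le_trans (P1 a Qa))// lerDl.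
have q0 : 0 < q by exact: lt_le_trans q1.
pose N := expR (- L / q).
have N0 : 0 < N by exact: expR_gt0.
have Nlo x : Q x -> m <= N `^ P x.
  move=> Qx; rewrite powR_expR mL ler_expR mulrCA mulNr lerN2 ler_piMr//.
  rewrite ler_pdivrMr// mul1r /q.
  by have := Peta x Qx; rewrite ler_distl => /andP[].
have Nup x : Q x -> N `^ P x <= m * expR (2 * n.+1%:R * G).
  move=> Qx; rewrite powR_expR mL -expRD ler_expR.
  have -> : P x * (- L / q) = - L + L * ((q - P x) / q).
    by field; rewrite gt_eqF.
  rewrite lerD2l.
  have h : (q - P x) / q <= 2 * eta.
    rewrite ler_pdivrMr//; have := Peta x Qx; rewrite ler_distl => /andP[h1 h2].
    apply: (@le_trans _ _ (2 * eta)); first by rewrite /q; lra.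
    by rewrite ler_peMr// mulr_ge0.
  apply: (@le_trans _ _ (L * (2 * eta))); first exact: ler_wpM2l.
  apply: (@le_trans _ _ (n.+1%:R * ln K1 * (2 * eta))); first by rewrite ler_wpM2r// mulr_ge0.
  have -> : n.+1%:R * ln K1 * (2 * eta) = 2 * n.+1%:R * (eta * ln K1) by ring.
  by rewrite ler_wpM2l// mulr_ge0.
have rwN : (rho mu P (Q : set X) (fun x : X => N^-1 * w x)%R <= 1)%E.
  apply: (@le_trans _ _ (m^-1%:E * rho mu P (Q : set X) w)%E).
    rewrite /rho -(@ge0_integralZl_EFin _ X R mu Q mQ); last 3 first.
    - by move=> x _; rewrite lee_fin powR_ge0.
    - by apply/measurable_EFinP; exact: (measurable_powR_exponent mQ mP P1 mw).
    - by rewrite invr_ge0 ltW.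
    apply: lower_integral_le => [//|x _|x _|x Qx].
    + by rewrite lee_fin powR_ge0.
    + by rewrite -EFinM lee_fin mulr_ge0 ?powR_ge0// invr_ge0 ltW.
    rewrite -EFinM lee_fin powRM ?nm1_ge0 ?invr_ge0 ?(ltW N0)// ler_wpM2r ?powR_ge0//.
    have -> : N^-1 `^ P x = (N `^ P x)^-1 by rewrite /N -expRN !powR_expR mulrN expRN.
    by rewrite lef_pV2 ?posrE ?powR_gt0// Nlo.
  by rewrite rE -EFinM lee_fin mulrC ler_pdivrMr// mul1r le_max lexx.
pose u x := nm1 (W x *m mollify_vec k v x).
have u0 x : 0 <= u x by exact: nm1_ge0.
(* Extended by zero from [E] to the whole cube, as the averaging property requires. *)
pose h x : R := \1_E x * ((Bm * K1 ^+ n.+1)^-1 * u x).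
have BK0 : 0 < Bm * K1 ^+ n.+1 by rewrite mulr_gt0// exprn_gt0.
have rh : (rho mu P (Q : set X) (fun x : X => (C * N * (3 * K1^-1) ^+ n.+1)^-1 * h x)%R <= 1)%E.
  apply: (av a _ N v h l0 QU N0 mv _ _ rwN) => x Qx.
    by rewrite /h mulr_ge0// mulr_ge0// invr_ge0 ltW.
  have [Ex|nEx] := pselect (E x); last first.
    rewrite /h indicE memNset// mul0r; apply: integral_ge0 => y _.
    by rewrite lee_fin nm1_ge0.
  rewrite /h indicE mem_set// mul1r EFinM lee_pdivrMl//.
  apply: le_trans (mollify_le_integral (summable_nm1 (summable_vec_mul (W x) sv))
    (fun y => nm1_ge0 _) mQ (fun y => EnQ x y Ex)).
  by rewrite lee_fin /u mulmx_mollify// nm1_mollify_le//; exact: summable_vec_mul.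
pose g x := (A * N)^-1 * u x.
have AN0 : 0 < A * N by rewrite mulr_gt0// (lt_le_trans ltr01).
have EU : E `<=` Q by [].
have rg : (rho mu P E g <= 1)%E.
  apply: le_trans rh; apply: le_rho => [//|x /EQ/P0//|x Ex].
  rewrite /g mulr_ge0 ?invr_ge0 ?(ltW AN0)//=.
  rewrite /h indicE mem_set// mul1r mulrA -invfM ler_wpM2r// lef_pV2 ?posrE//; last first.
    by rewrite !mulr_gt0// exprn_gt0// invr_gt0.
  have -> : C * N * (3 * K1^-1) ^+ n.+1 * (Bm * K1 ^+ n.+1) = A0 * N.
    by rewrite /A0 exprMn exprVn; field; rewrite expf_neq0// gt_eqF.
  by rewrite ler_wpM2r// ltW.
have mg : measurable_fun E g.
  apply: measurable_funM; first exact: measurable_cst.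
  apply: measurable_nm1; apply: measurable_mxM; first exact: measurable_mxS mQ EQ mW.
  exact: mollify_vec_measurable.
have P1E x : E x -> 1 <= P x by move=> /EQ/P1.
have c0 : 0 <= A `^ PM * expR (2 * n.+1%:R * G) * m.
  by rewrite !mulr_ge0 ?powR_ge0 ?expR_ge0// ltW.
(* Since u = A N g, the bound for N^P leaves a factor [m] and the modular of [g], which is at most
   1; finally the maximum [m] is at most the sum of its two terms. *)
apply: (@le_trans _ _ ((A `^ PM * expR (2 * n.+1%:R * G) * m)%:E * rho mu P E g)%E).
  rewrite /rho -(@ge0_integralZl_EFin _ X R mu E mE); last 3 first.
  - by move=> x _; rewrite lee_fin powR_ge0.
  - apply/measurable_EFinP.
    exact: (measurable_powR_exponent mE (measurable_funS mQ EQ mP) P1E mg).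
  - exact: c0.
  apply: lower_integral_le => [//|x _|x _|x Ex].
  - by rewrite lee_fin powR_ge0.
  - by rewrite -EFinM lee_fin mulr_ge0 ?powR_ge0.
  have Qx := EQ x Ex.
  rewrite -EFinM lee_fin -/(u x).
  have -> : u x = A * N * g x by rewrite /g mulVKf// gt_eqF.
  rewrite powRM ?(ltW AN0)//; last by rewrite /g mulr_ge0// invr_ge0 ltW.
  rewrite ler_wpM2r ?powR_ge0// powRM ?(ltW N0)//; last by rewrite (le_trans ler01).
  rewrite -mulrA; apply: ler_pM; rewrite ?powR_ge0//.
    by rewrite ler_powR// PPM.
  by rewrite mulrC Nup.
apply: le_trans (lee_wpmul2l _ rg) _; first by rewrite lee_fin.
rewrite mule1 rE -EFinD -EFinM lee_fin ler_wpM2l ?mulr_ge0 ?powR_ge0 ?expR_ge0//.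
by rewrite ge_max lerDl lerDr ltW.
Qed.

End cell_bound.

Section mollification_bound.
Local Open Scope classical_set_scope.
Local Open Scope ring_scope.
Context {R : realType} {n : nat}.
Local Notation Rn := 'cV[R]_n.+1.
Local Notation X := (lebT R n).
Local Notation mu := (leb R n).
Variables (d : nat) (P : Rn -> R) (W : Rn -> 'M[R]_d) (U : set Rn) (PM : R).
Hypothesis adm : admissible P W U PM.

(** With K = k+1 and c = 3(n+1), the oscillation over the cube is at most C / (ln K - ln c). The
    requirement c^2 <= K gives 2 ln c <= ln K, whence the bound 2 C for eta ln K. *)
Lemma log_oscillation_cube : exists2 G, 0 <= G & forall k a, ((3 * n.+1) ^ 2 <= k.+1)%N ->
  cube a (3 * k.+1%:R^-1) `<=` U -> exists2 eta, 0 <= eta &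
   eta * ln k.+1%:R <= G /\ (forall x, cube a (3 * k.+1%:R^-1) x -> `|P x - P a| <= eta).
Proof.
have [C C0 logP] := adm_log adm; exists (2 * C); first by rewrite mulr_ge0.
move=> k a kn QU; set K1 : R := k.+1%:R; pose c : R := (3 * n.+1)%:R.
have K10 : 0 < K1 by rewrite ltr0n.
have c3 : 3 <= c by rewrite ler_nat leq_pmulr.
have c0 : 0 < c by rewrite (lt_le_trans _ c3).
have cK : c ^+ 2 <= K1 by rewrite -natrX ler_nat.
have tE : n.+1%:R * (3 * K1^-1) = c / K1 by rewrite /c natrM; ring.
have lnc : 0 < ln c by rewrite ln_gt0// (lt_le_trans _ c3)// ltr1n.
have lnK : 2 * ln c <= ln K1.
  by rewrite mulr_natl -lnXn// ler_ln ?posrE// exprn_gt0.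
have lnt : - ln (c / K1) = ln K1 - ln c.
  by rewrite lnM ?posrE ?invr_gt0// lnV ?posrE// opprD opprK addrC.
have den : 0 < ln K1 - ln c by lra.
exists (C / - ln (n.+1%:R * (3 * K1^-1))).
  by rewrite tE lnt divr_ge0// ltW.
split.
  rewrite tE lnt mulrAC ler_pdivrMr//.
  apply: (@le_trans _ _ (C * (2 * (ln K1 - ln c)))); last by rewrite mulrCA mulrA.
  by rewrite ler_wpM2l//; lra.
move=> x Qx; have r0 : 0 < 3 * K1^-1 by rewrite mulr_gt0// invr_gt0.
apply: logP => //; [exact: QU| | |].
- by apply: QU => i; rewrite lexx lerDl ltW.
- apply: normcV_le => [|i]; first exact: ltW.
  have := Qx i; rewrite !mxE => /andP[h1 h2].
  by rewrite ger0_norm ?subr_ge0// lerBlDl.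
rewrite tE ltr_pdivrMr//.
have : c * 3 <= c ^+ 2 by rewrite expr2 ler_pM2l.
lra.
Qed.

(** The error on each cell is (k+1)^-(n+1), and at most [M ^ n.+1] cells occur, so the errors add up
    to at most (2B + 1)^(n+1) whatever [k]. A modular at most 1 on [U] remains so on every tripled
    cell, where the local bound requires it. *)
Lemma mollify_bound (i : nat) : exists C : R, exists k0 : nat, forall k v, (k0 <= k)%N ->
  summable_vec v -> (forall x, ~ exhaust U i x -> v x = 0) ->
  (rho mu P (U : set X) (fun x : X => nm1 (W x *m v x)) <= 1)%E ->
  (rho mu P (U : set X) (fun x : X => nm1 (W x *m mollify_vec k v x)) <= C%:E)%E.
Proof.
have oU := adm_open adm; have mU := open_measurable_leb oU.
have [A A1 cb] := cell_bound adm; have [G G0 osc] := log_oscillation_cube.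
have [B B0 KB] := compact_box (@exhaust_compact R n U i.+1).
pose c := A `^ PM * expR (2 * n.+1%:R * G).
have c0 : 0 <= c by rewrite mulr_ge0 ?powR_ge0 ?expR_ge0.
(* The first bound is the one under which the oscillation is controlled; the second makes
   [2 * delta <= gap i.+1], so that tripled cells around the support remain in [U]. *)
pose k0 := maxn ((3 * n.+1) ^ 2) (2 * (i.+2 * i.+3))%N.
exists (c * (4 ^+ n.+1 + (2 * B + 1) ^+ n.+1)), k0 => k v kk0 sv v0 rv.
pose delta : R := k.+1%:R^-1.
have delta0 : 0 < delta by rewrite invr_gt0.
have k1 : ((3 * n.+1) ^ 2 <= k.+1)%N.
  by apply: leqW; apply: leq_trans kk0; exact: leq_maxl.
have k2 : (2 * (i.+2 * i.+3) <= k)%N by apply: leq_trans kk0; exact: leq_maxr.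
have dgap : 2 * delta <= gap i.+1.
  rewrite gapE -[leLHS]invrK lef_pV2 ?posrE ?invr_gt0 ?mulr_gt0//.
  by rewrite invfM invrK ler_pdivlMl// -!natrM ler_nat leqW.
pose M := (Num.truncn (2 * B / delta)).+1.
have BM : 2 * B <= M%:R * delta by rewrite -ler_pdivrMr// ltW// truncnS_gt.
have MB : M%:R * delta <= 2 * B + 1.
  rewrite /M -natr1 mulrDl mul1r lerD//; last by rewrite invf_le1// ler1n.
  by rewrite -ler_pdivlMr// truncn_le// divr_ge0 ?mulr_ge0// ltW.
pose I := {ffun 'I_n.+1 -> 'I_M}.
pose J (z : I) : bool := `[< exists2 x, exhaust U i.+1 x & cell B delta z x >].
have JU (z : I) : J z -> cell3 B delta z `<=` U.
  move=> /asboolP[x Kx zx] y zy; apply: (@exhaust_sub _ _ U i.+2).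
  by apply: exhaust_ball Kx _; apply: le_trans (cell3_near delta0 zx zy) _.
have cc3 (z : I) : cell B delta z `<=` cell3 B delta z.
  by move=> x zx; apply: cell_cell3 zx _; rewrite subrr normr0 ltW.
pose w := fun x : X => nm1 (W x *m v x).
pose u := fun x : X => nm1 (W x *m mollify_vec k v x).
have mE (z : I) : measurable (cell B delta z : set X) by exact: measurable_box.
have mE3 (z : I) : measurable (cell3 B delta z : set X) by exact: measurable_cube.
have JU1 (z : I) : J z -> cell B delta z `<=` U.
  by move=> Jz; exact: subset_trans (cc3 z) (JU z Jz).
have p0 (f : X -> R) (x : X) : U x -> (0 <= (f x `^ P x)%:E)%E.
  by move=> _; rewrite lee_fin powR_ge0.
have mW := adm_weight adm.
have mu_ : measurable_fun (U : set X) (fun x : X => (u x `^ P x)%:E).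
  apply/measurable_EFinP; apply: (measurable_powR_exponent mU (adm_measurable adm) (adm_ge1 adm)).
  by apply: measurable_nm1; apply: measurable_mxM mW _; exact: mollify_vec_measurable.
have mw : measurable_fun (U : set X) (fun x : X => (w x `^ P x)%:E).
  apply/measurable_EFinP; apply: (measurable_powR_exponent mU (adm_measurable adm) (adm_ge1 adm)).
  by apply: measurable_nm1; apply: measurable_mxM mW _; exact: summable_vec_measurable.
apply: (@le_trans _ _ (\sum_(z | J z) rho mu P (cell B delta z : set X) u)%E).
  apply: (@integral_le_cover _ X R mu I J U _ _ mU mE JU1 (p0 u) mu_) => x Ux.
  have [Kx|nKx] := pselect (exhaust U i.+1 x).
    right; have [z zx] := cell_cover delta0 BM (KB x Kx).
    by exists z => //; apply/asboolP; exists x.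
  left; rewrite /u (_ : mollify_vec k v x = 0) ?mulmx0 ?nm1_0 ?powR0//.
    by rewrite gt_eqF// (lt_le_trans _ (adm_ge1 adm Ux)).
  apply/matrixP => a b; rewrite !mxE; apply: (mollify_exhaust_eq0 (U := U) (i := i)) => //.
    apply: leq_trans k2; rewrite mulnA; apply: leq_mul => //.
    by rewrite (leq_trans (leqnSn _))// leq_pmull.
  by move=> y /v0 ->; rewrite mxE.
apply: (@le_trans _ _ (\sum_(z | J z) (c%:E * (rho mu P (cell3 B delta z : set X) w + (delta ^+ n.+1)%:E)))%E).
  apply: lee_sum => z Jz.
  have [eta eta0 [etaG Peta]] := osc k _ k1 (JU z Jz).
  rewrite /delta exprVn; apply: (cb k _ v _ eta G (JU z Jz) (mE z) (cc3 z)) => //.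
  - by move=> x y zx xy; exact: cell_cell3 zx xy.
  - apply: le_trans rv; apply: lower_integral_le => //; first exact: JU.
    + by move=> x _; rewrite lee_fin powR_ge0.
    + by move=> x _; rewrite lee_fin powR_ge0.
rewrite -ge0_sume_distrr; last by move=> z _; rewrite adde_ge0 ?rho_ge0// lee_fin exprn_ge0// ltW.
rewrite (EFinM c); apply: lee_wpmul2l; first by rewrite lee_fin.
rewrite big_split/= EFinD; apply: leeD.
  apply: le_trans (@sum_integral_le_overlap _ X R mu I J U _ _ (4 ^+ n.+1) mU mE3 JU (p0 w) mw _ _) _.
  - by move=> x _; exact: cell3_overlap.
  - by rewrite exprn_ge0.
  rewrite -[leRHS]mule1; apply: lee_wpmul2l; first by rewrite lee_fin exprn_ge0.
  exact: rv.
rewrite sumEFin lee_fin sumr_const.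
apply: (@le_trans _ _ ((M%:R * delta) ^+ n.+1)); last first.
  by apply: lerXn2r => //; rewrite nnegrE ?mulr_ge0 ?addr_ge0 ?mulr_ge0// ltW.
rewrite exprMn -[leLHS]mulr_natl ler_wpM2r ?exprn_ge0 ?(ltW delta0)//.
rewrite -natrX ler_nat (leq_trans (max_card _))//.
by rewrite card_ffun !card_ord.
Qed.

End mollification_bound.

(** * Convergence in the modular and approximation *)

Section dominated_convergence_modular.
Local Open Scope classical_set_scope.
Local Open Scope ring_scope.
Context d (T : measurableType d) (R : realType).
Variable mu : {measure set T -> \bar R}.
Variables (P : T -> R) (D : set T).
Hypotheses (mD : measurable D) (mP : measurable_fun D P) (P1 : forall x, D x -> 1 <= P x).

Lemma rho_dominated (f : nat -> T -> R) (g : T -> R) :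
  (forall n, measurable_fun D (f n)) -> measurable_fun D g ->
  (forall n x, D x -> 0 <= f n x <= g x) -> (rho mu P D g < +oo)%E ->
  {ae mu, forall x, D x -> f n x @[n --> \oo] --> 0} ->
  (rho mu P D (f n) @[n --> \oo] --> 0%E).
Proof.
move=> mf mg fg goo f0.
pose F n x := (f n x `^ P x)%:E.
have mF n : measurable_fun D (F n).
  by apply/measurable_EFinP; exact: measurable_powR_exponent.
have iG : mu.-integrable D (fun x => (g x `^ P x)%:E).
  apply/integrableP; split; first by apply/measurable_EFinP; exact: measurable_powR_exponent.
  apply: le_lt_trans goo; rewrite /rho (eq_integral (fun x => (g x `^ P x)%:E))// => x _.
  by rewrite gee0_abs ?lee_fin ?powR_ge0.
have F0 : {ae mu, forall x, D x -> F ^~ x @ \oo --> cst 0%E x}.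
  apply: filterS f0 => x fx Dx; have {}fx := fx Dx; apply/fine_cvgP; split; first exact: nearW.
  apply/cvgrPdist_le => e e0 /=.
  (* Once the base is at most 1, a power with exponent at least 1 is at most its base. *)
  have e1 : 0 < Num.min e 1 by rewrite lt_min e0 ltr01.
  move/cvgrPdist_le : fx => /(_ _ e1) [N _ fN]; exists N => // k Nk /=.
  have := fN k Nk; have /andP[fk0 _] := fg k x Dx.
  rewrite !sub0r !normrN (ger0_norm fk0) (ger0_norm (powR_ge0 _ _)) le_min => /andP[fe f1].
  apply: le_trans fe; have Px := P1 Dx.
  move: fk0; rewrite le_eqVlt => /predU1P[<-|fk0].
    by rewrite powR0// gt_eqF// (lt_le_trans _ Px).
  by rewrite ge1r_powR// fk0.
have Fg : {ae mu, forall x n, D x -> (`|F n x| <= (g x `^ P x)%:E)%E}.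
  apply: aeW => x k Dx; have /andP[fk0 fkg] := fg k x Dx.
  rewrite /F gee0_abs ?lee_fin ?powR_ge0//.
  apply: ge0_ler_powR => //; [exact: le_trans (P1 Dx)|by rewrite nnegrE (le_trans fk0)].
have [_ _] := dominated_convergence mD mF (measurable_cst _) F0 iG Fg.
by rewrite integral0.
Qed.

End dominated_convergence_modular.

Section mollifiable.
Local Open Scope classical_set_scope.
Local Open Scope ring_scope.
Context {R : realType} {n : nat}.
Local Notation Rn := 'cV[R]_n.+1.
Local Notation X := (lebT R n).
Local Notation mu := (leb R n).
Variables (d : nat) (P : Rn -> R) (W : Rn -> 'M[R]_d) (U : set Rn) (PM : R).
Hypothesis adm : admissible P W U PM.

Let oU := adm_open adm.
Let mU : measurable (U : set X). Proof. exact: open_measurable_leb oU. Qed.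

Lemma mollify_vecB k (v1 v2 : Rn -> 'cV[R]_d) x : summable_vec v1 -> summable_vec v2 ->
  mollify_vec k (fun y => v1 y - v2 y) x = mollify_vec k v1 x - mollify_vec k v2 x.
Proof.
move=> s1 s2; apply/matrixP => i j; rewrite !mxE -(convB _ (mollifier_test k) (s1 i) (s2 i)).
by congr conv; apply/funext => y; rewrite !mxE.
Qed.

Lemma mollify_vecD k (v1 v2 : Rn -> 'cV[R]_d) x : summable_vec v1 -> summable_vec v2 ->
  mollify_vec k (fun y => v1 y + v2 y) x = mollify_vec k v1 x + mollify_vec k v2 x.
Proof.
move=> s1 s2; apply/matrixP => i j; rewrite !mxE -(convD _ (mollifier_test k) (s1 i) (s2 i)).
by congr conv; apply/funext => y; rewrite !mxE.
Qed.

Lemma mollify_vecZ k c (v : Rn -> 'cV[R]_d) x : summable_vec v ->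
  mollify_vec k (fun y => c *: v y) x = c *: mollify_vec k v x.
Proof.
move=> sv; apply/matrixP => i j; rewrite !mxE -(convZ _ _ (mollifier_test k) (sv i)).
by congr conv; apply/funext => y; rewrite !mxE.
Qed.

Lemma summable_vecB (v1 v2 : Rn -> 'cV[R]_d) : summable_vec v1 -> summable_vec v2 ->
  summable_vec (fun y => v1 y - v2 y).
Proof.
move=> s1 s2 i; have := summableB (s1 i) (s2 i).
by congr summable; apply/funext => y; rewrite !mxE.
Qed.

Lemma summable_vecD (v1 v2 : Rn -> 'cV[R]_d) : summable_vec v1 -> summable_vec v2 ->
  summable_vec (fun y => v1 y + v2 y).
Proof.
move=> s1 s2 i; have := summableD (s1 i) (s2 i).
by congr summable; apply/funext => y; rewrite !mxE.
Qed.

Lemma summable_vecZ c (v : Rn -> 'cV[R]_d) : summable_vec v ->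
  summable_vec (fun y => c *: v y).
Proof.
move=> sv i; have := summableZ c (sv i).
by congr summable; apply/funext => y; rewrite !mxE.
Qed.

Let rhoW (v : Rn -> 'cV[R]_d) : \bar R := rho mu P (U : set X) (fun x : X => nm1 (W x *m v x)).

Let mWv (v : Rn -> 'cV[R]_d) : measurable_mx (U : set X) (v : X -> 'cV[R]_d) ->
  measurable_fun (U : set X) (fun x : X => nm1 (W x *m v x)).
Proof. by move=> mv; apply: measurable_nm1; exact: measurable_mxM (adm_weight adm) mv. Qed.

Lemma rhoW_D (v1 v2 : Rn -> 'cV[R]_d) :
  measurable_mx (U : set X) (v1 : X -> 'cV[R]_d) ->
  measurable_mx (U : set X) (v2 : X -> 'cV[R]_d) ->
  (rhoW (fun x => v1 x + v2 x)%R <= (2 `^ PM)%:E * (rhoW v1 + rhoW v2))%E.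
Proof.
move=> m1 m2.
have := rhoD_le mu mU (adm_measurable adm) (adm_ge1 adm) (adm_le adm) (mWv m1) (mWv m2)
  (fun x _ => nm1_ge0 _) (fun x _ => nm1_ge0 _).
apply: le_trans; apply: le_rho => [//|x Ux|x Ux].
  by apply: le_trans (adm_ge1 adm Ux).
by rewrite nm1_ge0/= mulmxDr nm1D.
Qed.

(** The uniform bound is applied to v / eta, whose modular is at most eta^-PM eta^PM = 1, and scaled
    back by eta <= 1. This is equicontinuity of the mollifications at 0. *)
Lemma mollify_small (i : nat) : exists2 C : R, 0 <= C & exists k0 : nat, forall k v eta,
  (k0 <= k)%N -> summable_vec v -> (forall x, ~ exhaust U i x -> v x = 0) ->
  0 < eta <= 1 -> (rhoW v <= (eta `^ PM)%:E)%E ->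
  (rhoW (mollify_vec k v) <= (eta * C)%:E)%E.
Proof.
have [C [k0 CP]] := mollify_bound adm i.
exists `|C| => //; exists k0 => k v eta kk0 sv v0 /andP[eta0 eta1] rv.
have sv' := summable_vecZ eta^-1 sv.
have ei1 : 1 <= eta^-1 by rewrite invf_ge1.
have r1 : (rhoW (fun x => eta^-1 *: v x)%R <= 1)%E.
  have h := rhoZ_le mu mU (adm_measurable adm) (adm_ge1 adm) (adm_le adm)
    (mWv (summable_vec_measurable (D := U) sv)) (fun x _ => nm1_ge0 _) ei1.
  rewrite /rhoW; under eq_fun do rewrite -scalemxAr nm1Z (gtr0_norm (lt_le_trans ltr01 ei1)).
  apply: le_trans h _; apply: le_trans (lee_wpmul2l _ rv) _; first by rewrite lee_fin powR_ge0.
  by rewrite -EFinM lee_fin -powRM ?invr_ge0 ?(ltW eta0)// mulVf ?gt_eqF// powR1.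
have v'0 x : ~ exhaust U i x -> eta^-1 *: v x = 0 by move=> /v0 ->; rewrite scaler0.
have h := CP k _ kk0 sv' v'0 r1.
have e01 : 0 <= eta <= 1 by rewrite ltW.
have h2 := rhoZ_le1 mu mU (adm_measurable adm) (adm_ge1 adm)
  (mWv (mollify_vec_measurable k (D := U) sv')) (fun x _ => nm1_ge0 _) e01.
apply: (@le_trans _ _ (eta%:E * C%:E)%E); last first.
  by rewrite -EFinM lee_fin ler_wpM2l ?ler_norm// ltW.
apply: le_trans (lee_wpmul2l _ h); last by rewrite lee_fin ltW.
apply: le_trans h2; apply: le_rho => [//|x Ux|x Ux]; first by apply: le_trans (adm_ge1 adm Ux).
rewrite nm1_ge0/= mollify_vecZ// -scalemxAr nm1Z ger0_norm ?invr_ge0 ?(ltW eta0)//.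
by rewrite mulrA divff ?mul1r// gt_eqF.
Qed.

Definition mollifiable (v : Rn -> 'cV[R]_d) : Prop :=
  rhoW (fun x => mollify_vec k v x - v x) @[k --> \oo] --> 0%E.

Lemma mollifiable_le v : (forall e : R, 0 < e -> exists k0 : nat, forall k, (k0 <= k)%N ->
  (rhoW (fun x => mollify_vec k v x - v x)%R <= e%:E)%E) -> mollifiable v.
Proof.
move=> h; apply/fine_cvgP; split.
  have [k0 k0P] := h 1 ltr01; exists k0 => // k kk0.
  by rewrite ge0_fin_numE ?rho_ge0// (le_lt_trans (k0P _ kk0))// ltry.
apply/cvgrPdist_le => e e0; have [k0 k0P] := h e e0; exists k0 => // k kk0 /=.
have fk : rhoW (fun x => mollify_vec k v x - v x) \is a fin_num.
  by rewrite ge0_fin_numE ?rho_ge0// (le_lt_trans (k0P _ kk0))// ltry.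
by rewrite sub0r normrN ger0_norm ?fine_ge0 ?rho_ge0// -lee_fin fineK// k0P.
Qed.

Lemma mollifiable_shift (k0 : nat) v :
  rhoW (fun x => mollify_vec (k + k0) v x - v x) @[k --> \oo] --> 0%E -> mollifiable v.
Proof.
move=> h; pose F k := rhoW (fun x => mollify_vec k v x - v x).
suff : F @ \oo --> 0%E by [].
by rewrite -(@cvg_shiftn k0).
Qed.

Lemma mollifiable_near v (e : R) : mollifiable v -> 0 < e -> exists k0 : nat, forall k, (k0 <= k)%N ->
  (rhoW (fun x => mollify_vec k v x - v x)%R <= e%:E)%E.
Proof.
move=> /fine_cvgP[[k1 _ k1P] /cvgrPdist_le h] e0; have [k2 _ k2P] := h e e0.
exists (maxn k1 k2) => k; rewrite geq_max => /andP[/k1P kk1 /k2P /=].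
by rewrite sub0r normrN ger0_norm ?fine_ge0 ?rho_ge0// -lee_fin fineK.
Qed.

(** T v - v = T (v - v') + (T v' - v') + (v' - v): the first term is small uniformly in [k] by
    equicontinuity, the second by convergence for v', the third by the choice of v'. *)
Lemma mollifiable_limit (i : nat) v : summable_vec v -> (forall x, ~ exhaust U i x -> v x = 0) ->
  (forall e : R, 0 < e -> exists v', [/\ summable_vec v', (forall x, ~ exhaust U i x -> v' x = 0),
    mollifiable v' & (rhoW (fun x => v x - v' x)%R <= e%:E)%E]) ->
  mollifiable v.
Proof.
move=> sv v0 h; apply: mollifiable_le => e e0.
have [C C0 [k0 CP]] := mollify_small i.
pose c : R := 2 `^ PM.
have c0 : 0 < c by rewrite powR_gt0.
(* Solves c (e' + c (e' + e')) = e, which accounts for the two quasi-triangle inequalities. *)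
pose e' := e / (c * (1 + 2 * c)).
have e'0 : 0 < e' by rewrite divr_gt0// mulr_gt0// addr_gt0// mulr_gt0.
pose eta := Num.min 1 (e' / (C + 1)).
have C10 : 0 < C + 1 by rewrite ltr_wpDl.
have eta0 : 0 < eta by rewrite lt_min ltr01 divr_gt0.
have eta1 : 0 < eta <= 1 by rewrite eta0 ge_min lexx.
have etaC : eta * C <= e'.
  apply: (@le_trans _ _ (e' / (C + 1) * C)); first by rewrite ler_wpM2r// ge_min lexx orbT.
  by rewrite mulrAC ler_pdivrMr// ler_pM2l// lerDl.
pose e2 := Num.min e' (eta `^ PM).
have e20 : 0 < e2 by rewrite lt_min e'0 powR_gt0.
have [v' [sv' v'0 mv' rvv']] := h e2 e20.
have [k1 k1P] := mollifiable_near mv' e'0.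
exists (maxn k0 k1) => k; rewrite geq_max => /andP[kk0 kk1].
have sd := summable_vecB sv sv'.
have sd' := summable_vecB sv' sv.
have d0 x : ~ exhaust U i x -> v x - v' x = 0 by move=> nK; rewrite v0// v'0// subrr.
have t1 : (rhoW (mollify_vec k (fun x => v x - v' x)%R) <= e'%:E)%E.
  apply: (@le_trans _ _ (eta * C)%:E); last by rewrite lee_fin.
  apply: CP => //; apply: le_trans rvv' _; by rewrite lee_fin ge_min lexx orbT.
have t2 := k1P k kk1.
have t3 : (rhoW (fun x => v' x - v x)%R <= e'%:E)%E.
  rewrite /rhoW; under eq_fun do rewrite -opprB mulmxN nm1N.
  by apply: le_trans rvv' _; rewrite lee_fin ge_min lexx.
have E : (fun x => mollify_vec k v x - v x) = (fun x => mollify_vec k (fun x => v x - v' x) x +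
    ((mollify_vec k v' x - v' x) + (v' x - v x))).
  apply/funext => x; rewrite (@mollify_vecB k v v' x sv sv').
  by rewrite [X in _ = _ + X]addrA subrK addrA subrK.
have mm (w : Rn -> 'cV[R]_d) : summable_vec w -> measurable_mx (U : set X) (w : X -> 'cV[R]_d).
  by move=> sw; exact: summable_vec_measurable.
have mT (w : Rn -> 'cV[R]_d) : summable_vec w -> measurable_mx (U : set X) (mollify_vec k w : X -> 'cV[R]_d).
  by move=> sw; exact: mollify_vec_measurable.
have mTv' : measurable_mx (U : set X) (fun x : X => mollify_vec k v' x - v' x).
  exact: measurable_mxD (mT _ sv') (measurable_mxN (mm _ sv')).
rewrite E; apply: le_trans (rhoW_D (mT _ sd) (measurable_mxD mTv' (mm _ sd'))) _.
have t23 := le_trans (rhoW_D mTv' (mm _ sd')) (lee_wpmul2l _ (leeD t2 t3)).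
apply: (@le_trans _ _ (c%:E * (e'%:E + c%:E * (e'%:E + e'%:E)))%E).
  apply: lee_wpmul2l; first by rewrite lee_fin ltW.
  by apply: leeD; [exact: t1|apply: t23; rewrite lee_fin ltW].
rewrite -!EFinD -!EFinM lee_fin /e'.
rewrite le_eqVlt; apply/orP; left; apply/eqP; field.
by rewrite !gt_eqF// addr_gt0// mulr_gt0.
Qed.

Lemma mollifiableD v1 v2 : summable_vec v1 -> summable_vec v2 ->
  mollifiable v1 -> mollifiable v2 -> mollifiable (fun x => v1 x + v2 x).
Proof.
move=> s1 s2 m1 m2; apply: mollifiable_le => e e0.
pose c : R := 2 `^ PM.
have c0 : 0 < c by rewrite powR_gt0.
have e'0 : 0 < e / (2 * c) by rewrite divr_gt0// mulr_gt0.
have [k1 k1P] := mollifiable_near m1 e'0; have [k2 k2P] := mollifiable_near m2 e'0.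
exists (maxn k1 k2) => k; rewrite geq_max => /andP[kk1 kk2].
have -> : (fun x => mollify_vec k (fun x => v1 x + v2 x) x - (v1 x + v2 x)) =
    (fun x => (mollify_vec k v1 x - v1 x) + (mollify_vec k v2 x - v2 x)).
  by apply/funext => x; rewrite mollify_vecD// opprD addrACA.
have mT (w : Rn -> 'cV[R]_d) : summable_vec w -> measurable_mx (U : set X) (fun x : X => mollify_vec k w x - w x).
  move=> sw; apply: measurable_mxD; first exact: mollify_vec_measurable.
  by apply: measurable_mxN; exact: summable_vec_measurable.
apply: le_trans (rhoW_D (mT _ s1) (mT _ s2)) _.
apply: le_trans (lee_wpmul2l _ (leeD (k1P k kk1) (k2P k kk2))) _; first by rewrite lee_fin ltW.
rewrite -EFinD -EFinM lee_fin le_eqVlt; apply/orP; left; apply/eqP; rewrite -/c.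
by field; rewrite gt_eqF.
Qed.

Lemma mollifiableZ c v : summable_vec v -> mollifiable v -> mollifiable (fun x => c *: v x).
Proof.
move=> sv mv; apply: mollifiable_le => e e0.
pose b := Num.max 1 `|c|.
have b1 : 1 <= b by rewrite le_max lexx.
have b0 : 0 < b `^ PM by rewrite powR_gt0// (lt_le_trans ltr01).
have e'0 : 0 < e / b `^ PM by rewrite divr_gt0.
have [k0 k0P] := mollifiable_near mv e'0; exists k0 => k kk0.
have mT : measurable_mx (U : set X) (fun x : X => mollify_vec k v x - v x).
  apply: measurable_mxD; first exact: mollify_vec_measurable.
  by apply: measurable_mxN; exact: summable_vec_measurable.
have h := rhoZ_le mu mU (adm_measurable adm) (adm_ge1 adm) (adm_le adm)
    (mWv mT) (fun x _ => nm1_ge0 _) b1.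
apply: (@le_trans _ _ ((b `^ PM)%:E * (e / b `^ PM)%:E)%E); last first.
  by rewrite -EFinM lee_fin mulrC divfK// gt_eqF.
apply: le_trans (lee_wpmul2l _ (k0P k kk0)); last by rewrite lee_fin ltW.
apply: le_trans h; apply: le_rho => [//|x Ux|x Ux]; first by apply: le_trans (adm_ge1 adm Ux).
rewrite nm1_ge0/= mollify_vecZ// -scalerBr -scalemxAr nm1Z ler_wpM2r ?nm1_ge0//.
by rewrite le_max lexx orbT.
Qed.

(** Dominated convergence supplies the approximants that [mollifiable_limit] asks for; only
    approximation of the fields is needed, not of their mollifications. *)
Lemma mollifiable_dominated (i : nat) v (vs : nat -> Rn -> 'cV[R]_d) (g : X -> R) :
  summable_vec v -> (forall x, ~ exhaust U i x -> v x = 0) ->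
  (forall m, summable_vec (vs m)) -> (forall m x, ~ exhaust U i x -> vs m x = 0) ->
  (forall m, mollifiable (vs m)) -> measurable_fun (U : set X) g ->
  (rho mu P (U : set X) g < +oo)%E ->
  (forall m x, U x -> nm1 (W x *m (v x - vs m x)) <= g x) ->
  {ae mu, forall x : X, U x -> nm1 (W x *m (v x - vs m x)) @[m --> \oo] --> 0} ->
  mollifiable v.
Proof.
move=> sv v0 svs vs0 mvs mg goo vg ae0; apply: (mollifiable_limit (i := i)) => // e e0.
have mf m : measurable_fun (U : set X) (fun x : X => nm1 (W x *m (v x - vs m x))).
  by apply: mWv; apply: summable_vec_measurable; exact: summable_vecB.
have := rho_dominated mU (adm_measurable adm) (adm_ge1 adm) mf mg _ goo ae0.
move=> /(_ _)/fine_cvgP[|[k1 _ k1P] /cvgrPdist_le h].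
  by move=> m x Ux; rewrite nm1_ge0 vg.
have [k2 _ k2P] := h e e0.
pose m := maxn k1 k2; exists (vs m); split; [exact: svs|exact: vs0|exact: mvs|].
have fm := k1P m (leq_maxl _ _); have := k2P m (leq_maxr _ _).
rewrite /= sub0r normrN ger0_norm ?fine_ge0 ?rho_ge0// -lee_fin (fineK fm).
exact.
Qed.

End mollifiable.

Section modular_indicator.
Local Open Scope classical_set_scope.
Local Open Scope ring_scope.
Context d (T : measurableType d) (R : realType).
Variable mu : {measure set T -> \bar R}.

Lemma rho_indic (P : T -> R) (D K : set T) (h : T -> R) : K `<=` D ->
  (forall x, D x -> P x != 0) -> rho mu P D (fun x => \1_K x * h x) = rho mu P K h.
Proof.
move=> KD P0; rewrite /rho -[in RHS](setIidr KD) integral_mkcondr.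
apply: eq_integral => x /set_mem Dx; rewrite /patch indicE; case: ifPn => _.
  by rewrite mul1r.
by rewrite mul0r powR0// P0.
Qed.

End modular_indicator.

(** * Sets with negligible boundary *)

Section locally_constant_sets.
Local Open Scope classical_set_scope.
Local Open Scope ring_scope.
Context {R : realType} {n : nat}.
Local Notation Rn := 'cV[R]_n.+1.
Local Notation X := (lebT R n).
Local Notation mu := (leb R n).
Implicit Types E F : set Rn.

(** [x] is not a boundary point of [E]. Sets with negligible boundary are stable under finite unions
    and intersections and include the boxes; their indicators are continuous almost everywhere. *)
Definition locally_constant_at E (x : Rn) : Prop :=
  (\forall y \near x, E y) \/ (\forall y \near x, ~ E y).

Definition ae_locally_constant E : Prop := {ae mu, forall x : X, locally_constant_at E x}.

Lemma ae_locally_constantU E F : ae_locally_constant E -> ae_locally_constant F ->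
  ae_locally_constant (E `|` F).
Proof.
move=> cE cF; apply: leb_aeS (leb_aeI cE cF) => x [[Ex|nEx] [Fx|nFx]].
- by left; apply: filterS Ex => y; left.
- by left; apply: filterS Ex => y; left.
- by left; apply: filterS Fx => y; right.
- by right; apply: filterS2 nEx nFx => y nE nF [].
Qed.

Lemma ae_locally_constantI E F : ae_locally_constant E -> ae_locally_constant F ->
  ae_locally_constant (E `&` F).
Proof.
move=> cE cF; apply: leb_aeS (leb_aeI cE cF) => x [[Ex|nEx] [Fx|nFx]].
- by left; apply: filterS2 Ex Fx.
- by right; apply: filterS nFx => y nF [].
- by right; apply: filterS nEx => y nE [].
- by right; apply: filterS nEx => y nE [].
Qed.

Lemma ae_locally_constantT : ae_locally_constant setT.
Proof. by apply: aeW => x; left; exact: filterT. Qed.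

Lemma ae_locally_constant0 : ae_locally_constant set0.
Proof.
apply: aeW => x; right.
by apply: (@filterS Rn (nbhs (x : Rn)) _ setT) => [y _ []|]; exact: filterT.
Qed.

Lemma ae_locally_constant_forall (I : eqType) (s : seq I) (F : I -> set Rn) :
  (forall i, ae_locally_constant (F i)) ->
  ae_locally_constant [set x | forall i, i \in s -> F i x].
Proof.
move=> cF; elim: s => [|i s IH].
  rewrite (_ : [set _ | _] = setT); first exact: ae_locally_constantT.
  by apply/seteqP; split=> x // _ i; rewrite in_nil.
rewrite (_ : [set _ | _] = F i `&` [set x | forall i, i \in s -> F i x]).
  exact: ae_locally_constantI.
apply/seteqP; split => [x h|x [h1 h2] j]; last by rewrite inE => /predU1P[->//|/h2].
by split=> [|j js]; apply: h; rewrite inE ?eqxx// js orbT.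
Qed.

Lemma ae_locally_constant_exists (N : nat) (F : nat -> set Rn) :
  (forall i, ae_locally_constant (F i)) ->
  ae_locally_constant [set x | exists2 k, (k < N)%N & F k x].
Proof.
move=> cF; elim: N => [|N IH].
  rewrite (_ : [set _ | _] = set0); first exact: ae_locally_constant0.
  by apply/seteqP; split => x // -[].
rewrite (_ : [set _ | _] = F N `|` [set x | exists2 k, (k < N)%N & F k x]).
  exact: ae_locally_constantU.
apply/seteqP; split => [x [k]|x [h|[k kN h]]].
- by rewrite ltnS leq_eqVlt => /predU1P[->|kN] h; [left|right; exists k].
- by exists N.
- by exists k => //; rewrite ltnS ltnW.
Qed.

Let near_coord (x : Rn) i (D : set R) : open D -> D (x i 0) -> \forall y \near x, D ((y : Rn) i 0).
Proof.
move=> oD Dx; apply: (@coord_continuous R _ _ i 0 x).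
exact: open_nbhs_nbhs.
Qed.

(** Each condition a_i < x_i <= b_i is locally constant off the two hyperplanes x_i = a_i and x_i =
    b_i. *)
Lemma ae_locally_constant_box (ab : Rn * Rn) : ae_locally_constant (box ab).
Proof.
pose S i := [set x : X | ab.1 i 0 < x i 0 <= ab.2 i 0].
have -> : box ab = [set x | forall i, i \in enum 'I_n.+1 -> S i x].
  by apply/seteqP; split => x h i => [_|]; [exact: h|apply: h; rewrite mem_enum].
have all0 i : ae_locally_constant (S i : set Rn).
  have h1 : (leb R n).-negligible ([set x : X | x i 0 = ab.1 i 0] `|` [set x : X | x i 0 = ab.2 i 0]).
    apply: negligibleU.
      exists [set x : X | x i 0 = ab.1 i 0]; split => //; last exact: leb_hyperplane.
      by have := measurable_fun_coord i measurableT (@measurable_set1 R (ab.1 i 0)); rewrite setTI.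
    exists [set x : X | x i 0 = ab.2 i 0]; split => //; last exact: leb_hyperplane.
    by have := measurable_fun_coord i measurableT (@measurable_set1 R (ab.2 i 0)); rewrite setTI.
  apply: negligibleS h1 => x /= nc; apply: contrapT => /not_orP[/= x1 x2]; apply: nc.
  have [xa|xa] := ltP (ab.1 i 0) (x i 0); last first.
    right; have {}xa : x i 0 < ab.1 i 0 by rewrite lt_neqAle xa andbT; apply/eqP.
    apply: filterS (near_coord (@open_lt R (ab.1 i 0)) xa) => y /= ya /andP[].
    by rewrite ltNge (ltW ya).
  have [xb|xb] := leP (x i 0) (ab.2 i 0).
    left; have {}xb : x i 0 < ab.2 i 0 by rewrite lt_neqAle xb andbT; apply/eqP.
    apply: filterS2 (near_coord (@open_gt R (ab.1 i 0)) xa) (near_coord (@open_lt R (ab.2 i 0)) xb).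
    by move=> y /= ya yb; rewrite /S/= ya ltW.
  right; apply: filterS (near_coord (@open_gt R (ab.2 i 0)) xb) => y /= yb /andP[_].
  by rewrite leNgt yb.
exact: ae_locally_constant_forall.
Qed.

End locally_constant_sets.

(** * Convergence for bounded, almost everywhere continuous fields *)

Section mollification_converges.
Local Open Scope classical_set_scope.
Local Open Scope ring_scope.
Context {R : realType} {n : nat}.
Local Notation Rn := 'cV[R]_n.+1.
Local Notation X := (lebT R n).
Local Notation mu := (leb R n).
Variables (d : nat) (P : Rn -> R) (W : Rn -> 'M[R]_d) (U : set Rn) (PM : R).
Hypothesis adm : admissible P W U PM.

Let oU := adm_open adm.
Let mU : measurable (U : set X). Proof. exact: open_measurable_leb oU. Qed.
Let rhoW (v : Rn -> 'cV[R]_d) : \bar R := rho mu P (U : set X) (fun x : X => nm1 (W x *m v x)).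
Local Notation mollifiable := (mollifiable P W U).

Definition bounded_on (i : nat) (C : R) (u : Rn -> R) : Prop :=
  [/\ measurable_fun setT (u : X -> R), forall x, `|u x| <= C &
      forall x, ~ exhaust U i x -> u x = 0].

Lemma bounded_on_summable i C u : bounded_on i C u -> summable u.
Proof. by case=> mu_ uC u0; exact: (summable_compact_supp (@exhaust_compact R n U i) mu_ uC u0). Qed.

Lemma summable_vec_coord (j : 'I_d) (u : Rn -> R) : summable u ->
  summable_vec (fun x => u x *: delta_mx j 0 : 'cV[R]_d).
Proof.
move=> su i; have := summableZ ((i == j)%:R) su; congr summable.
by apply/funext => x; rewrite !mxE eqxx andbT mulrC.
Qed.

Lemma mollify_vec_coord k (j : 'I_d) (u : Rn -> R) x : summable u ->
  mollify_vec k (fun x => u x *: delta_mx j 0 : 'cV[R]_d) x = mollify k u x *: delta_mx j 0.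
Proof.
move=> su; apply/matrixP => i l; rewrite !mxE ord1 eqxx andbT mulrC.
rewrite -(convZ ((i == j)%:R) x (mollifier_test k) su); congr conv.
by apply/funext => y; rewrite !mxE eqxx andbT mulrC.
Qed.

Lemma nm1_mul_coord (A : 'M[R]_d) (c : R) (j : 'I_d) :
  nm1 (A *m (c *: delta_mx j 0 : 'cV[R]_d)) <= `|c| * nm1 A.
Proof.
rewrite -scalemxAr nm1Z ler_wpM2l// -colE [leRHS]nm1_cols (bigD1 j)//= lerDl.
by apply: sumr_ge0 => k _; exact: nm1_ge0.
Qed.

(** The dominating function for fields bounded by [C] and supported in level [i]; its modular is
    finite because |W|^P is integrable on compact levels. *)
Let dom i (C : R) (x : X) := \1_(exhaust U i) x * (C * nm1 (W x)).

Let mdom i C : measurable_fun (U : set X) (dom i C).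
Proof.
apply: measurable_funM; first by apply: measurable_indic; exact: exhaust_measurable.
apply: measurable_funM; first exact: measurable_cst.
exact: measurable_nm1 (adm_weight adm).
Qed.

Let dom_lty i C : 0 <= C -> (rho mu P (U : set X) (dom i C) < +oo)%E.
Proof.
move=> C0; have KU := @exhaust_sub R n U i.
rewrite (@rho_indic _ X R mu P U (exhaust U i) _ KU); last first.
  by move=> x /(adm_ge1 adm) h; rewrite gt_eqF// (lt_le_trans _ h).
have mK : measurable (exhaust U i : set X) by exact: exhaust_measurable.
have mW : measurable_fun (exhaust U i : set X) (fun x : X => nm1 (W x)).
  exact: measurable_nm1 (adm_weightS adm KU).
have P1 x : exhaust U i x -> 1 <= P x by move=> /KU; exact: adm_ge1 adm x.
have PPM x : exhaust U i x -> P x <= PM by move=> /KU; exact: adm_le adm x.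
have c1 : 1 <= Num.max 1 C by rewrite le_max lexx.
apply: (@le_lt_trans _ _ (rho mu P (exhaust U i : set X) (fun x : X => Num.max 1 C * nm1 (W x))%R)).
  apply: le_rho => [//|x /P1|x _]; first by apply: le_trans.
  by rewrite mulr_ge0 ?nm1_ge0//= ler_wpM2r ?nm1_ge0// le_max lexx orbT.
apply: le_lt_trans (rhoZ_le mu mK (adm_measurableS adm KU) P1 PPM mW (fun x _ => nm1_ge0 _) c1) _.
apply: lte_mul_pinfty; [by rewrite lee_fin powR_ge0|by []|].
exact: weight_compact_lty adm i.
Qed.

Let dom_ge i (C c : R) (A : 'cV[R]_d) (x : Rn) (j : 'I_d) : (~ exhaust U i x -> c = 0) ->
  `|c| <= C -> A = c *: delta_mx j 0 -> nm1 (W x *m A) <= dom i C x.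
Proof.
move=> c0 cC ->; rewrite /dom; have [Kx|nKx] := pselect (exhaust U i x); last first.
  by rewrite c0// scale0r mulmx0 nm1_0 indicE memNset// mul0r.
rewrite indicE mem_set// mul1r (le_trans (nm1_mul_coord _ _ _))//.
by rewrite ler_wpM2r ?nm1_ge0.
Qed.

Let nm1_cvg0 (j : 'I_d) (A : 'M[R]_d) (c : nat -> R) : c m @[m --> \oo] --> 0 ->
  nm1 (A *m (c m *: delta_mx j 0 : 'cV[R]_d)) @[m --> \oo] --> 0.
Proof.
move=> c0; have h : `|c m| * nm1 A @[m --> \oo] --> 0.
  rewrite -(mul0r (nm1 A)) -(@normr0 _ R); apply: cvgM; last exact: cvg_cst.
  exact: cvg_norm.
apply: (squeeze_cvgr _ (cvg_cst 0) h).
by apply: nearW => m; rewrite nm1_ge0 nm1_mul_coord.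
Qed.

(** Here the mollifications converge almost everywhere and are bounded on a common compact set, so
    that dominated convergence suffices. *)
Lemma mollifiable_continuous i C u (j : 'I_d) : bounded_on i C u ->
  {ae mu, forall x : X, {for (x : Rn), continuous u}} ->
  mollifiable (fun x => u x *: delta_mx j 0).
Proof.
move=> bu cu; have su := bounded_on_summable bu; have [mu_ uC u0] := bu.
have C0 : 0 <= C by exact: le_trans (normr_ge0 _) (uC 0).
have sv := summable_vec_coord j su.
(* From this scale on supports grow by one level at most; the shift does not affect convergence. *)
pose k0 := (i.+1 * i.+2)%N.
pose f m (x : X) := nm1 (W x *m (mollify_vec (m + k0)%N (fun x => u x *: delta_mx j 0) x - u x *: delta_mx j 0)).
have fE m (x : Rn) : mollify_vec (m + k0)%N (fun x => u x *: delta_mx j 0) x - u x *: delta_mx j 0 =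
    (mollify (m + k0)%N u x - u x) *: delta_mx j 0 :> 'cV[R]_d.
  by rewrite mollify_vec_coord// -scalerBl.
have mf m : measurable_fun (U : set X) (f m).
  apply: measurable_nm1; apply: measurable_mxM (adm_weight adm) _.
  apply: measurable_mxD; first exact: mollify_vec_measurable.
  by apply: measurable_mxN; exact: summable_vec_measurable sv.
have fg m (x : X) : U x -> 0 <= f m x <= dom i.+1 (C + C) x.
  move=> Ux; rewrite nm1_ge0/=; apply: dom_ge (fE m x) => [nK|].
    rewrite (mollify_exhaust_eq0 (leq_addl _ _) u0 nK) u0 ?subr0// => Kx.
    by apply: nK; exact: exhaust_mono (leqnSn i) _ Kx.
  by rewrite (le_trans (ler_normB _ _))// lerD// mollify_le.
have ae0 : {ae mu, forall x : X, U x -> f m x @[m --> \oo] --> 0}.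
  apply: leb_aeS cu => x cx Ux; rewrite /f; under eq_fun do rewrite fE.
  apply: nm1_cvg0; rewrite -(subrr (u x)); apply: cvgB; last exact: cvg_cst.
  exact: (cvg_comp _ (fun m => mollify m u x) (@cvg_addnr k0) (mollify_cvg su cx)).
have CC : 0 <= C + C by rewrite addr_ge0.
have := rho_dominated mU (adm_measurable adm) (adm_ge1 adm) mf (mdom i.+1 (C + C)) fg
  (dom_lty i.+1 CC) ae0.
exact: mollifiable_shift.
Qed.

Lemma mollifiable_bounded_limit i C u us (j : 'I_d) : bounded_on i C u ->
  (forall m, bounded_on i C (us m)) ->
  (forall m, mollifiable (fun x => us m x *: delta_mx j 0)) ->
  {ae mu, forall x : X, us m x @[m --> \oo] --> u x} ->
  mollifiable (fun x => u x *: delta_mx j 0).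
Proof.
move=> bu bus mus ae0; have [mu_ uC u0] := bu.
have C0 : 0 <= C by exact: le_trans (normr_ge0 _) (uC 0).
have CC : 0 <= C + C by rewrite addr_ge0.
apply: (@mollifiable_dominated _ _ _ _ _ _ _ adm i _ (fun m x => us m x *: delta_mx j 0) (dom i (C + C))).
- exact: summable_vec_coord (bounded_on_summable bu).
- by move=> x /u0 ->; rewrite scale0r.
- by move=> m; exact: summable_vec_coord (bounded_on_summable (bus m)).
- by move=> m x; have [_ _ h] := bus m => /h ->; rewrite scale0r.
- exact: mus.
- exact: mdom.
- exact: dom_lty.
- move=> m x Ux; have [_ mC m0] := bus m.
  apply: dom_ge (esym (scalerBl _ _ _)) => [nK|]; first by rewrite u0// m0// subrr.
  by rewrite (le_trans (ler_normB _ _))// lerD.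
- apply: leb_aeS ae0 => x ux Ux; under eq_fun do rewrite -scalerBl.
  by apply: nm1_cvg0; rewrite -(subrr (u x)); apply: cvgB => //; exact: cvg_cst.
Qed.

Lemma locally_constant_continuous (E : set Rn) x : locally_constant_at E x ->
  {for x, continuous (\1_E : Rn -> R)}.
Proof.
move=> h; apply: continuous_atP => e e0.
have : \forall y \near x, \1_E x = \1_E y :> R.
  case: h => hE; have Ex := nbhs_singleton hE.
    by apply: filterS hE => y Ey; rewrite !indicE !mem_set.
  by apply: filterS hE => y Ey; rewrite !indicE !memNset.
move=> /nbhs_ballP[r /= r0 xr]; exists r => // y xy.
have -> : \1_E x = \1_E y :> R by apply: xr; rewrite -ball_normE.
by rewrite subrr normr0 ltW.
Qed.

(** A finite union of boxes may leave [U]; the cutoff brings the support back into a compact level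
    and, being smooth, keeps the product continuous almost everywhere. *)
Lemma mollifiable_cutoff_indic i (E : set Rn) (j : 'I_d) : measurable (E : set X) ->
  ae_locally_constant E ->
  bounded_on i.+2 1 (fun x => cutoff U i x * \1_E x) /\
  mollifiable (fun x => (cutoff U i x * \1_E x) *: delta_mx j 0).
Proof.
move=> mE cE; have tc := cutoff_test U i.
have b : bounded_on i.+2 1 (fun x => cutoff U i x * \1_E x).
  split.
  - apply: measurable_funM; first exact: test_function_measurable tc.
    exact: measurable_indic.
  - move=> x; rewrite normrM ger0_norm ?cutoff_ge0//.
    by apply: mulr_ile1; rewrite ?cutoff_ge0 ?cutoff_le1// indicE normr_nat lern1 leq_b1.
  - by move=> x /cutoff_eq0 ->; rewrite mul0r.
split=> //; apply: mollifiable_continuous b _; apply: leb_aeS cE => x cx.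
apply: continuousM; last exact: locally_constant_continuous.
by have [sc _ _] := tc; exact: smooth_on_continuous sc I.
Qed.

Lemma indic_cvg (T : Type) (E : nat -> set T) (F : set T) x :
  (\forall m \near \oo, E m x <-> F x) -> (\1_(E m) x : R) @[m --> \oo] --> (\1_F x : R).
Proof.
move=> h; apply: cvg_near_cst; apply: filterS h => m EF; rewrite !indicE.
by congr (nat_of_bool _)%:R; apply/idP/idP; rewrite !inE => /EF.
Qed.

End mollification_converges.

(** * From boxes to arbitrary fields *)

Section mollification_converges_general.
Local Open Scope classical_set_scope.
Local Open Scope ring_scope.
Context {R : realType} {n : nat}.
Local Notation Rn := 'cV[R]_n.+1.
Local Notation X := (lebT R n).
Local Notation mu := (leb R n).

(** The definition of the outer measure provides, for every [l], a cover by boxes of total volume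
    less than mu A + 1/(l+1); the intersection of these covers exceeds [A] by a null set. *)
Lemma box_covers (A : set X) : measurable A -> (mu A < +oo)%E ->
  exists B : nat -> nat -> Rn * Rn, (forall l, A `<=` \bigcup_k box (B l k)) /\
    mu ((\bigcap_l \bigcup_k box (B l k)) `\` A) = 0%E.
Proof.
move=> mA Aoo; have fA : mu A \is a fin_num by rewrite ge0_fin_numE.
have ex l : exists B : nat -> Rn * Rn, A `<=` \bigcup_k box (B k) /\
    (mu (\bigcup_k box (B k)) <= mu A + (l.+1%:R^-1)%:E)%E.
  have l0 : 0 < l.+1%:R^-1 :> R by rewrite invr_gt0.
  have [_ [B AB <-] Bl] := lb_ereal_inf_adherent l0 fA.
  exists B; split => //; apply: le_trans (ltW Bl).
  apply: le_trans (leb_outer_sigma_subadditive _) _.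
  by apply: lee_nneseries => [k _ _|k _]; [exact: leb_outer_ge0|rewrite leb_outer_box].
have [B BP] := choice ex; exists B; split => [l|]; first by have [] := BP l.
have mG l : measurable (\bigcup_k box (B l k) : set X).
  by apply: bigcupT_measurable => k; exact: measurable_box.
apply/eqP; rewrite eq_le measure_ge0 andbT; apply/lee_addgt0Pr => e e0; rewrite add0e.
have [l le] : exists l, l.+1%:R^-1 < e.
  by have [l] := ltr_add_invr e0; rewrite add0r => h; exists l.
have [AG Gl] := BP l.
apply: (@le_trans _ _ (mu ((\bigcup_k box (B l k)) `\` A))).
  by apply: le_leb_outer => x [h nA]; split => //; exact: h.
rewrite (measureD (mG l) mA); last by rewrite (le_lt_trans Gl)// lte_add_pinfty// ltry.
rewrite (setIidr AG) leeBlDl// (le_trans Gl)// leeD2l// lee_fin.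
exact: ltW.
Qed.

Variables (d : nat) (P : Rn -> R) (W : Rn -> 'M[R]_d) (U : set Rn) (PM : R).
Hypothesis adm : admissible P W U PM.
Local Notation mollifiable_at := mollifiable.
Local Notation mollifiable := (mollifiable P W U).
Local Notation bounded_on := (bounded_on U).

Lemma indic_bounded_on i (A : set X) : measurable A -> A `<=` exhaust U i ->
  bounded_on i 1 \1_A.
Proof.
move=> mA Ai; split; first exact: measurable_indic.
  by move=> x; rewrite indicE normr_nat lern1 leq_b1.
by move=> x nK; rewrite indicE memNset// => /Ai.
Qed.

(** Two limits: [D m N], a finite intersection of finite unions of boxes, increases to [H m] as [N]
    grows, and [H m] decreases to a set equal to [A] up to a null set. The cutoff, which is 1 on
    level [i], keeps all supports in one compact level. *)
Lemma mollifiable_indic i (A : set X) (j : 'I_d) : measurable A -> A `<=` exhaust U i ->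
  mollifiable (fun x => \1_A x *: delta_mx j 0).
Proof.
move=> mA Ai.
have Aoo : (mu A < +oo)%E.
  by apply: le_lt_trans (compact_leb_lty (@exhaust_compact R n U i)); exact: le_leb_outer.
have [B [AB B0]] := box_covers mA Aoo.
pose D m N : set Rn := [set x | forall l, l \in iota 0 m -> exists2 k, (k < N)%N & box (B l k) x].
pose H m : set Rn := [set x | forall l, l \in iota 0 m -> exists k, box (B l k) x].
have mD m N : measurable (D m N : set X).
  rewrite (_ : D m N = \bigcap_(l in [set l | l \in iota 0 m])
      \bigcup_(k in [set k | (k < N)%N]) box (B l k)); last first.
    by apply/seteqP; split => x h l /h [k kN kx]; exists k.
  by apply: bigcap_measurableType => l _; apply: bigcup_measurable => k _; exact: measurable_box.
have mH m : measurable (H m : set X).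
  rewrite (_ : H m = \bigcap_(l in [set l | l \in iota 0 m]) \bigcup_k box (B l k)); last first.
    apply/seteqP; split => x h l /h; first by move=> [k kx]; exists k.
    by move=> [k _ kx]; exists k.
  by apply: bigcap_measurableType => l _; apply: bigcupT_measurable => k; exact: measurable_box.
have cD m N : ae_locally_constant (D m N).
  apply: ae_locally_constant_forall => l; apply: ae_locally_constant_exists => k.
  exact: ae_locally_constant_box.
have DH m x : \forall N \near \oo, D m N x <-> H m x.
  have [Hx|nHx] := pselect (H m x); last first.
    apply: nearW => N; split => // Dx; exfalso; apply: nHx => l /Dx[k _ kx].
    by exists k.
  have ex l : exists k, l \in iota 0 m -> box (B l k) x.
    have [lm|//] := boolP (l \in iota 0 m); last by exists 0%N.
    by have [k kx] := Hx l lm; exists k.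
  have [f fP] := choice ex.
  exists (\max_(l < m) (f l).+1) => // N /= fN; split => // _ l lm.
  exists (f l); last exact: fP.
  move: (lm); rewrite mem_iota add0n => /andP[_ lm'].
  by rewrite (leq_trans _ fN)// (leq_bigmax (Ordinal lm')).
have bE (E : set X) : measurable E -> bounded_on i.+2 1 (fun x => cutoff U i x * \1_E x).
  move=> mE; split.
  - apply: measurable_funM; first exact: test_function_measurable (cutoff_test U i).
    exact: measurable_indic.
  - move=> x; rewrite normrM ger0_norm ?cutoff_ge0//.
    by apply: mulr_ile1; rewrite ?cutoff_ge0 ?cutoff_le1// indicE normr_nat lern1 leq_b1.
  - by move=> x /cutoff_eq0 ->; rewrite mul0r.
have molH m : mollifiable (fun x => (cutoff U i x * \1_(H m) x) *: delta_mx j 0).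
  apply: (mollifiable_bounded_limit adm (bE _ (mH m)) (fun N => bE _ (mD m N))).
    by move=> N; have [] := mollifiable_cutoff_indic adm i j (mD m N) (cD m N).
  apply: aeW => x; apply: cvgM; first exact: cvg_cst.
  exact: indic_cvg (DH m x).
have bA : bounded_on i.+2 1 \1_A.
  apply: indic_bounded_on => // x /Ai; apply: exhaust_mono; exact: leqW.
apply: (mollifiable_bounded_limit adm bA (fun m => bE _ (mH m)) molH).
exists ((\bigcap_l \bigcup_k box (B l k)) `\` A); split => //.
  apply: measurableD => //; apply: bigcapT_measurable => l.
  by apply: bigcupT_measurable => k; exact: measurable_box.
move=> x /= ncvg; apply: contrapT => /not_andP nx; apply: ncvg.
have [Ax|nAx] := pselect (A x).
  apply: cvg_near_cst; apply: nearW => m.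
  rewrite cutoff_eq1 ?mul1r; last exact: Ai.
  rewrite !indicE !mem_set// => l _; have [k _ kx] := AB l x Ax; by exists k.
have [//|nA] := nx; last by exfalso; apply: nA.
move=> /existsNP[l /not_implyP[_ nl]].
apply: cvg_near_cst; exists l.+1 => // m /= lm.
rewrite !indicE !memNset ?mulr0// => Hx; apply: nl.
by have [|k kx] := Hx l; [rewrite mem_iota|exists k].
Qed.

Lemma mollifiable_indic_sum i (I : Type) (r : seq I) (c : R) (A : I -> set X) (j : 'I_d) :
  (forall k, measurable (A k)) -> (forall k, A k `<=` exhaust U i) ->
  mollifiable (fun x => (\sum_(k <- r) c * \1_(A k) x) *: delta_mx j 0).
Proof.
move=> mA Ai; have s1 k : summable (\1_(A k) : Rn -> R).
  exact: bounded_on_summable (indic_bounded_on (mA k) (Ai k)).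
have sI k : summable_vec (fun x => \1_(A k) x *: delta_mx j 0 : 'cV[R]_d).
  exact: summable_vec_coord.
have ss r' : summable (fun x : Rn => \sum_(k <- r') c * \1_(A k) x).
  by have [] := mollify_lin 0 r' (fun=> c) 0 s1.
elim: r => [|k r IH].
  have := mollifiable_indic (i := i) j (@measurable0 _ X) (@sub0set _ _).
  by congr mollifiable_at; apply/funext => x; rewrite big_nil indicE in_set0.
rewrite (_ : (fun x => _) = (fun x : Rn => c *: (\1_(A k) x *: delta_mx j 0) +
    (\sum_(k <- r) c * \1_(A k) x) *: delta_mx j 0 : 'cV[R]_d)); last first.
  by apply/funext => x; rewrite big_cons scalerDl scalerA.
apply: (mollifiableD adm (summable_vecZ c (sI k)) (summable_vec_coord j (ss r)) _ IH).
have mi := mollifiable_indic j (mA k) (Ai k).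
have mi2 := mollifiableZ adm c (sI k) mi.
exact: mi2.
Qed.

Let sum_threshold (M q : nat) : (q <= M)%N -> \sum_(k < M) (k < q)%N%:R = q%:R :> R.
Proof.
move=> qM; rewrite -natr_sum; congr _%:R.
rewrite (eq_bigr (fun k : 'I_M => if (k < q)%N then 1%N else 0%N)); last by move=> k _; case: ltnP.
by rewrite -big_mkcond/= -(big_ord_widen M (fun=> 1%N) qM) sum1_card card_ord.
Qed.

(** [us N] is [u] rounded down to a multiple of 1/(N+1). Counting the thresholds k+1 <= (N+1) u
    writes it as a sum of indicators of the sets [A N k], the number of terms being fixed by the
    bound [C]. *)
Lemma mollifiable_bounded_ge0 i C u (j : 'I_d) : bounded_on i C u -> (forall x, 0 <= u x) ->
  mollifiable (fun x => u x *: delta_mx j 0).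
Proof.
move=> bu u_ge0; have [mu_ uC u0] := bu.
have C0 : 0 <= C by exact: le_trans (normr_ge0 _) (uC 0).
pose A (N k : nat) : set X := [set x : X | k.+1%:R <= N.+1%:R * u x].
pose M N := Num.truncn (N.+1%:R * C).
pose us N (x : Rn) : R := \sum_(k < M N) N.+1%:R^-1 * \1_(A N k) x.
have mA N k : measurable (A N k).
  rewrite (_ : A N k = setT `&` (fun x : X => N.+1%:R * u x) @^-1` `[k.+1%:R, +oo[); last first.
    by apply/seteqP; split => x; rewrite /A/= in_itv/= andbT// => -[].
  have mNu : measurable_fun setT (fun x : X => N.+1%:R * u x).
    exact: measurable_funM (measurable_cst _) mu_.
  exact: mNu measurableT _ (measurable_itv _).
have Ai N k : A N k `<=` exhaust U i.
  move=> x; rewrite /A/= => h; apply: contrapT => /u0 ux0; move: h.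
  by rewrite ux0 mulr0 leNgt ltr0n.
have usE N x : us N x = (Num.truncn (N.+1%:R * u x))%:R / N.+1%:R.
  rewrite /us -mulr_sumr mulrC; congr (_ / _).
  have ux : 0 <= N.+1%:R * u x by rewrite mulr_ge0.
  rewrite -(@sum_threshold (M N) (Num.truncn (N.+1%:R * u x))); last first.
    by apply: le_truncn; rewrite ler_wpM2l// (le_trans (ler_norm _)).
  apply: eq_bigr => k _; rewrite indicE; congr (nat_of_bool _)%:R.
  by rewrite truncn_gt_nat; apply/idP/idP; rewrite inE.
have us_le N x : 0 <= us N x <= u x.
  rewrite usE divr_ge0//= ler_pdivrMr// mulrC truncn_le//.
  by rewrite mulr_ge0.
have us_ge N x : u x - N.+1%:R^-1 <= us N x.
  rewrite usE lerBlDr -[X in _ <= _ + X]mul1r -mulrDl ler_pdivlMr// mulrC natr1.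
  exact/ltW/truncnS_gt.
have bus N : bounded_on i C (us N).
  split.
  - by apply: measurable_sum => k; apply: measurable_funM => //; exact: measurable_indic.
  - move=> x; have /andP[h1 h2] := us_le N x; rewrite ger0_norm//.
    by rewrite (le_trans h2)// (le_trans (ler_norm _)).
  - by move=> x /u0 ux0; have := us_le N x; rewrite ux0 => h; apply/eqP; rewrite eq_le andbC.
apply: (mollifiable_bounded_limit adm bu bus).
  by move=> N; exact: (mollifiable_indic_sum (index_enum 'I_(M N)) N.+1%:R^-1 j (fun k => mA N k) (fun k => Ai N k)).
apply: aeW => x; have hN : u x - N.+1%:R^-1 @[N --> \oo] --> u x.
  rewrite -[X in _ --> X]subr0; apply: cvgB; first exact: cvg_cst.
  exact: cvg_harmonic.
apply: (squeeze_cvgr _ hN (cvg_cst (u x))).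
by apply: nearW => N; rewrite us_ge; have /andP[] := us_le N x.
Qed.

Lemma mollifiable_bounded i C u (j : 'I_d) : bounded_on i C u ->
  mollifiable (fun x => u x *: delta_mx j 0).
Proof.
move=> [mu_ uC u0].
have bp (w : Rn -> R) : measurable_fun setT (w : X -> R) -> (forall x, `|w x| = `|u x|) ->
    bounded_on i C (fun x => Num.max (w x) 0).
  move=> mw wu; split.
  - by apply: measurable_maxr => //; exact: measurable_cst.
  - move=> x; apply: le_trans (uC x); rewrite -wu ger0_norm ?le_max ?lexx ?orbT//.
    by rewrite ge_max ler_norm normr_ge0.
  - move=> x /u0 ux; have := wu x; rewrite ux normr0 => /eqP; rewrite normr_eq0 => /eqP ->.
    by rewrite maxxx.
have b1 := bp u mu_ (fun x => erefl).
have b2 : bounded_on i C (fun x => Num.max (- u x) 0).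
  by apply: bp => [|x]; [exact: measurable_funN|rewrite normrN].
have g1 (w : Rn -> R) x : 0 <= Num.max (w x) 0 by rewrite le_max lexx orbT.
have m1 := mollifiable_bounded_ge0 j b1 (g1 u).
have m2 := mollifiable_bounded_ge0 j b2 (g1 (fun x => - u x)).
have s1 := summable_vec_coord j (bounded_on_summable b1).
have s2 := summable_vec_coord j (bounded_on_summable b2).
have := mollifiableD adm s1 (summable_vecZ (-1) s2) m1 (mollifiableZ adm (-1) s2 m2).
congr mollifiable_at; apply/funext => x; rewrite scalerA -scalerDl; congr (_ *: _).
by rewrite mulN1r /Num.max; case: ltP => h1; case: ltP => h2; lra.
Qed.

Lemma mollifiable_bounded_vec i C (v : Rn -> 'cV[R]_d) :
  (forall j, bounded_on i C (fun x => v x j 0)) -> mollifiable v.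
Proof.
move=> bv; have svj j := summable_vec_coord j (bounded_on_summable (bv j)).
suff h (r : seq 'I_d) : summable_vec (fun x => \sum_(j <- r) v x j 0 *: delta_mx j 0 : 'cV[R]_d) /\
    mollifiable (fun x => \sum_(j <- r) v x j 0 *: delta_mx j 0).
  have [_] := h (index_enum 'I_d); congr mollifiable_at; apply/funext => x.
  apply/matrixP => a b; rewrite ord1 summxE (bigD1 a)//= !mxE !eqxx mulr1 big1 ?addr0// => j ja.
  by rewrite !mxE eq_sym (negbTE ja) mulr0.
elim: r => [|j r [sr mr]].
  have z : (fun x : Rn => \sum_(j <- [::]) v x j 0 *: delta_mx j 0 : 'cV[R]_d) = (fun=> 0).
    by apply/funext => x; rewrite big_nil.
  rewrite z; have sz : summable_vec ((fun=> 0) : Rn -> 'cV[R]_d).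
    move=> a; have h0 : summable (\1_set0 : Rn -> R).
      by apply: summable_indic; [exact: measurable0|rewrite measure0 ltry].
    suff E : (\1_set0 : Rn -> R) = (fun=> (0 : 'cV[R]_d) a 0) by rewrite -E.
    by apply/funext => x; rewrite indicE in_set0 mxE.
  split=> //; apply: mollifiable_le => e e0; exists 0%N => k _.
  rewrite /rho integral0_eq ?lee_fin ?(ltW e0)// => x Ux.
  rewrite subr0 (_ : mollify_vec k _ x = 0) ?mulmx0 ?nm1_0 ?powR0//.
    by rewrite gt_eqF// (lt_le_trans _ (adm_ge1 adm Ux)).
  by apply/matrixP => a b; rewrite !mxE; apply: mollify_eq0.
have E : (fun x : Rn => \sum_(j <- j :: r) v x j 0 *: delta_mx j 0 : 'cV[R]_d) =
   (fun x => v x j 0 *: delta_mx j 0 + \sum_(j <- r) v x j 0 *: delta_mx j 0).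
  by apply/funext => x; rewrite big_cons.
rewrite E; split; first exact: summable_vecD.
have m1 := mollifiable_bounded j (bv j).
have m2 := mollifiableD adm (svj j) sr m1 mr.
exact: m2.
Qed.

(** Setting [v] to zero where |v| > m leaves a difference that is 0 or [v] itself, so that |W v|, of
    finite modular, dominates. *)
Theorem mollify_converges i (v : Rn -> 'cV[R]_d) : summable_vec v ->
  (forall x, ~ exhaust U i x -> v x = 0) ->
  (rho mu P (U : set X) (fun x : X => nm1 (W x *m v x)) < +oo)%E -> mollifiable v.
Proof.
move=> sv v0 voo.
pose A m : set X := [set x : X | nm1 (v x) <= m%:R].
have mnv : measurable_fun setT (fun x : X => nm1 (v x)).
  by apply: measurable_nm1; exact: summable_vec_measurable.
have mA m : measurable (A m).
  rewrite (_ : A m = setT `&` (fun x : X => nm1 (v x)) @^-1` `]-oo, m%:R]); last first.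
    by apply/seteqP; split => x; rewrite /A/= in_itv// => -[].
  exact: mnv measurableT _ (measurable_itv _).
pose vs m (x : Rn) := \1_(A m) x *: v x.
have bvs m j : bounded_on i m%:R (fun x => vs m x j 0).
  split.
  - under eq_fun do rewrite mxE; apply: measurable_funM; first exact: measurable_indic.
    exact: summable_measurable (sv j).
  - move=> x; rewrite mxE normrM indicE normr_nat.
    have [Ax|nAx] := pselect (A m x); last by rewrite memNset// mul0r.
    by rewrite mem_set// mul1r (le_trans (nm1_entry _ _ _)).
  - by move=> x /v0 vx; rewrite mxE vx mxE mulr0.
have mU := open_measurable_leb (adm_open adm).
apply: (@mollifiable_dominated _ _ _ _ _ _ _ adm i _ vs (fun x : X => nm1 (W x *m v x))) => //.
- by move=> m j; exact: bounded_on_summable (bvs m j).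
- by move=> m x /v0 vx; rewrite /vs vx scaler0.
- by move=> m; exact: mollifiable_bounded_vec (bvs m).
- apply: measurable_nm1; apply: measurable_mxM (adm_weight adm) _.
  exact: summable_vec_measurable.
- move=> m x Ux; rewrite /vs indicE; case: (x \in A m).
    by rewrite scale1r subrr mulmx0 nm1_0 nm1_ge0.
  by rewrite scale0r subr0.
apply: aeW => x Ux; apply: cvg_near_cst.
exists (Num.truncn (nm1 (v x))).+1 => // m /= xm.
rewrite /vs indicE mem_set ?scale1r ?subrr ?mulmx0 ?nm1_0// /A/=.
by rewrite (le_trans (ltW (truncnS_gt _)))// ler_nat.
Qed.

End mollification_converges_general.

(** * Uniqueness of weak derivatives *)

Section weak_derivative_unique.
Local Open Scope classical_set_scope.
Local Open Scope ring_scope.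
Context {R : realType} {n : nat}.
Local Notation Rn := 'cV[R]_n.+1.
Local Notation X := (lebT R n).
Local Notation mu := (leb R n).
Implicit Types (U : set Rn).

(** In this case the modular is an L^1 norm, and the convergence theorem specializes to convergence
    of mollifications in L^1, from which uniqueness follows. *)
Lemma admissible_unweighted d U : open U -> admissible (fun=> 1) (fun=> 1%:M : 'M[R]_d) U 1.
Proof.
move=> oU; split=> //.
(* The hypotheses bound [h] by [N] on the cube; the constant is the one in the upper bound for the
   measure of a cube. *)
- exists (2 ^+ n.+1); first by rewrite exprn_gt0.
  move=> a l N v h l0 QU N0 mv h0 hv hN; have mQ : measurable (cube a l : set X) := measurable_cube a l.
  have c0 : 0 < (2 * l) ^+ n.+1 by rewrite exprn_gt0// mulr_gt0.
  have hle x : cube a l x -> h x <= N.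
    move=> Qx; rewrite -lee_fin; apply: le_trans (hv x Qx) _.
    rewrite -[N%:E]mule1; apply: le_trans (lee_wpmul2l _ hN); last by rewrite lee_fin ltW.
    rewrite /rho -ge0_integralZl_EFin//; [|by move=> y _; rewrite lee_fin powR_ge0| |exact: ltW].
      apply: lower_integral_le => // y Qy; rewrite ?lee_fin ?nm1_ge0// -?EFinM ?lee_fin ?mulr_ge0 ?powR_ge0 ?(ltW N0)//.
      by rewrite powRr1 ?mulr_ge0 ?nm1_ge0 ?invr_ge0 ?(ltW N0)// mulVKf ?gt_eqF// !mul1mx.
    apply/measurable_EFinP; under eq_fun do rewrite powRr1 ?mulr_ge0 ?nm1_ge0 ?invr_ge0 ?(ltW N0)// mul1mx.
    by apply: measurable_funM; [exact: measurable_cst|exact: measurable_nm1].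
  apply: (@le_trans _ _ (\int[mu]_(x in (cube a l : set X)) (((2 * l) ^+ n.+1)^-1)%:E)%E).
    apply: lower_integral_le => // x Qx; rewrite ?lee_fin ?powR_ge0 ?invr_ge0 ?(ltW c0)//.
    have e : 2 ^+ n.+1 * N * l ^+ n.+1 = N * (2 * l) ^+ n.+1 by rewrite exprMn mulrCA mulrA.
    have d0 : 0 < N * (2 * l) ^+ n.+1 by rewrite mulr_gt0.
    rewrite e powRr1; last by rewrite mulr_ge0 ?h0 ?invr_ge0 ?(ltW d0).
    rewrite invfM mulrAC -ler_pdivlMr ?invr_gt0// divff ?gt_eqF ?invr_gt0//.
    by rewrite ler_pdivrMl// mulr1 hle.
  rewrite integral_cst//.
  apply: (@le_trans _ _ ((((2 * l) ^+ n.+1)^-1)%:E * ((2 * l) ^+ n.+1)%:E)%E).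
    by apply: lee_wpmul2l; [rewrite lee_fin invr_ge0 ltW|exact: leb_cube_le].
  by rewrite -EFinM mulVf ?gt_eqF.
- exists 0 => // x y r _ _ _ _ _; by rewrite subrr normr0 mul0r.
Qed.

(** Times a cutoff, [g1 - g2] has vanishing mollifications, because the mollifier centred at x times
    the cutoff is a test function; these mollifications converge to it in L^1. *)
Lemma weak_partial_unique U j f g1 g2 : open U -> loc_integrable U f ->
  weak_partial U j f g1 -> weak_partial U j f g2 ->
  {ae mu, forall x : X, U x -> g1 x = g2 x}.
Proof.
move=> oU lf w1 w2; have w := weak_partialB oU lf lf w1 w2; have [lg _] := w.
have lff := loc_integrableB oU lf lf.
suff h i : {ae mu, forall x : X, exhaust U i x -> g1 x = g2 x}.
  have /ae_foralln : forall i, {ae mu, forall x : X, exhaust U i x -> g1 x = g2 x} := h.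
  apply: leb_aeS => x hx Ux; have [i ix] := exhaust_cover oU Ux; exact: hx ix.
pose u x := (g1 x - g2 x) * cutoff U i x.
have tz := cutoff_test U i.
have su : summable u := loc_integrable_testM oU lg tz.
have Tu k x : mollify k u x = 0.
  have tm : test_function setT (mollifier k : Rn -> R) := mollifier_test k.
  have [sm _ _] := test_function_reflect x tm.
  have t := test_functionMs oU tz sm.
  have := weak_partialE oU lff w t.
  rewrite (_ : (fun y : X => (f y - f y) * _) = cst 0); last first.
    by apply/funext => y; rewrite subrr mul0r.
  rewrite Rintegral_cst// mul0r => /esym/eqP; rewrite oppr_eq0 => /eqP <-.
  by rewrite /mollify /conv; congr Rintegral; apply/funext => y; rewrite /u mulrCA.
have mu_ : measurable_fun setT (u : X -> R) := summable_measurable su.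
pose v (x : Rn) : 'cV[R]_1 := u x *: delta_mx 0 0.
have sv : summable_vec v := summable_vec_coord 0 su.
have nv x : nm1 (1%:M *m v x) = `|u x|.
  by rewrite mul1mx /nm1 !big_ord1 !mxE !eqxx mulr1.
have mU := open_measurable_leb oU.
have adm := admissible_unweighted 1 oU.
have v0 x : ~ exhaust U i.+2 x -> v x = 0.
  by move=> /cutoff_eq0 z; rewrite /v /u z mulr0 scale0r.
have rE : rho mu (fun=> 1) (U : set X) (fun x : X => nm1 (1%:M *m v x)) =
    (\int[mu]_(x in (U : set X)) `|(u x)%:E|)%E.
  by apply: eq_integral => x _; rewrite nv powRr1.
have roo : (rho mu (fun=> 1%R) (U : set X) (fun x : X => nm1 (1%:M *m v x)%R) < +oo)%E.
  rewrite rE; have /summable_integrable/integrableP[_] := su.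
  by apply: le_lt_trans; apply: lower_integral_le.
have cv := mollify_converges adm sv v0 roo.
have z0 : rho mu (fun=> 1) (U : set X) (fun x : X => nm1 (1%:M *m v x)) = 0%E.
  apply/eqP; rewrite eq_le rho_ge0 andbT; apply/lee_addgt0Pr => e e0; rewrite add0e.
  have [k kP] := mollifiable_near cv e0.
  apply: le_trans (kP k (leqnn k)); apply: le_rho => // x _.
  rewrite mollify_vec_coord; last exact: su.
  by rewrite Tu scale0r sub0r mulmxN nm1N nm1_ge0 lexx.
move: z0; rewrite rE => /(@ae_eq_integral_abs _ X R mu (U : set X) mU) h.
have {}h : ae_eq mu (U : set X) (EFin \o (u : X -> R)) (cst 0%E).
  by apply: h; apply/measurable_EFinP; exact: measurable_funTS.
apply: leb_aeS h => x h ix; have := h (exhaust_sub ix).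
by rewrite /= /u cutoff_eq1// mulr1 => -[] /eqP; rewrite subr_eq0 => /eqP.
Qed.

End weak_derivative_unique.

(** * Comparison of modular and norm *)

Section modular_and_norm.
Local Open Scope classical_set_scope.
Local Open Scope ring_scope.
Context {R : realType} {n : nat}.
Local Notation Rn := 'cV[R]_n.+1.
Local Notation X := (lebT R n).
Local Notation mu := (leb R n).
Variables (p : Rn -> \bar R) (P : Rn -> R) (U : set Rn) (PM : R).
Hypotheses (pE : forall x, U x -> p x = (P x)%:E) (mU : measurable (U : set X))
  (mP : measurable_fun (U : set X) (P : X -> R))
  (P1 : forall x, U x -> 1 <= P x) (PPM : forall x, U x -> P x <= PM).

Lemma modularE (f : Rn -> R) (l : R) : 0 < l -> (forall x, U x -> 0 <= f x) ->
  modular p U (fun x => l^-1%:E * (f x)%:E)%E = rho mu P (U : set X) (fun x : X => l^-1 * f x).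
Proof.
move=> l0 f0; rewrite /modular.
set S := [set x | _].
have S0 : S = set0.
  by rewrite -subset0 => x [Ux]; rewrite pE.
rewrite S0 setD0 (_ : Linfty_norm _ _ = 0%E) ?adde0.
  apply: eq_integral => x /set_mem Ux; rewrite (pE Ux) -EFinM abse_EFin poweR_EFin.
  by rewrite ger0_norm// mulr_ge0 ?invr_ge0 ?(ltW l0) ?f0.
apply/eqP; rewrite eq_le Linfty_norm_ge0 andbT; apply: ereal_inf_lbound; split=> //.
exact: aeW.
Qed.

Lemma Lp_norm_le (f g : Rn -> R) (l : R) : 0 < l -> (forall x, U x -> 0 <= f x <= g x) ->
  (rho mu P (U : set X) (fun x : X => l^-1 * g x)%R <= 1)%E ->
  (Lp_norm p U (fun x => (f x)%:E) <= l%:E)%E.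
Proof.
move=> l0 fg g1; apply: ereal_inf_lbound; exists l => //; split=> //.
rewrite (modularE l0 (fun x Ux => proj1 (andP (fg x Ux)))).
apply: le_trans g1; apply: le_rho => // [x /P1|x /fg/andP[f0 fg']].
  exact: le_trans.
by rewrite mulr_ge0 ?invr_ge0 ?(ltW l0)//= ler_wpM2l// invr_ge0 ltW.
Qed.

(** A finite norm bounds the modular of f / l by 1 for some [l], and boundedness of the exponent
    permits scaling back. *)
Lemma rho_lty_Lp_norm (f g : Rn -> R) (c : R) : measurable_fun (U : set X) (g : X -> R) ->
  0 <= c -> (forall x, U x -> 0 <= f x) -> (forall x, U x -> 0 <= g x <= c * f x) ->
  (Lp_norm p U (fun x => (f x)%:E) < +oo)%E -> (rho mu P (U : set X) (g : X -> R) < +oo)%E.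
Proof.
move=> mg c0 f0 gf foo; have ffin : Lp_norm p U (fun x => (f x)%:E) \is a fin_num.
  by rewrite ge0_fin_numE// Lp_norm_ge0.
have [l [l0 _]] : exists l, [/\ 0 < l, l < fine (Lp_norm p U (fun x => (f x)%:E)) + 1 &
    (modular p U (fun x => l^-1%:E * (f x)%:E) <= 1)%E].
  by apply: Lp_norm_lt; rewrite -[ltLHS]fineK// lte_fin ltrDl.
rewrite (modularE l0 f0) => r1.
(* [a >= 1] is needed for scaling, and [a >= c * l] gives g / a <= f / l. *)
pose a := c * l + 1; have cl0 : 0 <= c * l by rewrite mulr_ge0// ltW.
have a1 : 1 <= a by rewrite /a lerDr.
have a0 : 0 < a := lt_le_trans ltr01 a1.
have mg' : measurable_fun (U : set X) (fun x : X => a^-1 * g x).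
  by apply: measurable_funM => //; exact: measurable_cst.
have g0 x : U x -> 0 <= a^-1 * g x.
  by move=> /gf/andP[g0 _]; rewrite mulr_ge0// invr_ge0 ltW.
rewrite (_ : g = fun x => a * (a^-1 * g x)); last by apply/funext => x; rewrite mulVKf// gt_eqF.
have rz := rhoZ_le mu mU mP P1 PPM mg' g0 a1.
apply: le_lt_trans rz _.
rewrite lte_mul_pinfty ?lee_fin ?powR_ge0//; apply: le_lt_trans (ltry 1); apply: le_trans r1.
apply: le_rho => // [x /P1|x Ux]; first exact: le_trans.
rewrite g0//= ler_pdivrMl//; have /andP[_ h] := gf x Ux; apply: le_trans h _.
rewrite mulrA -subr_ge0 -mulrBl mulr_ge0 ?f0// /a mulrDl mul1r mulfK ?gt_eqF//.
by rewrite addrC addKr invr_ge0 ltW.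
Qed.

Lemma Lp_norm_lty (f g : Rn -> R) : measurable_fun (U : set X) (g : X -> R) ->
  (forall x, U x -> 0 <= f x <= g x) -> (rho mu P (U : set X) (g : X -> R) < +oo)%E ->
  (Lp_norm p U (fun x => (f x)%:E) < +oo)%E.
Proof.
move=> mg fg goo; have g0 x : U x -> 0 <= g x by move=> /fg/andP[]; exact: le_trans.
have gfin : rho mu P (U : set X) (g : X -> R) \is a fin_num by rewrite ge0_fin_numE// rho_ge0.
pose r := fine (rho mu P (U : set X) (g : X -> R)).
have r0 : 0 <= r by rewrite fine_ge0// rho_ge0.
have l0 : 0 < r + 1 by rewrite ltr_wpDl.
apply: le_lt_trans (ltry (r + 1)); apply: (Lp_norm_le l0 fg).
have l1 : 0 <= (r + 1)^-1 <= 1 by rewrite invr_ge0 ltW//= invf_le1// lerDr.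
apply: le_trans (rhoZ_le1 mu mU mP P1 mg g0 l1) _.
by rewrite -(fineK gfin) -/r -EFinM lee_fin mulrC ler_pdivrMr// mul1r lerDl.
Qed.

(** Dividing by [e] costs e^-PM, which the assumed smallness cancels. *)
Lemma Lp_norm_small (f g : Rn -> R) (e : R) : 0 < e <= 1 ->
  measurable_fun (U : set X) (g : X -> R) -> (forall x, U x -> 0 <= f x <= g x) ->
  (rho mu P (U : set X) (g : X -> R) <= (e `^ PM)%:E)%E ->
  (Lp_norm p U (fun x => (f x)%:E) <= e%:E)%E.
Proof.
move=> /andP[e0 e1] mg fg ge; have g0 x : U x -> 0 <= g x by move=> /fg/andP[]; exact: le_trans.
apply: (Lp_norm_le e0 fg).
have ei : 1 <= e^-1 by rewrite invf_ge1.
apply: le_trans (rhoZ_le mu mU mP P1 PPM mg g0 ei) _.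
apply: (@le_trans _ _ ((e^-1 `^ PM)%:E * (e `^ PM)%:E)%E).
  by apply: lee_wpmul2l => //; rewrite lee_fin powR_ge0.
by rewrite -EFinM lee_fin -powRM ?invr_ge0 ?(ltW e0)// mulVf ?gt_eqF// powR1.
Qed.

(* The weights 2 ^ j.+1 avoid the convexity of the modular: each term is at
   most 2 ^- j.+1 times the largest of the 2 ^ j.+1 * u j. *)
Lemma powR_sum_le (r : R) (N : nat) (u : nat -> R) : 0 < r -> (forall j, 0 <= u j) ->
  (\sum_(j < N) u j) `^ r <= \sum_(j < N) ((2 ^ j.+1)%:R * u j) `^ r.
Proof.
move=> r0 u0; set S := \sum_(j < N) _ `^ r.
have S0 : 0 <= S by apply: sumr_ge0 => j _; exact: powR_ge0.
pose s := S `^ r^-1.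
have rV : r^-1 != 0 by rewrite invr_eq0 gt_eqF.
have sr : s `^ r = S by rewrite -powRrM mulVf ?gt_eqF// powRr1.
rewrite -sr; apply: ge0_ler_powR; rewrite ?nnegrE ?powR_ge0 ?sumr_ge0 ?(ltW r0)//.
have us (j : 'I_N) : u j <= s / (2 ^ j.+1)%:R.
  have p2 : 0 < (2 ^ j.+1)%:R :> R by rewrite ltr0n expn_gt0.
  rewrite ler_pdivlMr// mulrC.
  have t0 : 0 <= (2 ^ j.+1)%:R * u j by rewrite mulr_ge0.
  have tE : (2 ^ j.+1)%:R * u j = (((2 ^ j.+1)%:R * u j) `^ r) `^ r^-1.
    by rewrite -powRrM mulfV ?gt_eqF// powRr1.
  rewrite [leLHS]tE.
  apply: ge0_ler_powR; rewrite ?nnegrE ?invr_ge0 ?powR_ge0 ?S0 ?(ltW r0)//.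
  by rewrite /S (bigD1 j)//= lerDl sumr_ge0// => i _; exact: powR_ge0.
have s0 : 0 <= s by exact: powR_ge0.
apply: (le_trans (ler_sum _ (fun j _ => us j))).
rewrite (_ : \sum_(j < N) s / (2 ^ j.+1)%:R = s * (1 - (2 ^ N)%:R^-1)).
  by rewrite ler_piMr// gerDl oppr_le0 invr_ge0.
elim: (N) => [|m IH]; first by rewrite big_ord0 expn0 invr1 subrr mulr0.
rewrite big_ord_recr/= IH -mulrDr; congr (_ * _).
have h : (2 ^ m)%:R != 0 :> R by rewrite pnatr_eq0 -lt0n expn_gt0.
by rewrite expnS natrM; field.
Qed.

(** The number of terms needed depends on [x], so the estimate passes through the infinite series.
    The weights of [powR_sum_le] cost (2^(j+1))^PM in the modular; the assumption on [u j]
    compensates, leaving the sum of e / 2^(j+1). *)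
Lemma rho_series_le (u : nat -> Rn -> R) (v : Rn -> R) (e : R) : 0 <= e ->
  (forall j, measurable_fun (U : set X) (u j : X -> R)) -> (forall j x, U x -> 0 <= u j x) ->
  (forall x, U x -> exists N, 0 <= v x <= \sum_(j < N) u j x) ->
  (forall j, (rho mu P (U : set X) (u j : X -> R) <= (e / (2 ^ j.+1)%:R / (2 ^ j.+1)%:R `^ PM)%:E)%E) ->
  (rho mu P (U : set X) (v : X -> R) <= e%:E)%E.
Proof.
move=> e0 mu_ u0 vu ue.
pose w j (x : X) := (((2 ^ j.+1)%:R * u j x) `^ P x)%:E.
have mw j : measurable_fun (U : set X) (w j).
  apply/measurable_EFinP; apply: (measurable_powR_exponent mU mP P1).
  by apply: measurable_funM => //; exact: measurable_cst.
have w0 j x : U x -> (0 <= w j x)%E by move=> _; rewrite lee_fin powR_ge0.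
apply: (@le_trans _ _ (\int[mu]_(x in (U : set X)) \sum_(j <oo) w j x)%E).
  apply: lower_integral_le => // [x _|x Ux|x Ux].
  - by rewrite lee_fin powR_ge0.
  - by apply: nneseries_ge0 => j _ _; exact: w0.
  have [N /andP[v0 vN]] := vu x Ux; have P0 : 0 < P x := lt_le_trans ltr01 (P1 Ux).
  apply: (@le_trans _ _ (\sum_(j < N) w j x)%E); last first.
    rewrite -(big_mkord xpredT (fun j => w j x)).
    by apply: nneseries_lim_ge => *; exact: w0.
  rewrite sumEFin lee_fin; apply: le_trans (powR_sum_le N P0 (u := fun j => u j x) _) => [|j]; last exact: u0.
  by apply: ge0_ler_powR; rewrite ?nnegrE ?(ltW P0)// ?sumr_ge0// => j _; exact: u0.
rewrite integral_nneseries//; apply: le_trans (epsilon_trick0 xpredT e0).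
apply: lee_nneseries => j _; first by move=> _; apply: integral_ge0 => x; exact: w0.
have c1 : 1 <= (2 ^ j.+1)%:R :> R by rewrite ler1n expn_gt0.
apply: le_trans (rhoZ_le mu mU mP P1 PPM (mu_ j) (u0 j) c1) _.
apply: (@le_trans _ _ (((2 ^ j.+1)%:R `^ PM)%:E * (e / (2 ^ j.+1)%:R / (2 ^ j.+1)%:R `^ PM)%:E)%E).
  by apply: lee_wpmul2l => //; rewrite lee_fin powR_ge0.
rewrite -EFinM lee_fin mulrC divfK// gt_eqF// powR_gt0// (lt_le_trans ltr01)//.
Qed.

End modular_and_norm.

(** * Partition of unity *)

Section partition_of_unity.
Local Open Scope classical_set_scope.
Local Open Scope ring_scope.
Context {R : realType} {n : nat}.
Local Notation Rn := 'cV[R]_n.+1.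
Local Notation X := (lebT R n).
Local Notation mu := (leb R n).
Implicit Types (U : set Rn) (x : Rn).

Lemma nbhs_exhaust U i x : exhaust U i x -> \forall y \near x, exhaust U i.+1 y.
Proof.
move=> ix; apply/nbhs_normP; exists (gap i) => /=; first exact: gap_gt0.
by move=> y /= xy; exact: exhaust_ball ix (ltW xy).
Qed.

(** The cutoffs shifted by one and preceded by 0, so that the sum of the first [N] differences
    [piece U j] telescopes to [cut U N]. *)
Definition cut U j : Rn -> R := if j is i.+1 then cutoff U i else fun=> 0.

Definition piece U j x : R := cut U j.+1 x - cut U j x.

Lemma cut_smooth U j : smooth_on setT (cut U j).
Proof.
case: j => [|j] /=; first exact: smooth_on_cst openT.
by have [] := cutoff_test U j.
Qed.

Lemma cut_eq0 U j x : ~ exhaust U j.+1 x -> cut U j x = 0.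
Proof. by case: j => [//|j] /cutoff_eq0. Qed.

Lemma cut_eq1 U i j x : exhaust U i x -> (i < j)%N -> cut U j x = 1.
Proof. by case: j => [//|j] ix; rewrite ltnS => ij; exact: cutoff_eq1 (exhaust_mono ij ix). Qed.

(** One level more is lost than for the values, as the cutoff has to be 1 on a neighbourhood of
    [x]. *)
Lemma derive_cut_eq0 U i j c x : exhaust U i x -> (i.+1 < j)%N ->
  'D_(basis_vec c) (cut U j) x = 0.
Proof.
move=> ix ij; rewrite (@near_eq_derive _ _ _ _ (cst (1 : R))) ?derive_cst//.
by apply: filterS (nbhs_exhaust ix) => y iy; exact: cut_eq1 iy ij.
Qed.

Lemma piece_eq0 U i j x : exhaust U i x -> (i < j)%N -> piece U j x = 0.
Proof. by move=> ix ij; rewrite /piece !(cut_eq1 ix) ?subrr//; exact: leqW. Qed.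

Lemma derive_piece U j c x : 'D_(basis_vec c) (piece U j) x =
  'D_(basis_vec c) (cut U j.+1) x - 'D_(basis_vec c) (cut U j) x.
Proof.
case: (is_deriveB (smooth_on_is_derive c (cut_smooth U j.+1) (I : setT x))
  (smooth_on_is_derive c (cut_smooth U j) (I : setT x))) => _ <-.
by [].
Qed.

Lemma derive_piece_eq0 U i j c x : exhaust U i x -> (i.+1 < j)%N ->
  'D_(basis_vec c) (piece U j) x = 0.
Proof.
by move=> ix ij; rewrite derive_piece !(derive_cut_eq0 _ ix) ?subrr//; exact: leqW.
Qed.

Lemma sum_piece U i N x : exhaust U i x -> (i < N)%N -> \sum_(j < N) piece U j x = 1.
Proof.
move=> ix iN; rewrite -(big_mkord xpredT (piece U ^~ x)) telescope_sumr// (cut_eq1 ix iN).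
by rewrite /= subr0.
Qed.

Lemma sum_derive_piece U i N c x : exhaust U i x -> (i.+1 < N)%N ->
  \sum_(j < N) 'D_(basis_vec c) (piece U j) x = 0.
Proof.
move=> ix iN; under eq_bigr do rewrite derive_piece.
rewrite -(big_mkord xpredT (fun j => 'D_(basis_vec c) (cut U j.+1) x - 'D_(basis_vec c) (cut U j) x)).
rewrite (telescope_sumr (fun j => 'D_(basis_vec c) (cut U j) x))//.
by rewrite (derive_cut_eq0 c ix iN) /= derive_cst subr0.
Qed.

Lemma piece_test_exhaust U j : test_function (exhaust U j.+2) (piece U j).
Proof.
apply: (test_functionP _ (@exhaust_compact R n U j.+2)) => //.
  exact: smooth_onB openT (cut_smooth U j.+1) (cut_smooth U j).
move=> x nx; have nx' : ~ exhaust U j.+1 x by move=> /(exhaust_mono (leqnSn j.+1)).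
by rewrite /piece (cut_eq0 nx) (cut_eq0 nx') subrr.
Qed.

Lemma piece_test U j : test_function U (piece U j).
Proof. by apply: test_function_sub (piece_test_exhaust U j); exact: exhaust_sub. Qed.

End partition_of_unity.

(** * Smooth approximation *)

Section smooth_approximation.
Local Open Scope classical_set_scope.
Local Open Scope ring_scope.
Context {R : realType} {n : nat}.
Local Notation Rn := 'cV[R]_n.+1.
Local Notation X := (lebT R n).
Local Notation mu := (leb R n).
Variables (d : nat) (P : Rn -> R) (W : Rn -> 'M[R]_d) (U : set Rn) (PM : R).
Hypothesis adm : admissible P W U PM.
Variables (f : Rn -> 'cV[R]_d) (G : Rn -> 'M[R]_(d, n.+1)).
Hypotheses (lf : forall i, loc_integrable U (fun x => f x i 0)) (fG : weak_jacobian U f G).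
Local Notation rhoU := (rho mu P (U : set X)).
Let B (x : Rn) := nm1 (W x *m f x) + nm1 (W x *m G x).
Hypothesis (Boo : (rhoU B < +oo)%E).

Let oU : open U. Proof. exact: adm_open adm. Qed.
Let mU : measurable (U : set X). Proof. exact: open_measurable_leb oU. Qed.
Let lG i c : loc_integrable U (fun x => G x i c). Proof. by have [] := fG i c. Qed.

(* The target f is indexed by None, the columns of its Jacobian by Some c. *)
Definition target (c : option 'I_n.+1) x : 'cV[R]_d := if c is Some c then col c (G x) else f x.

(** For [Some c], the c-th column of the weak Jacobian of [piece U j *: f] by the product rule; its
    mollification is the classical derivative of the mollified piece. *)
Definition target_piece (c : option 'I_n.+1) j x : 'cV[R]_d :=
  if c is Some c then piece U j x *: col c (G x) + 'D_(basis_vec c) (piece U j) x *: f x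
  else piece U j x *: f x.

Lemma target_piece_summable c j : summable_vec (target_piece c j).
Proof.
have t := piece_test U j.
case: c => [c|] a /=.
  have s1 := loc_integrable_testM oU (lG a c) t.
  have s2 := loc_integrable_testM oU (lf a) (test_function_partial c t).
  have := summableD s1 s2; congr summable; apply/funext => x.
  by rewrite !mxE mulrC [in X in _ + X]mulrC.
have := loc_integrable_testM oU (lf a) t; congr summable; apply/funext => x.
by rewrite !mxE mulrC.
Qed.

Lemma target_piece_supp c j x : ~ exhaust U j.+2 x -> target_piece c j x = 0.
Proof.
move=> nx; have t := piece_test_exhaust U j; have p0 := test_function_eq0 t nx.
case: c => [c|] /=; rewrite p0 scale0r// add0r.
by rewrite (test_function_eq0 (test_function_partial c t) nx) scale0r.
Qed.

Lemma target_piece_eq0 c i j x : exhaust U i x -> (i.+1 < j)%N -> target_piece c j x = 0.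
Proof.
move=> ix ij; have p0 := piece_eq0 ix (ltnW ij).
case: c => [c|] /=; rewrite p0 scale0r// add0r.
by rewrite (derive_piece_eq0 c ix ij) scale0r.
Qed.

(** The pieces sum to 1 near [x], so their derivatives sum to 0 and no trace of the cutoffs is
    left. *)
Lemma sum_target_piece c i N x : exhaust U i x -> (i.+1 < N)%N ->
  \sum_(j < N) target_piece c j x = target c x.
Proof.
move=> ix iN; have s1 := sum_piece ix (ltnW iN).
case: c => [c|] /=; last by rewrite -scaler_suml s1 scale1r.
by rewrite big_split/= -!scaler_suml s1 (sum_derive_piece c ix iN) scale1r scale0r addr0.
Qed.

Lemma target_piece_rho c j : (rhoU (fun x : X => nm1 (W x *m target_piece c j x))%R < +oo)%E.
Proof.
have t := piece_test U j.
(* [rhoZ_le] asks for [C >= 1], hence the summand 1 in the witnesses. *)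
have [C C1 le] : exists2 C, 1 <= C & forall x, nm1 (W x *m target_piece c j x) <= C * B x.
  have [C1 C10 pC1] := test_function_bounded t.
  case: c => [c|] /=; last first.
    exists (C1 + 1); first by rewrite lerDr.
    move=> x; rewrite -scalemxAr nm1Z mulrDl mul1r ler_wpDr ?addr_ge0 ?nm1_ge0//.
    by rewrite ler_pM ?nm1_ge0// lerDl nm1_ge0.
  have [C2 C20 pC2] := test_function_bounded (test_function_partial c t).
  exists (C1 + C2 + 1); first by rewrite lerDr addr_ge0.
  move=> x; rewrite mulmxDr -!scalemxAr; apply: le_trans (nm1D _ _) _; rewrite !nm1Z.
  rewrite mulrDl mul1r ler_wpDr ?addr_ge0 ?nm1_ge0// mulrDl; apply: lerD.
    apply: ler_pM; rewrite ?nm1_ge0// colE mulmxA -colE.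
    rewrite /B ler_wpDl ?nm1_ge0// [leRHS]nm1_cols (bigD1 c)//= lerDl sumr_ge0// => *.
    exact: nm1_ge0.
  by apply: ler_pM; rewrite ?nm1_ge0// /B lerDl nm1_ge0.
have mB : measurable_fun (U : set X) (B : X -> R).
  have mf : measurable_mx (U : set X) (f : X -> 'cV[R]_d).
    by move=> i k; rewrite ord1; have [] := lf i.
  have mG : measurable_mx (U : set X) (G : X -> 'M[R]_(d, n.+1)).
    by move=> i k; have [] := lG i k.
  apply: measurable_funD; apply: measurable_nm1.
    exact: measurable_mxM (adm_weight adm) mf.
  exact: measurable_mxM (adm_weight adm) mG.
have B0 x : U x -> 0 <= B x by rewrite /B addr_ge0 ?nm1_ge0.
have rz := rhoZ_le mu mU (adm_measurable adm) (adm_ge1 adm) (adm_le adm) mB B0 C1.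
have Coo : ((C `^ PM)%:E * rhoU B < +oo)%E by rewrite lte_mul_pinfty ?lee_fin ?powR_ge0.
apply: le_lt_trans Coo.
apply: le_trans rz; apply: le_rho => // x Ux; last by rewrite nm1_ge0 le.
exact: le_trans (adm_ge1 adm Ux).
Qed.

Lemma target_piece_mollifiable c j : mollifiable P W U (target_piece c j).
Proof.
exact: (mollify_converges adm (target_piece_summable c j) (@target_piece_supp c j)
  (target_piece_rho c j)).
Qed.

(** One scale [k] has to serve the field and all columns of its Jacobian, since the approximant and
    its derivatives come from the same mollification. *)
Lemma mollifiable_near_sum (I : Type) (r : seq I) (v : I -> Rn -> 'cV[R]_d) (e : R) :
  (forall i, summable_vec (v i)) -> (forall i, mollifiable P W U (v i)) -> 0 < e ->
  exists k0 : nat, forall k, (k0 <= k)%N ->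
    (rhoU (fun x : X => \sum_(i <- r) nm1 (W x *m (mollify_vec k (v i) x - v i x)))%R <= e%:E)%E.
Proof.
move=> sv mv; elim: r e => [|i r IH] e e0.
  exists 0%N => k _; rewrite /rho integral0_eq ?lee_fin ?(ltW e0)// => x Ux.
  by rewrite big_nil powR0// gt_eqF// (lt_le_trans _ (adm_ge1 adm Ux)).
pose c : R := 2 `^ PM; have c0 : 0 < c by rewrite powR_gt0.
have e'0 : 0 < e / 2 / c by rewrite !divr_gt0.
have [k1 k1P] := IH _ e'0; have [k2 k2P] := mollifiable_near (mv i) e'0.
exists (maxn k1 k2) => k; rewrite geq_max => /andP[/k1P h1 /k2P h2].
under eq_fun do rewrite big_cons.
have mi i' : measurable_fun (U : set X) (fun x : X => nm1 (W x *m (mollify_vec k (v i') x - v i' x))).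
  apply: measurable_nm1; apply: measurable_mxM (adm_weight adm) _.
  apply: measurable_mxD; first exact: mollify_vec_measurable.
  by apply: measurable_mxN; exact: summable_vec_measurable.
have mr : measurable_fun (U : set X)
    (fun x : X => \sum_(i <- r) nm1 (W x *m (mollify_vec k (v i) x - v i x))).
  by apply: measurable_sum => i'; exact: mi.
have := rhoD_le mu mU (adm_measurable adm) (adm_ge1 adm) (adm_le adm) (mi i) mr
  (fun x _ => nm1_ge0 _) (fun x _ => sumr_ge0 _ (fun i' _ => nm1_ge0 _)).
move=> /le_trans; apply; rewrite -/c.
apply: (@le_trans _ _ (c%:E * ((e / 2 / c)%:E + (e / 2 / c)%:E))%E).
  by apply: lee_wpmul2l; [rewrite lee_fin ltW|exact: leeD h2 h1].
by rewrite -EFinD -EFinM lee_fin -mulrDl mulrC divfK ?gt_eqF// -splitr.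
Qed.

End smooth_approximation.

(** * Gluing the mollified pieces *)

Section meyers_serrin.
Local Open Scope classical_set_scope.
Local Open Scope ring_scope.
Context {R : realType} {n : nat}.
Local Notation Rn := 'cV[R]_n.+1.
Local Notation X := (lebT R n).
Local Notation mu := (leb R n).
Variables (d : nat) (P : Rn -> R) (W : Rn -> 'M[R]_d) (U : set Rn) (PM : R).
Hypothesis adm : admissible P W U PM.

Definition classical_jacobian (g : Rn -> 'cV[R]_d) x : 'M[R]_(d, n.+1) :=
  \matrix_(i, c) 'D_(basis_vec c) (fun y => g y i 0) x.

Theorem smooth_modular_approximation (f : Rn -> 'cV[R]_d) (G : Rn -> 'M[R]_(d, n.+1)) (e : R) :
  (forall i, loc_integrable U (fun x => f x i 0)) -> weak_jacobian U f G ->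
  (rho mu P (U : set X) (fun x : X => nm1 (W x *m f x) + nm1 (W x *m G x))%R < +oo)%E -> 0 < e ->
  exists2 g : Rn -> 'cV[R]_d, smooth_vector U g &
    (rho mu P (U : set X) (fun x : X => nm1 (W x *m (f x - g x)) +
      nm1 (W x *m (G x - classical_jacobian g x)))%R <= e%:E)%E.
Proof.
move=> lf fG Boo e0; have oU := adm_open adm; have mU := open_measurable_leb oU.
pose T := target_piece U f G.
pose cs : seq (option 'I_n.+1) := None :: map Some (index_enum 'I_n.+1).
pose u j k x := \sum_(c <- cs) nm1 (W x *m (mollify_vec k (T c j) x - T c j x)).
(* The precision demanded by [rho_series_le]. *)
pose de j : R := e / (2 ^ j.+1)%:R / (2 ^ j.+1)%:R `^ PM.
have de0 j : 0 < de j by rewrite !divr_gt0// ?powR_gt0// ltr0n expn_gt0.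
have sT c j : summable_vec (T c j) := target_piece_summable adm lf fG c j.
(* The lower bound on the scale makes the mollified piece [j] vanish on level i once j > i + 2, so
   that the sum is locally finite. *)
have ex j : exists k, (j.+1 * j.+2 <= k)%N /\ (rho mu P (U : set X) (u j k : X -> R) <= (de j)%:E)%E.
  have [k0 k0P] := mollifiable_near_sum adm cs (fun c => sT c j)
    (fun c => target_piece_mollifiable adm lf fG Boo c j) (de0 j).
  by exists (maxn k0 (j.+1 * j.+2)); rewrite leq_maxr; split=> //; exact: k0P (leq_maxl _ _).
have [ks ksP] := choice ex.
pose H c j x := mollify_vec (ks j) (T c j) x.
have H0 c i j x : exhaust U i x -> (i.+2 < j)%N -> H c j x = 0.
  move=> ix ij; apply/matrixP => a b; rewrite !mxE; apply: mollify_eq0 => y xy.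
  have iy : exhaust U i.+1 y.
    have iks : (i.+1 * i.+2 <= ks j)%N.
      have ij' : (i <= j)%N by rewrite ltnW// ltnW// ltnW.
      by apply: leq_trans (proj1 (ksP j)); apply: leq_mul.
    exact: exhaust_ball ix (le_trans xy (gap_le iks)).
  by rewrite /T (target_piece_eq0 f G c iy ij) mxE.
have stable c i N x : exhaust U i x -> (i.+2 < N)%N ->
    \sum_(j < N) H c j x = \sum_(j < i.+3) H c j x.
  move=> ix iN; rewrite -(subnKC iN); elim: (N - i.+3)%N => [|m IH]; first by rewrite addn0.
  by rewrite addnS big_ord_recr/= IH (H0 c i)// ?addr0// leq_addr.
(* The choice of a level containing [x] is immaterial: by [stable] all further terms vanish. *)
pose g x := \sum_(j < (xget 0%N [set i | exhaust U i x]).+3) H None j x.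
have gE i N x : exhaust U i x -> (i.+2 < N)%N -> g x = \sum_(j < N) H None j x.
  move=> ix iN; rewrite /g; set i0 := xget _ _.
  have i0x : exhaust U i0 x.
    by have := @xgetPex _ 0%N [set i | exhaust U i x] (ex_intro _ i ix).
  rewrite -(stable _ _ (maxn N i0.+3) _ i0x) ?leq_maxr// (stable _ _ _ _ ix) ?leq_max ?iN//.
  by rewrite (stable _ _ _ _ ix).
have HE c N x a : (\sum_(j < N) H c j x) a 0 =
    \sum_(j < N) mollify (ks j) (fun z => T c j z a 0) x.
  by rewrite summxE; apply: eq_bigr => j _; rewrite mxE.
have smT c j a : smooth_on setT (mollify (ks j) (fun z => T c j z a 0)).
  exact: mollify_smooth (sT c j a).
(* One term more than for the value at [x], because the neighbours are only known to lie in level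
   [i.+1]. *)
have gnear i N x a : exhaust U i x -> (i.+3 < N)%N ->
    \forall y \near x, g y a 0 = \sum_(j < N) mollify (ks j) (fun z => T None j z a 0) y.
  move=> ix iN; apply: filterS (nbhs_exhaust ix) => y iy.
  by rewrite (gE _ _ _ iy iN) HE.
have dT c j a x : is_derive x (basis_vec c) (mollify (ks j) (fun z => T None j z a 0))
    (mollify (ks j) (fun z => T (Some c) j z a 0) x).
  have := mollify_is_derive (ks j) x oU (lf a) (fG a c) (piece_test U j).
  rewrite (_ : (fun x => f x a 0 * piece U j x) = (fun z => T None j z a 0)); last first.
    by apply/funext => z; rewrite !mxE mulrC.
  rewrite (_ : (fun x => _ + _) = (fun z => T (Some c) j z a 0))//.
  by apply/funext => z; rewrite !mxE mulrC [in X in _ + X = _]mulrC.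
have dS c N a x : is_derive x (basis_vec c)
    (fun y => \sum_(j < N) mollify (ks j) (fun z => T None j z a 0) y)
    (\sum_(j < N) mollify (ks j) (fun z => T (Some c) j z a 0) x).
  elim: N => [|N IH].
    rewrite big_ord0 (_ : (fun y => _) = cst 0); first exact: is_derive_cst.
    by apply/funext => y; rewrite big_ord0.
  rewrite big_ord_recr/= (_ : (fun y => _) =
    (fun y => \sum_(j < N) mollify (ks j) (fun z => T None j z a 0) y) +
    mollify (ks N) (fun z => T None N z a 0)).
    exact: is_deriveD IH (dT c N a x).
  by apply/funext => y; rewrite big_ord_recr.
have JE i N x a c : exhaust U i x -> (i.+3 < N)%N ->
    classical_jacobian g x a c = (\sum_(j < N) H (Some c) j x) a 0.
  move=> ix iN; rewrite mxE HE (near_eq_derive _ (gnear i N x a ix iN)).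
  by case: (dS c N a x).
exists g.
  move=> a; apply: smooth_on_local => x Ux; have [i ix] := exhaust_cover oU Ux.
  have gn : nbhs (x : Rn) [set y | g y a 0 = \sum_(j < i.+4) mollify (ks j) (fun z => T None j z a 0) y].
    exact: gnear ix (leqnn _).
  move: gn; rewrite nbhsE => -[V oVx VE].
  exists V, (fun y => \sum_(j < i.+4) mollify (ks j) (fun z => T None j z a 0) y); first exact: oVx.
  split=> //; apply: (@smooth_on_sub _ _ setT) => //.
  exact: (smooth_on_sum (index_enum 'I_i.+4) openT (fun j : 'I_i.+4 => smT None j a)).
have mu_ j : measurable_fun (U : set X) (u j (ks j) : X -> R).
  apply: measurable_sum => c; apply: measurable_nm1; apply: measurable_mxM (adm_weight adm) _.
  apply: measurable_mxD; first exact: mollify_vec_measurable (sT c j).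
  by apply: measurable_mxN; exact: summable_vec_measurable (sT c j).
have u0 j x : U x -> 0 <= u j (ks j) x by move=> _; apply: sumr_ge0 => c _; exact: nm1_ge0.
apply: (rho_series_le mU (adm_measurable adm) (adm_ge1 adm) (adm_le adm) (ltW e0) mu_ u0).
  move=> x Ux; have [i ix] := exhaust_cover oU Ux; exists i.+4.
  rewrite addr_ge0 ?nm1_ge0//=.
  (* The target is the sum of its own pieces, so the error splits piece by piece. *)
  have tE c : nm1 (W x *m (target f G c x - \sum_(j < i.+4) H c j x)) <=
      \sum_(j < i.+4) nm1 (W x *m (H c j x - T c j x)).
    rewrite -(sum_target_piece f G c ix (N := i.+4)); last exact: leqW (leqW (leqnn _)).
    rewrite -sumrB mulmx_sumr; apply: le_trans (nm1_sum _ _) _.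
    apply: ler_sum => j _; by rewrite -opprB mulmxN nm1N.
  rewrite (eq_bigr (fun j : 'I_i.+4 => nm1 (W x *m (H None j x - T None j x)) +
    \sum_c nm1 (W x *m (H (Some c) j x - T (Some c) j x)))); last first.
    by move=> j _; rewrite /u big_cons big_map.
  rewrite big_split; apply: lerD.
    by have := tE None; rewrite -(gE i i.+4 x ix (leqnSn _)).
  rewrite nm1_cols [leRHS]exchange_big; apply: ler_sum => c _; apply: le_trans (tE (Some c)).
  rewrite colE -mulmxA -colE le_eqVlt; apply/orP; left; apply/eqP; congr (nm1 (_ *m _)).
  apply/matrixP => a b; rewrite ord1 [RHS]mxE [X in _ = _ + X]mxE.
  by rewrite -(JE i i.+4 x a c ix (leqnn _)) !mxE.
by move=> j; have [] := ksP j.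
Qed.

End meyers_serrin.

(** * From log-Hoelder continuity and A_p to admissibility *)

Section admissible_of_Ap.
Local Open Scope classical_set_scope.
Local Open Scope ring_scope.
Context {R : realType} {n : nat}.
Local Notation Rn := 'cV[R]_n.+1.
Local Notation X := (lebT R n).
Local Notation mu := (leb R n).
Variables (p : Rn -> \bar R) (Omega : set Rn).

Lemma enorm_le_maxnorm (x : Rn) : enorm x <= n.+1%:R * `|x|.
Proof.
apply: le_trans (enorm_le_nm1 x) _; rewrite /nm1 (le_trans (ler_sum _ (G := fun=> `|x|) _))//.
  by move=> i _; rewrite big_ord1; exact: normcV_coord.
by rewrite sumr_const card_ord mulr_natl.
Qed.

(** Since ln(e + |x|) >= 1, the decay condition bounds [p] at every point and rules out the value
    +oo. *)
Lemma log_Hoelder_bounded : exponent p Omega -> log_Hoelder p Omega ->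
  exists PM, forall x, Omega x -> p x = (fine (p x))%:E /\ fine (p x) <= PM.
Proof.
move=> [_ p1] [C0 [Coo [poo [_ h]]]]; exists (poo + `|Coo|) => x Ox.
have l1 : 1 <= ln (expR 1 + enorm x).
  by rewrite -{1}[1]expRK ler_ln ?posrE ?expR_gt0 ?lerDl ?enorm_ge0// ltr_wpDr ?enorm_ge0 ?expR_gt0.
have Cl : Coo / ln (expR 1 + enorm x) <= `|Coo|.
  rewrite ler_pdivrMr ?(lt_le_trans ltr01 l1)//; apply: le_trans (ler_norm _) _.
  by rewrite ler_peMr.
have := h x Ox; have := p1 x Ox; case: (p x) => [r| |]//= _.
rewrite lee_fin => hr; split=> //.
by rewrite -lerBlDl (le_trans (ler_norm _))// (le_trans hr).
Qed.

(** The Euclidean norm is at most n+1 times the maximum norm, and t -> 1 / (- ln t) increases on (0,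
    1); the absolute value of [C0] takes care of its sign. *)
Lemma log_Hoelder_maxnorm : (forall x, Omega x -> p x = (fine (p x))%:E) ->
  log_Hoelder p Omega ->
  exists2 C : R, 0 <= C & forall x y r, Omega x -> Omega y -> `|x - y| <= r -> 0 < r ->
    n.+1%:R * r < 2^-1 -> `|fine (p x) - fine (p y)| <= C / - ln (n.+1%:R * r).
Proof.
move=> pE [C0 [Coo [poo [h _]]]]; exists `|C0| => // x y r Ox Oy xy r0 r2.
have nr0 : 0 < n.+1%:R * r by rewrite mulr_gt0.
have lr : 0 < - ln (n.+1%:R * r).
  rewrite oppr_gt0; apply: ln_lt0; rewrite nr0 (lt_trans r2)// invf_lt1// ltr1n.
  by [].
have er : enorm (x - y) <= n.+1%:R * r.
  by apply: le_trans (enorm_le_maxnorm _) _; rewrite ler_wpM2l.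
have := h x y Ox Oy (le_lt_trans er r2).
rewrite (pE x Ox) (pE y Oy) -EFinB abse_EFin lee_fin => /le_trans; apply.
(* For x = y the given bound is 0, by the conventions ln 0 = 0 and 0^-1 = 0. *)
have [e0|e0] := eqVneq (enorm (x - y)) 0.
  by rewrite e0 ln0// oppr0 invr0 mulr0 divr_ge0// ltW.
have {}e0 : 0 < enorm (x - y) by rewrite lt_def e0 enorm_ge0.
have le : ln (enorm (x - y)) <= ln (n.+1%:R * r) by rewrite ler_ln ?posrE.
have el : 0 < - ln (enorm (x - y)) by rewrite (lt_le_trans lr)// lerN2.
apply: (@le_trans _ _ (`|C0| / - ln (enorm (x - y)))).
  by rewrite ler_wpM2r ?ler_norm// invr_ge0 ltW.
by rewrite ler_wpM2l// lef_pV2 ?posrE// lerN2.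
Qed.

Lemma admissible_of_Ap d (W : Rn -> 'M[R]_d) : open Omega -> exponent p Omega ->
  log_Hoelder p Omega -> matrix_Ap p W Omega ->
  (forall x, Omega x -> p x = (fine (p x))%:E) /\
  exists PM, admissible (fun x => fine (p x)) W Omega PM.
Proof.
move=> oO ep lH [ Omega' [oO' sub ep' [_ mW _] [uW Ap]]].
have [PM PMP] := log_Hoelder_bounded ep lH.
have pE x : Omega x -> p x = (fine (p x))%:E by move=> /PMP[].
have mO := open_measurable_leb oO; have mO' := open_measurable_leb oO'.
split; first exact: pE.
exists PM; split.
- exact: oO.
- have [mp _] := ep; apply/measurable_EFinP.
  by apply: eq_measurable_fun mp => x /set_mem Ox; exact: pE.
- by move=> x Ox; rewrite -lee_fin -(pE x Ox); exact: ep.2.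
- by move=> x /PMP[].
- by move=> i j; exact: measurable_funS mO' sub (mW i j).
- exact: averaging_of_Ap oO' sub ep' mW uW pE Ap.
- exact: log_Hoelder_maxnorm pE lH.
Qed.

End admissible_of_Ap.

(** * Sobolev spaces in terms of the modular *)

Section sobolev_and_modular.
Local Open Scope classical_set_scope.
Local Open Scope ring_scope.
Context {R : realType} {n : nat}.
Local Notation Rn := 'cV[R]_n.+1.
Local Notation X := (lebT R n).
Local Notation mu := (leb R n).
Variables (d : nat) (p : Rn -> \bar R) (W : Rn -> 'M[R]_d) (U : set Rn) (PM : R).
Hypothesis (pE : forall x, U x -> p x = (fine (p x))%:E)
  (adm : admissible (fun x => fine (p x)) W U PM).
Local Notation rhoU := (rho mu (fun x => fine (p x)) (U : set X)).
Implicit Types (f g : Rn -> 'cV[R]_d) (G : Rn -> 'M[R]_(d, n.+1)).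

Let oU : open U. Proof. exact: adm_open adm. Qed.
Let mU : measurable (U : set X). Proof. exact: open_measurable_leb oU. Qed.

Lemma leb_ae_forall_ord m (Q : 'I_m -> X -> Prop) : (forall i, {ae mu, forall x, Q i x}) ->
  {ae mu, forall x, forall i, Q i x}.
Proof.
move=> QA; pose P k x := forall i : 'I_m, i = k :> nat -> Q i x.
have /ae_foralln : forall k, {ae mu, forall x, P k x}.
  move=> k; have [km|mk] := ltnP k m.
    by apply: leb_aeS (QA (Ordinal km)) => x Qx l lk; rewrite (_ : l = Ordinal km)//; exact: val_inj.
  by apply: aeW => x l lk; move: (ltn_ord l); rewrite lk ltnNge mk.
by apply: leb_aeS => x h i; exact: (h i i erefl).
Qed.

Lemma weak_jacobian_unique f G1 G2 : (forall i, loc_integrable U (fun x => f x i 0)) ->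
  weak_jacobian U f G1 -> weak_jacobian U f G2 -> {ae mu, forall x : X, U x -> G1 x = G2 x}.
Proof.
move=> lf w1 w2.
have h := leb_ae_forall_ord (fun i => leb_ae_forall_ord (fun c =>
  weak_partial_unique oU (lf i) (w1 i c) (w2 i c))).
by apply: leb_aeS h => x h Ux; apply/matrixP => i c; exact: h.
Qed.

Definition weighted_size f G x : R := nm1 (W x *m f x) + nm1 (W x *m G x).

Let measurable_W_vec f : (forall i, loc_integrable U (fun x => f x i 0)) ->
  measurable_fun (U : set X) (fun x : X => nm1 (W x *m f x)).
Proof.
move=> lf; apply: measurable_nm1; apply: measurable_mxM (adm_weight adm) _ => i j.
by rewrite ord1; have [] := lf i.
Qed.

Let measurable_W_jac f G : weak_jacobian U f G ->
  measurable_fun (U : set X) (fun x : X => nm1 (W x *m G x)).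
Proof.
move=> fG; apply: measurable_nm1; apply: measurable_mxM (adm_weight adm) _ => i j.
by have [[]] := fG i j.
Qed.

Let mP := adm_measurable adm.

Let weighted_size_ge0 f G x : 0 <= weighted_size f G x.
Proof. by rewrite /weighted_size addr_ge0 ?nm1_ge0. Qed.

Lemma weakDP f : sobolev11loc U f -> weak_jacobian U f (weakD U f).
Proof. by move=> [_ [G fG]]; exact: (@xgetPex _ _ [set G | weak_jacobian U f G] (ex_intro _ G fG)). Qed.

Lemma sobolevW_rho f : sobolevW p W U f -> (rhoU (weighted_size f (weakD U f)) < +oo)%E.
Proof.
move=> [sf foo]; have fD := weakDP sf; have [lf _] := sf.
move: foo; rewrite /sobolev_norm.
set N1 := weighted_norm _ _ _ _; set N2 := Lp_norm _ _ _ => foo.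
have N10 : (0 <= N1)%E by exact: Lp_norm_ge0.
have N20 : (0 <= N2)%E by exact: Lp_norm_ge0.
have N1oo : (N1 < +oo)%E by exact: le_lt_trans (leeDl _ N20) foo.
have N2oo : (N2 < +oo)%E by exact: le_lt_trans (leeDr _ N10) foo.
have m1 := measurable_W_vec lf; have m2 := measurable_W_jac fD.
have r1 := rho_lty_Lp_norm pE mU mP (adm_ge1 adm) (adm_le adm) m1 (ler0n R d)
  (fun x _ => enorm_ge0 _) (fun x _ => introT andP (conj (nm1_ge0 _) (nm1_le_enorm _))) N1oo.
have r2 := rho_lty_Lp_norm pE mU mP (adm_ge1 adm) (adm_le adm) m2 (ler0n R (d * n.+1))
  (fun x _ => opnorm_ge0 _) (fun x _ => introT andP (conj (nm1_ge0 _) (nm1_le_opnorm _))) N2oo.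
apply: le_lt_trans (rhoD_le mu mU mP (adm_ge1 adm) (adm_le adm) m1 m2
  (fun x _ => nm1_ge0 _) (fun x _ => nm1_ge0 _)) _.
by apply: lte_mul_pinfty; [rewrite lee_fin powR_ge0|by []|exact: lte_add_pinfty r1 r2].
Qed.

Section norm_of_modular.
Variables (f : Rn -> 'cV[R]_d) (G : Rn -> 'M[R]_(d, n.+1)).
Hypotheses (lf : forall i, loc_integrable U (fun x => f x i 0)) (fG : weak_jacobian U f G).

Let sf : sobolev11loc U f. Proof. by split; [exact: lf|exists G]. Qed.

Let rho_vec : (rhoU (fun x : X => nm1 (W x *m f x)) <= rhoU (weighted_size f G))%E.
Proof.
apply: le_rho => // x Ux; first exact: le_trans (adm_ge1 adm Ux).
by rewrite nm1_ge0 lerDl nm1_ge0.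
Qed.

(** [weakD] is just some weak Jacobian; it agrees almost everywhere with [G], which is all that the
    integral sees. *)
Let rho_jac : (rhoU (fun x : X => nm1 (W x *m weakD U f x)) <= rhoU (weighted_size f G))%E.
Proof.
rewrite (_ : rhoU _ = rhoU (fun x : X => nm1 (W x *m G x))).
  apply: le_rho => // x Ux; first exact: le_trans (adm_ge1 adm Ux).
  by rewrite nm1_ge0 lerDr nm1_ge0.
have m1 := measurable_W_jac (weakDP sf); have m2 := measurable_W_jac fG.
apply: (@ge0_ae_eq_integral _ X R mu).
- exact: mU.
- by apply/measurable_EFinP; exact: (measurable_powR_exponent mU mP (adm_ge1 adm) m1).
- by apply/measurable_EFinP; exact: (measurable_powR_exponent mU mP (adm_ge1 adm) m2).
- by move=> x _; rewrite lee_fin powR_ge0.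
- by move=> x _; rewrite lee_fin powR_ge0.
by apply: leb_aeS (weak_jacobian_unique lf (weakDP sf) fG) => x h Ux; rewrite h.
Qed.

Lemma sobolevW_of_rho : (rhoU (weighted_size f G) < +oo)%E -> sobolevW p W U f.
Proof.
move=> foo; split; first exact: sf.
rewrite /sobolev_norm lte_add_pinfty//.
  apply: (Lp_norm_lty pE mU mP (adm_ge1 adm) (measurable_W_vec lf)).
    by move=> x _; rewrite enorm_ge0 enorm_le_nm1.
  exact: le_lt_trans rho_vec foo.
apply: (Lp_norm_lty pE mU mP (adm_ge1 adm) (measurable_W_jac (weakDP sf))).
  by move=> x _; rewrite opnorm_ge0 opnorm_le_nm1.
exact: le_lt_trans rho_jac foo.
Qed.

Lemma sobolev_norm_small (e : R) : 0 < e <= 1 ->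
  (rhoU (weighted_size f G) <= (e `^ PM)%:E)%E -> (sobolev_norm p W U f <= (e + e)%:E)%E.
Proof.
move=> e1 fe; rewrite /sobolev_norm EFinD; apply: leeD.
  apply: (Lp_norm_small pE mU mP (adm_ge1 adm) (adm_le adm) e1 (measurable_W_vec lf)).
    by move=> x _; rewrite enorm_ge0 enorm_le_nm1.
  exact: le_trans rho_vec fe.
apply: (Lp_norm_small pE mU mP (adm_ge1 adm) (adm_le adm) e1 (measurable_W_jac (weakDP sf))).
  by move=> x _; rewrite opnorm_ge0 opnorm_le_nm1.
exact: le_trans rho_jac fe.
Qed.

End norm_of_modular.

Lemma sobolevW_sub_sobolevH : sobolevW p W U `<=` sobolevH p W U.
Proof.
move=> f Wf; split=> // e e0; have [sf _] := Wf; have [lf _] := sf.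
have fD := weakDP sf; have foo := sobolevW_rho Wf.
(* Both parts of the Sobolev norm will be at most [a], and [a + a < e]. *)
pose a := Num.min 1 (e / 3); have a0 : 0 < a by rewrite lt_min ltr01 divr_gt0.
have a1 : 0 < a <= 1 by rewrite a0 ge_min lexx.
have aP0 : 0 < a `^ PM by rewrite powR_gt0.
have [g sg ge] := smooth_modular_approximation adm lf fD foo aP0.
pose J := classical_jacobian g.
have lg i : loc_integrable U (fun x => g x i 0) := smooth_loc_integrable oU (sg i).
have gJ : weak_jacobian U g J.
  move=> i c; have := smooth_weak_partial c oU (sg i); congr weak_partial.
  by apply/funext => x; rewrite mxE.
pose h x := f x - g x; pose D x := weakD U f x - J x.
have lh i : loc_integrable U (fun x => h x i 0).
  by under eq_fun do rewrite !mxE; exact: loc_integrableB oU (lf i) (lg i).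
have hD : weak_jacobian U h D.
  move=> i c; under eq_fun do rewrite !mxE; under [X in weak_partial _ _ _ X]eq_fun do rewrite !mxE.
  have := weak_partialB oU (lf i) (lg i) (fD i c) (gJ i c).
  by congr weak_partial; apply/funext => x; rewrite !mxE.
have hn := sobolev_norm_small lh hD a1 ge.
exists g; last first.
  apply: le_lt_trans hn _; rewrite lte_fin.
  have : a <= e / 3 by rewrite ge_min lexx orbT.
  lra.
split; first exact: sg.
apply: (sobolevW_of_rho lg gJ).
have mf : measurable_fun (U : set X) (weighted_size f (weakD U f) : X -> R).
  by apply: measurable_funD; [exact: measurable_W_vec lf|exact: measurable_W_jac fD].
have mh : measurable_fun (U : set X) (weighted_size h D : X -> R).
  by apply: measurable_funD; [exact: measurable_W_vec lh|exact: measurable_W_jac hD].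
have hoo : (rhoU (weighted_size h D) < +oo)%E by exact: le_lt_trans ge (ltry _).
(* The approximant lies in the Sobolev space because g = f - h with both modulars finite. *)
apply: le_lt_trans (_ : _ <= rhoU (fun x : X => weighted_size f (weakD U f) x + weighted_size h D x)%R)%E _.
  apply: le_rho => // x Ux; first exact: le_trans (adm_ge1 adm Ux).
  rewrite weighted_size_ge0 /weighted_size addrACA; apply: lerD.
    rewrite (_ : g x = f x - h x); last by rewrite /h opprB addrC subrK.
    by rewrite mulmxBr (le_trans (nm1D _ _))// nm1N.
  rewrite -/(J x) (_ : J x = weakD U f x - D x); last by rewrite /D opprB addrC subrK.
  by rewrite mulmxBr (le_trans (nm1D _ _))// nm1N.
apply: le_lt_trans (rhoD_le mu mU mP (adm_ge1 adm) (adm_le adm) mf mh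
  (fun x _ => weighted_size_ge0 _ _ x) (fun x _ => weighted_size_ge0 _ _ x)) _.
by apply: lte_mul_pinfty; [rewrite lee_fin powR_ge0|by []|exact: lte_add_pinfty foo hoo].
Qed.

End sobolev_and_modular.

Local Open Scope classical_set_scope.
Local Open Scope ring_scope.
Local Open Scope ereal_scope.

(** One inclusion is part of the definition of [sobolevH]; the other is the density of smooth
    fields, once the hypotheses have been turned into admissibility of the real exponent
    [fine (p x)]. *)
Theorem theorem1p4 (R : realType) (n d : nat) (Omega : set 'cV[R]_n.+1)
    (p : 'cV[R]_n.+1 -> \bar R) (W : 'cV[R]_n.+1 -> 'M[R]_d) :
  (0 < d)%N ->
  open Omega ->
  exponent p Omega ->
  1 <= ess_inf_on Omega p ->
  ess_inf_on Omega p <= ess_sup_on Omega p ->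
  ess_sup_on Omega p < +oo ->
  log_Hoelder p Omega ->
  matrix_Ap p W Omega ->
  sobolevW p W Omega = sobolevH p W Omega.
Proof.
move=> _ oO ep _ _ _ lH Ap; have [pE [PM adm]] := admissible_of_Ap oO ep lH Ap.
apply/seteqP; split; first exact: sobolevW_sub_sobolevH pE adm.
by move=> f [].
Qed.
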